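(* Let $\mu$ be a probability measure on $\mathcal{C}_{x_0}M$. Suppose that for some $r_0>0$ and some constant $C>0$, with $\beta(s)=C\log\frac1s$, the weak logarithmic Sobolev inequality $$\mathrm{Ent}(f^2)\leqslant\beta(s)\int|\nabla f|^2\,d\mu+s|f|_\infty^2$$ holds for all $0<s<r_0$ and all bounded measurable functions $f$ in $\mathbb{D}^{1,2}$. Then there is a constant $\alpha>0$ such that the Poincar\'e inequality $$\mathrm{Var}(f)\leqslant\alpha\int|\nabla f|^2\,d\mu$$ holds for all $f\in\mathbb{D}^{1,2}$.
   Context: Fix $T>0$, a smooth finite dimensional, stochastically complete Riemannian manifold $M$, and $x_0\in M$. Let $\mathcal{C}_{x_0}M=\{\sigma:[0,T]\to M \text{ continuous},\ \sigma(0)=x_0\}$ with the uniform distance. Let $\mu$ be a Borel probability measure on $\mathcal{C}_{x_0}M$, possibly concentrated on a subspace such as the loop space $\{\sigma:\sigma(T)=x_0\}$. Integrals with respect to $\mu$ are denoted $\mathbf{E}$; $\mathrm{Var}(f)=\mathbf{E}(f-\mathbf{E}f)^2$, $\mathrm{Ent}(g)=\mathbf{E}\,g\log\frac{g}{\mathbf{E}g}$ for $g\geqslant0$, and $|\cdot|_\infty$ is the $L^\infty(\mu)$ norm. Fix a metric connection on $M$ with skew-symmetric torsion and let $/\!/_s:T_{x_0}M\to T_{\sigma(s)}M$ be the ($\mu$-a.s. defined) parallel translation along $\sigma$. The Bismut tangent space is $$H_\sigma=\{(/\!/_sk_s)_{0\leqslant s\leqslant T}:k\in L_0^{2,1}(T_{x_0}M)\},\qquad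 \langle/\!/_\cdot k,/\!/_\cdot l\rangle_{H_\sigma}=\int_0^T\langle\dot k_s,\dot l_s\rangle ds,$$ where $L_0^{2,1}(T_{x_0}M)$ is the Cameron-Martin space of absolutely continuous paths $k:[0,T]\to T_{x_0}M$ with $k_0=0$ and $\int_0^T|\dot k_s|^2ds<\infty$ (with in addition $k_T=0$ when $\mu$ is carried by paths with fixed end point). A smooth cylindrical function is $F(\sigma)=f(\sigma_{s_1},\dots,\sigma_{s_k})$, $f\in C_K^\infty(M^k)$ (smooth, compactly supported), $0<s_1<\dots<s_k\leqslant t$ for some $t<T$. Its differential is $dF(\sigma)(h)=\sum_i\partial_if(\sigma_{s_1},\dots,\sigma_{s_k})(h_{s_i})$ for $h\in H_\sigma$, and $\nabla F(\sigma)\in H_\sigma$ is defined by $\langle\nabla F(\sigma),h\rangle_{H_\sigma}=dF(\sigma)(h)$. Standing assumption: this operator is closable in $L^2(\mu)$ (which holds when Driver's integration by parts formula holds). $\mathbb{D}^{1,2}$ is the closure of the smooth cylindrical functions under the graph norm $\big(\int|\nabla f|_{H_\sigma}^2d\mu+\int f^2d\mu\big)^{1/2}$, $\nabla$ also denotes the closed operator, and $|\nabla f|=|\nabla f|_{H_\sigma}$. *)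

(* Defs.v *)
From HB Require Import structures.
From mathcomp Require Import all_boot all_order all_algebra.
From mathcomp Require Import all_classical all_reals all_analysis.

Set Implicit Arguments.
Unset Strict Implicit.
Unset Printing Implicit Defensive.

Import Order.TTheory GRing.Theory Num.Theory.
Import numFieldNormedType.Exports.

Local Open Scope classical_set_scope.
Local Open Scope ring_scope.

(* All iterated directional derivatives of order at most [m] exist and are
   continuous on the open set [U]; for finite dimensional [V] this is C^m. *)
Fixpoint Cm_on (R : realType) (V W : normedModType R) (m : nat) (U : set V)
    (f : V -> W) : Prop :=
  (forall x, U x -> {for x, continuous f}) /\
  match m with
  | 0%N => True
  | m'.+1 => forall v : V,
      (forall x, U x -> derivable f x v) /\ Cm_on m' U (fun x => 'D_v f x)
  end.

Definition smooth_on (R : realType) (V W : normedModType R) (U : set V)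
    (f : V -> W) : Prop := forall m, Cm_on m U f.

Record chart (R : realType) (M : topologicalType) (n : nat) := Chart {
  chart_dom : set M ;
  chart_fun : M -> 'rV[R]_n ;
  chart_inv : 'rV[R]_n -> M }.

Section Charts.
Variables (R : realType) (M : topologicalType) (n : nat).
Implicit Types c : chart R M n.

Definition chart_cod c : set 'rV[R]_n := chart_fun c @` chart_dom c.

Definition is_chart c : Prop :=
  [/\ open (chart_dom c), open (chart_cod c),
      (forall p, chart_dom c p -> chart_inv c (chart_fun c p) = p),
      (forall p, chart_dom c p -> {for p, continuous (chart_fun c)}) &
      (forall y, chart_cod c y -> {for y, continuous (chart_inv c)})].

Definition smooth_atlas (A : set (chart R M n)) : Prop :=
  [/\ (forall c, A c -> is_chart c),
      (forall p, exists2 c, A c & chart_dom c p) &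
      (forall c c', A c -> A c' ->
         smooth_on (chart_fun c @` (chart_dom c `&` chart_dom c'))
                   (chart_fun c' \o chart_inv c))].

Variable A : set (chart R M n).

Definition smooth_fun (f : M -> R) : Prop :=
  forall c, A c -> smooth_on (chart_cod c) ((f \o chart_inv c) : _ -> R^o).

Definition compactly_supported (f : M -> R) : Prop :=
  exists2 K : set M, compact K & forall p, ~ K p -> f p = 0.

(* Smoothness on the product manifold [M^k], in products of charts: the [i]-th
   row of the matrix is the coordinate vector of the [i]-th point. *)
Definition smooth_fun_prod (k : nat) (f : ('I_k -> M) -> R) : Prop :=
  forall c : 'I_k -> chart R M n, (forall i, A (c i)) ->
    smooth_on [set y : 'M[R]_(k, n) | forall i, chart_cod (c i) (row i y)]
      ((fun y => f (fun i => chart_inv (c i) (row i y))) : _ -> R^o).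

(* A closed subset of [M^k] is compact iff it lies in some [K^k], [K] compact. *)
Definition compactly_supported_prod (k : nat) (f : ('I_k -> M) -> R) : Prop :=
  exists2 K : set M, compact K &
    forall x : 'I_k -> M, ~ (forall i, K (x i)) -> f x = 0.

(* Tangent vectors are derivations of the algebra of smooth functions.  As they
   are represented by functionals on all functions [M -> R], they are required
   to vanish on non-smooth functions, so that [=] is equality of derivations. *)
Definition tvec := (M -> R) -> R.

Definition tangent (p : M) (v : tvec) : Prop :=
  [/\ (forall f, ~ smooth_fun f -> v f = 0),
      (forall a f h, smooth_fun f -> smooth_fun h ->
         v (fun q => a * f q + h q) = a * v f + v h) &
      (forall f h, smooth_fun f -> smooth_fun h ->
         v (fun q => f q * h q) = f p * v h + h p * v f)].

Definition vfield := M -> tvec.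

Definition vf_app (X : vfield) (f : M -> R) : M -> R := fun p => X p f.

Definition smooth_vfield (X : vfield) : Prop :=
  (forall p, tangent p (X p)) /\
  (forall f, smooth_fun f -> smooth_fun (vf_app X f)).

Definition bracket (X Y : vfield) : vfield :=
  fun p f => X p (vf_app Y f) - Y p (vf_app X f).

Definition inner_product_on (p : M) (g : tvec -> tvec -> R) : Prop :=
  [/\ (forall a u v w, tangent p u -> tangent p v -> tangent p w ->
         g (fun f => a * u f + v f) w = a * g u w + g v w),
      (forall u v, tangent p u -> tangent p v -> g u v = g v u) &
      (forall u, tangent p u -> u <> (fun=> 0) -> 0 < g u u)].

Definition riemannian_metric (g : M -> tvec -> tvec -> R) : Prop :=
  (forall p, inner_product_on p (g p)) /\
  (forall X Y, smooth_vfield X -> smooth_vfield Y ->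
     smooth_fun (fun p => g p (X p) (Y p))).

Definition smooth_curve (gam : R -> M) : Prop :=
  continuous gam /\
  forall f, smooth_fun f -> smooth_on [set: R^o] ((f \o gam) : _ -> R^o).

Definition velocity (gam : R -> M) (t : R) : tvec :=
  fun f => if `[< smooth_fun f >] then derive1 ((f \o gam) : R^o -> R^o) t else 0.

Definition curve_length (g : M -> tvec -> tvec -> R) (gam : R -> M) : \bar R :=
  (\int[lebesgue_measure]_(t in `[0%R, 1%R])
     (Num.sqrt (g (gam t) (velocity gam t) (velocity gam t)))%:E)%E.

End Charts.

(* The (extended) distance of the pseudometric structure is the Riemannian
   distance, i.e. the infimum of the lengths of the curves joining two points;
   that it induces the topology of the manifold is a theorem for every
   Riemannian manifold, so nothing is lost by this presentation. *)
Record riemannianManifold (R : realType) (n : nat) := RiemannianManifold {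
  rm_sort :> pseudoMetricType R ;
  rm_hausdorff : hausdorff_space rm_sort ;
  rm_second_countable : @second_countable rm_sort ;
  rm_atlas : set (chart R rm_sort n) ;
  rm_atlasP : smooth_atlas rm_atlas ;
  rm_metric : rm_sort -> tvec R rm_sort -> tvec R rm_sort -> R ;
  rm_metricP : riemannian_metric rm_atlas rm_metric ;
  rm_distP : forall (p q : rm_sort) (r : R), 0 < r ->
    ball p r q <->
    exists gam : R -> rm_sort,
      [/\ smooth_curve rm_atlas gam, gam 0 = p, gam 1 = q &
          (curve_length rm_atlas rm_metric gam < r%:E)%E] }.

Arguments rm_atlas {R n} M : rename.
Arguments rm_metric {R n} M p u v : rename.

Section Connections.
Variables (R : realType) (n : nat) (M : riemannianManifold R n).
Local Notation vf := (vfield R M).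
Local Notation smooth := (smooth_fun (rm_atlas M)).
Local Notation smoothvf := (smooth_vfield (rm_atlas M)).
Local Notation g := (rm_metric M).

(* [D X Y] is the covariant derivative of [Y] in the direction [X]. *)
Definition connection (D : vf -> vf -> vf) : Prop :=
  [/\ (forall X Y, smoothvf X -> smoothvf Y -> smoothvf (D X Y)),
      (forall a X X' Y, smooth a -> smoothvf X -> smoothvf X' -> smoothvf Y ->
         D (fun p f => a p * X p f + X' p f) Y =
         (fun p f => a p * D X Y p f + D X' Y p f)),
      (forall X Y Y', smoothvf X -> smoothvf Y -> smoothvf Y' ->
         D X (fun p f => Y p f + Y' p f) =
         (fun p f => D X Y p f + D X Y' p f)) &
      (forall a X Y, smooth a -> smoothvf X -> smoothvf Y ->
         D X (fun p f => a p * Y p f) =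
         (fun p f => X p a * Y p f + a p * D X Y p f))].

Definition metric_connection (D : vf -> vf -> vf) : Prop :=
  connection D /\
  forall X Y Z, smoothvf X -> smoothvf Y -> smoothvf Z -> forall p,
    X p (fun q => g q (Y q) (Z q)) =
    g p (D X Y p) (Z p) + g p (Y p) (D X Z p).

Definition torsion (D : vf -> vf -> vf) (X Y : vf) : vf :=
  fun p f => D X Y p f - D Y X p f - bracket X Y p f.

Definition skew_symmetric_torsion (D : vf -> vf -> vf) : Prop :=
  forall X Y Z, smoothvf X -> smoothvf Y -> smoothvf Z -> forall p,
    g p (torsion D X Y p) (Z p) = - g p (torsion D X Z p) (Y p).

Definition levi_civita (D : vf -> vf -> vf) : Prop :=
  metric_connection D /\
  forall X Y, smoothvf X -> smoothvf Y -> torsion D X Y = (fun _ _ => 0).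

(* [h] is the Laplace-Beltrami operator applied to [f]: the trace of the Hessian
   of [f] for the Levi-Civita connection [D]. *)
Definition is_laplacian (D : vf -> vf -> vf) (f h : M -> R) : Prop :=
  forall (p : M) (E : 'I_n -> vf), (forall i, smoothvf (E i)) ->
    (forall i j, g p (E i p) (E j p) = (i == j)%:R) ->
    h p = \sum_(i < n) (E i p (vf_app (E i) f) - D (E i) (E i) p f).

End Connections.

(* The sigma-algebra generated by a family [X] of [M]-valued maps up to time
   [s], [M] being equipped with its Borel sets. *)
Definition history (R : realType) (M : topologicalType) (Om : Type)
    (X : R -> Om -> M) (s : R) : set (set Om) :=
  <<s [set E | exists r B,
         [/\ 0 <= r <= s, open B & E = X r @^-1` B] ]>>.

(* Brownian motion started at [x], with infinite lifetime, as the diffusion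
   generated by half the Laplace-Beltrami operator (martingale problem). *)
Definition brownian_motion (R : realType) (n : nat)
    (M : riemannianManifold R n)
    (D : vfield R M -> vfield R M -> vfield R M) (x : M)
    (d : measure_display) (Om : measurableType d) (P : probability Om R)
    (X : R -> Om -> M) : Prop :=
  [/\ (forall w, X 0 w = x),
      (forall w, {within `[0, +oo[, continuous (X ^~ w)}),
      (forall t B, 0 <= t -> open B -> measurable (X t @^-1` B)) &
      (forall f h, smooth_fun (rm_atlas M) f -> compactly_supported f ->
         is_laplacian D f h ->
         let N t w := f (X t w) -
           2^-1 * Rintegral lebesgue_measure `[0, t] (fun r => h (X r w)) in
         forall s t (E : set Om), 0 <= s <= t -> history X s E ->
           (\int[P]_(w in E) (N t w)%:E = \int[P]_(w in E) (N s w)%:E)%E)].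

Definition stochastically_complete (R : realType) (n : nat)
    (M : riemannianManifold R n) : Prop :=
  exists2 D, levi_civita D & forall x : M,
    exists (d : measure_display) (Om : measurableType d)
           (P : probability Om R) (X : R -> Om -> M),
      brownian_motion D x P X.

(* Paths on [0, T], extended by [x0] outside of [0, T] in order that a path be
   determined by its restriction to [0, T]. *)
Record cpath (R : realType) (M : topologicalType) (T : R) (x0 : M) := CPath {
  cpath_fun :> R -> M ;
  cpath_cont : {within `[0, T], continuous cpath_fun} ;
  cpath0 : cpath_fun 0 = x0 ;
  cpath_out : forall t, ~ (0 <= t <= T) -> cpath_fun t = x0 }.

Section PathType.
Variables (R : realType) (M : topologicalType) (T : R) (x0 : M).

HB.instance Definition _ := gen_eqMixin (cpath T x0).
HB.instance Definition _ := gen_choiceMixin (cpath T x0).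

Definition cst_path : cpath T x0 :=
  @CPath R M T x0 (fun=> x0)
    (fun=> @cst_continuous _ _ x0 _) erefl (fun _ _ => erefl).

HB.instance Definition _ := isPointed.Build (cpath T x0) cst_path.

End PathType.

Section PathSpace.
Variables (R : realType) (M : pseudoMetricType R) (T : R) (x0 : M).

(* The topology of the uniform distance; its Borel sets are the events. *)
Definition uniform_open : set (set (cpath T x0)) :=
  [set O | forall sig : cpath T x0, O sig -> exists2 e : R, 0 < e &
     forall tau : cpath T x0,
       (forall s, 0 <= s <= T -> ball (sig s) e (tau s)) -> O tau].

Definition path_space := g_sigma_algebraType uniform_open.

End PathSpace.

Section Analysis.
Variables (R : realType) (n : nat) (M : riemannianManifold R n) (T : R).
Variables (x0 : M) (mu : probability (path_space T x0) R).
Local Notation Om := (path_space T x0).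
Local Notation tv := (tvec R M).
Local Notation vf := (vfield R M).
Local Notation smooth := (smooth_fun (rm_atlas M)).
Local Notation smoothvf := (smooth_vfield (rm_atlas M)).
Local Notation tan := (tangent (rm_atlas M)).
Local Notation g := (rm_metric M).

Definition coord (t : R) (sig : Om) : M := (sig : cpath T x0) t.

Definition trapezoid_sum (A B : R -> Om -> R) (s : seq R) (sig : Om) : R :=
  let x i := nth 0 (0 :: s) i in
  \sum_(0 <= i < size s)
    2^-1 * (A (x i) sig + A (x i.+1) sig) * (B (x i.+1) sig - B (x i) sig).

(* [I] is the Stratonovich integral of [A] against [B] over [0, t]: the limit
   in probability of the trapezoidal sums as the mesh tends to 0. *)
Definition stratonovich (A B : R -> Om -> R) (t : R) (I : Om -> R) : Prop :=
  measurable_fun setT I /\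
  forall e eta : R, 0 < e -> 0 < eta -> exists2 delta : R, 0 < delta &
    forall s : seq R, itv_partition 0 t s ->
      (forall i, (i < size s)%N ->
         nth 0 (0 :: s) i.+1 - nth 0 (0 :: s) i < delta) ->
      (mu [set sig | (e < `|trapezoid_sum A B s sig - I sig|)%R] <= eta%:E)%E.

(* [par sig s v] is the translate to [T_{sig s} M] of [v] in [T_{x0} M]; it is
   unconstrained on a null set, and adapted up to null sets.  The
   parallel equation is tested against smooth vector fields [Y]: if the
   covariant derivative of [Y] is written [sum_j d phi_j (x) Z_j], then
     d <par v, Y(sig)> = sum_j <par v, Z_j(sig)> o d phi_j(sig)
   in the Stratonovich sense, the connection being metric. *)
Definition stochastic_parallel_translation (D : vf -> vf -> vf)
    (par : Om -> R -> tv -> tv) : Prop :=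
  [/\ {ae mu, forall sig,
        [/\ (forall s v, 0 <= s <= T -> tan x0 v ->
               tan (coord s sig) (par sig s v)),
            (forall s a v w, 0 <= s <= T -> tan x0 v -> tan x0 w ->
               par sig s (fun f => a * v f + w f) =
               (fun f => a * par sig s v f + par sig s w f)),
            (forall s v w, 0 <= s <= T -> tan x0 v -> tan x0 w ->
               g (coord s sig) (par sig s v) (par sig s w) = g x0 v w),
            (forall v, tan x0 v -> par sig 0 v = v) &
            (forall v Y, tan x0 v -> smoothvf Y ->
               {within `[0, T], continuous (fun s : R =>
                  g (coord s sig) (par sig s v) (Y (coord s sig)))})]},
      (forall s v f, 0 <= s <= T -> tan x0 v -> smooth f ->
         measurable_fun setT (fun sig => par sig s v f) /\
         exists2 a : Om -> R,
           (forall B : set R, measurable B -> history coord s (a @^-1` B)) &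
           {ae mu, forall sig, par sig s v f = a sig}) &
      (forall v Y (m : nat) (phi : 'I_m -> M -> R) (Z : 'I_m -> vf),
         tan x0 v -> smoothvf Y ->
         (forall j, smooth (phi j)) -> (forall j, smoothvf (Z j)) ->
         (forall X, smoothvf X -> forall p f,
            D X Y p f = \sum_(j < m) X p (phi j) * Z j p f) ->
         forall t, 0 <= t <= T ->
         exists2 I : 'I_m -> Om -> R,
           (forall j, stratonovich
              (fun s sig => g (coord s sig) (par sig s v) (Z j (coord s sig)))
              (fun s sig => phi j (coord s sig)) t (I j)) &
           {ae mu, forall sig,
              g (coord t sig) (par sig t v) (Y (coord t sig)) - g x0 v (Y x0) =
              \sum_(j < m) I j sig})].

(* Measurability on [S] of a map into the finite dimensional space [T_{x0} M]:
   it is a combination of fixed tangent vectors with measurable coefficients. *)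
Definition measurable_tangent (d : measure_display) (E : measurableType d)
    (S : set E) (u : E -> tv) : Prop :=
  exists (e : 'I_n -> tv) (c : 'I_n -> E -> R),
    [/\ (forall a, tan x0 (e a)), (forall a, measurable_fun S (c a)) &
        (forall w, S w -> forall f, u w f = \sum_(a < n) c a w * e a f)].

Definition absolutely_continuous (a b : R) (k : R -> R) : Prop :=
  forall e : R, 0 < e -> exists2 delta : R, 0 < delta &
    forall (m : nat) (l r : 'I_m -> R),
      (forall i, [/\ a <= l i, l i <= r i & r i <= b]) ->
      (forall i j, i != j -> r i <= l j \/ r j <= l i) ->
      \sum_(i < m) (r i - l i) < delta ->
      \sum_(i < m) `|k (r i) - k (l i)| < e.

Definition Hprod (u w : R -> tv) : \bar R :=
  (\int[lebesgue_measure]_(r in `[0%R, T]) (g x0 (u r) (w r))%:E)%E.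

Definition Hnorm2 (u : R -> tv) : \bar R := Hprod u u.

Definition fixed_end_point : Prop :=
  exists y : M, {ae mu, forall sig : Om, coord T sig = y}.

(* [k] belongs to the Cameron-Martin space of [T_{x0} M] and [u] is its
   derivative; a vector [s |-> par sig s (k s)] of the Bismut tangent space at
   [sig] is represented below by the derivative [u] of [k]. *)
Definition cameron_martin (k u : R -> tv) : Prop :=
  [/\ (forall s, 0 <= s <= T -> tan x0 (k s)) /\ k 0 = (fun=> 0),
      (forall f, smooth f -> absolutely_continuous 0 T (k ^~ f)),
      measurable_tangent (`[0, T] : set (measurableTypeR R)) u /\
      (forall f, smooth f -> {ae lebesgue_measure, forall r : R, 0 < r < T ->
         is_derive r (1 : R) ((k ^~ f) : R -> R^o) (u r f)}),
      (Hnorm2 u < +oo)%E &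
      (fixed_end_point -> k T = (fun=> 0))].

Record cylinder := Cylinder {
  cyl_len : nat ;
  cyl_time : 'I_cyl_len.+1 -> R ;
  cyl_fun : ('I_cyl_len.+1 -> M) -> R }.

Arguments cyl_time : clear implicits.
Arguments cyl_fun : clear implicits.

Definition smooth_cylinder (F : cylinder) : Prop :=
  [/\ smooth_fun_prod (rm_atlas M) (cyl_fun F),
      compactly_supported_prod (cyl_fun F),
      (forall i, 0 < cyl_time F i),
      (forall i j : 'I_(cyl_len F).+1, (i < j)%N ->
         cyl_time F i < cyl_time F j) &
      (exists2 t, t < T & forall i, cyl_time F i <= t)].

Definition cyl_eval (F : cylinder) (sig : Om) : R :=
  cyl_fun F (fun i => coord (cyl_time F i) sig).

Definition cyl_diff (F : cylinder) (sig : Om) (h : R -> tv) : R :=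
  \sum_i h (cyl_time F i)
    (fun y => cyl_fun F (fun j => if j == i then y
                                else coord (cyl_time F j) sig)).

(* The domain of the gradient is the linear span of the smooth cylindrical
   functions: when [M] is not compact a sum of compactly supported functions of
   different times need not be compactly supported.  Scalar multiples of
   cylindrical functions are cylindrical, so sums suffice. *)
Definition cyls_eval (F : seq cylinder) (sig : Om) : R :=
  \sum_(c <- F) cyl_eval c sig.

Definition cyls_diff (F : seq cylinder) (sig : Om) (h : R -> tv) : R :=
  \sum_(c <- F) cyl_diff c sig h.

Definition smooth_cylinders (F : seq cylinder) : Prop :=
  forall i, (i < size F)%N ->
    smooth_cylinder (nth (Cylinder (fun _ : 'I_1 => 0) (fun=> 0)) F i).

Variable par : Om -> R -> tv -> tv.

Definition Hsection (U : Om -> R -> tv) : Prop :=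
  measurable_tangent (setT `*` `[0, T] : set (Om * measurableTypeR R)%type)
    (fun x => U x.1 x.2) /\
  {ae mu, forall sig, exists k, cameron_martin k (U sig)}.

Definition cyl_gradient (F : seq cylinder) (U : Om -> R -> tv) : Prop :=
  [/\ smooth_cylinders F, Hsection U &
      {ae mu, forall sig, forall k u, cameron_martin k u ->
         (Hprod (U sig) u = (cyls_diff F sig (fun s => par sig s (k s)))%:E)%E}].

Definition energy (U : Om -> R -> tv) : \bar R :=
  (\int[mu]_sig Hnorm2 (U sig))%E.

Definition cvg_L2 (F : nat -> Om -> R) (f : Om -> R) : Prop :=
  (\int[mu]_sig ((F j sig - f sig) ^+ 2)%:E)%E @[j --> \oo] --> (0 : \bar R).

Definition cvg_L2H (U : nat -> Om -> R -> tv) (V : Om -> R -> tv) : Prop :=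
  energy (fun sig r f => U j sig r f - V sig r f) @[j --> \oo]
    --> (0 : \bar R).

Definition closable_gradient : Prop :=
  forall (F : nat -> seq cylinder) (U : nat -> Om -> R -> tv) V,
    (forall j, cyl_gradient (F j) (U j)) -> Hsection V ->
    cvg_L2 (fun j => cyls_eval (F j)) (fun=> 0) -> cvg_L2H U V ->
    {ae mu, forall sig, Hnorm2 (V sig) = 0%E}.

(* [f] belongs to the domain D^{1,2} of the closed gradient and [V] is its
   gradient. *)
Definition D12_gradient (f : Om -> R) (V : Om -> R -> tv) : Prop :=
  [/\ measurable_fun setT f,
      (\int[mu]_sig ((f sig) ^+ 2)%:E < +oo)%E,
      Hsection V, (energy V < +oo)%E &
      exists (F : nat -> seq cylinder) (U : nat -> Om -> R -> tv),
        [/\ (forall j, cyl_gradient (F j) (U j)),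
            cvg_L2 (fun j => cyls_eval (F j)) f & cvg_L2H U V]].

Definition entropy (h : Om -> R) : \bar R :=
  (\int[mu]_sig (h sig * ln (h sig / fine ('E_mu[h])))%:E)%E.

End Analysis.

(* Main.v *)
Require Import Defs.
From mathcomp Require Import all_boot all_order all_algebra.
From mathcomp Require Import all_classical all_reals all_analysis.
From mathcomp Require Import measurable_realfun ess_sup_inf ring lra.

(** Let [E F] be the energy of [F], that is, the integral of the square of the
    norm of its gradient.

    _Truncations._  Let [F] exceed [a >= 0] with probability at most [3/4], and
    let [f] be the truncation of [F] to the levels between [b] and [b + t],
    [b >= a].  The function [f^2] lives on the set [F > b]; if [A] is the
    measure of this set, the entropy of [f^2] is at least [log (1/A)] times its
    mean ([entropy_support]).  The weak inequality bounds the same entropy by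
    [C log (1/s) E f + s t^2].  Choose [s] proportional to [A]: then
    [log (1/s)] and [log (1/A)] are comparable and cancel, which is where the
    growth of [beta] enters, while [s t^2] is a small multiple of [A t^2].
    Hence [t^2 mu (F > b + t)] is at most a multiple of [E f] plus
    [t^2 mu (F > b) / 8] ([level_step]).  For the dyadic levels
    [b = a + t], [t = lam 2^k], the energies [E f] add up to at most [E F],
    because the truncations have their gradients on disjoint level sets
    ([energy_levels]).  Summing over [k], the second terms are absorbed by the
    left-hand side, and the layer cake formula bounds the mean of [(F - a)_+^2]
    by a multiple of [E F] ([weighted_tail]).  Used for [F] and [- F] this
    bounds the mean of [F^2] ([two_sided_bound]).

    _Medians._  If constants were in the domain with gradient zero, this could
    be applied to [F - m], where [m] is a median of [F], and would end the
    proof.  But cylindrical functions are compactly supported, and when [M] is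
    not compact the constant [1] need not be a limit of them.  There are two
    cases.  Either there are cylindrical functions [u] close to [1] in
    [L^2] and of small energy; then [F - m u] takes the role of [F - m]
    ([poincare_near_one]).  Or there are none; then the energy of [F] controls
    [m^2]: a truncation of [2 F / m] takes values in the unit interval, is [1]
    with probability at least [1/2], and if its energy were small, the weak
    inequality would make its entropy small and thus place it close to [1] in
    [L^2], since the entropy dominates the distance to a constant
    ([entropy_L2], [near_one_truncation], [median_energy], [poincare_far]).

    _Domains._  The weak inequality is available in the domain of the closed
    gradient, so truncations have to be placed there.  Polynomials without
    constant term operate on cylindrical functions ([cyls_poly]).  There are
    such polynomials with derivatives in the unit interval, converging to the
    truncation from above at one level, whose derivatives converge at every
    point; for differences [P_k] of two of them, the gradients
    [P_k' (F) nabla F] converge by domination ([step_approx], [D12_trunc]).  At the level of truncation itself the limit of the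
    derivatives is some number in the unit interval, so nothing has to be known
    about the gradient of [F] on the set where [F] takes that value.  Sums of
    gradients have to be measurable sections again, that is, measurable
    combinations of [n] fixed derivations at [x0]; this rests on the fact that
    the derivations at a point span a space of dimension at most [n]
    ([tangent_span]), which follows from Hadamard's lemma and a bump
    function. *)

Import Order.TTheory GRing.Theory Num.Theory.
Import numFieldNormedType.Exports.

Local Open Scope classical_set_scope.
Local Open Scope ring_scope.

Set Implicit Arguments.
Unset Strict Implicit.
Unset Printing Implicit Defensive.

(** * Functions with continuous iterated directional derivatives *)

Section Calculus.
Context {R : realType}.
Implicit Types V W : normedModType R.

Lemma Cm_onS V W m (U : set V) (f : V -> W) : Cm_on m.+1 U f -> Cm_on m U f.
Proof.
elim: m f => [|m IH] f [cf df]; first by split.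
by split=> // v; have [dv /IH] := df v.
Qed.

Lemma Cm_onW V W m (U U' : set V) (f : V -> W) :
  U' `<=` U -> Cm_on m U f -> Cm_on m U' f.
Proof.
move=> UU'; elim: m f => [|m IH] f [cf df]; split=> //.
- by move=> x /UU'/cf.
- by move=> x /UU'/cf.
- by move=> v; have [dv /IH ?] := df v; split=> // x /UU'/dv.
Qed.

(** Continuity and derivability at the points of [U] refer to neighbourhoods in
    the whole space, so the condition on [U] is a condition at each point; this
    allows to work in neighbourhoods that depend on the point. *)
Lemma Cm_on_pointwise V W m (U : set V) (f : V -> W) :
  (forall x, U x -> Cm_on m [set x] f) -> Cm_on m U f.
Proof.
elim: m f => [|m IH] f H; split=> //.
- by move=> x /H[/(_ x erefl)].
- by move=> x /H[/(_ x erefl)].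
- move=> v; split; first by move=> x /H[_ /(_ v)[/(_ x erefl)]].
  by apply: IH => x /H[_ /(_ v)[]].
Qed.

Lemma Cm_on_eq V W m (U : set V) (f g : V -> W) : open U ->
  (forall x, U x -> f x = g x) -> Cm_on m U f -> Cm_on m U g.
Proof.
move=> oU; elim: m f g => [|m IH] f g fg [cf df].
  split=> // x Ux; have := cf _ Ux; rewrite /prop_for /continuous_at -fg//.
  apply: cvg_trans; apply: near_eq_cvg.
  by have := open_nbhs_nbhs (conj oU Ux); apply: filterS => y /fg.
have near_fg x : U x -> \forall y \near x, f y = g y.
  by move=> Ux; have := open_nbhs_nbhs (conj oU Ux); apply: filterS => y /fg.
split.
  move=> x Ux; have := cf _ Ux; rewrite /prop_for /continuous_at -fg//.
  by apply: cvg_trans; apply: near_eq_cvg; exact: near_fg.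
move=> v; have [dv Cv] := df v; split.
  by move=> x Ux; apply: near_eq_derivable (near_fg _ Ux) (dv _ Ux).
by apply: (IH _ _ _ Cv) => x Ux; exact: near_eq_derive (near_fg _ Ux).
Qed.

Lemma Cm_on_cst V W m (U : set V) (c : W) : Cm_on m U (cst c : V -> W).
Proof.
elim: m c => [|m IH] c; split=> //; try by move=> x _; exact: cst_continuous.
move=> v; split; first by move=> x _; exact: derivable_cst.
have -> : (fun x : V => 'D_v (cst c : V -> W) x) = cst 0.
  by apply/funext => x; rewrite derive_cst.
exact: IH.
Qed.

Lemma Cm_onD V W m (U : set V) (f g : V -> W) : open U ->
  Cm_on m U f -> Cm_on m U g -> Cm_on m U (fun x => f x + g x).
Proof.
move=> oU; elim: m f g => [|m IH] f g [cf df] [cg dg].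
  by split=> // x Ux; apply: continuousD; [exact: cf|exact: cg].
split; first by move=> x Ux; apply: continuousD; [exact: cf|exact: cg].
move=> v; have [dvf Cf] := df v; have [dvg Cg] := dg v; split.
  by move=> x Ux; apply: derivableD; [exact: dvf|exact: dvg].
apply: (@Cm_on_eq _ _ _ _ (fun x => 'D_v f x + 'D_v g x)) => //.
  by move=> x Ux; rewrite deriveD//; [exact: dvf|exact: dvg].
exact: IH.
Qed.

Lemma Cm_onM V m (U : set V) (f g : V -> R^o) : open U ->
  Cm_on m U f -> Cm_on m U g -> Cm_on m U (fun x => f x * g x : R^o).
Proof.
move=> oU; elim: m f g => [|m IH] f g Cf Cg.
  have [[cf _] [cg _]] := (Cf, Cg).
  by split=> // x Ux; apply: (@continuousM R V); [exact: cf|exact: cg].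
have [[cf df] [cg dg]] := (Cf, Cg).
split; first by move=> x Ux; apply: (@continuousM R V); [exact: cf|exact: cg].
move=> v; have [dvf Cvf] := df v; have [dvg Cvg] := dg v; split.
  by move=> x Ux; apply: derivableM; [exact: dvf|exact: dvg].
apply: (@Cm_on_eq _ _ _ _ (fun x => f x * 'D_v g x + g x * 'D_v f x)) => //.
  by move=> x Ux; rewrite deriveM//; [exact: dvf|exact: dvg].
by apply: Cm_onD => //; apply: IH => //; exact: Cm_onS.
Qed.

Lemma Cm_on_sum V m (U : set V) (I : Type) (s : seq I) (f : I -> V -> R^o) :
  open U -> (forall i, Cm_on m U (f i)) ->
  Cm_on m U (fun x => \sum_(i <- s) f i x : R^o).
Proof.
move=> oU Cf; elim: s => [|i s IH].
  have -> : (fun x => \sum_(i <- [::]) f i x : R^o) = cst 0.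
    by apply/funext => x; rewrite big_nil.
  exact: Cm_on_cst.
have -> : (fun x => \sum_(j <- i :: s) f j x : R^o) =
    (fun x => f i x + \sum_(j <- s) f j x).
  by apply/funext => x; rewrite big_cons.
exact: Cm_onD.
Qed.

Lemma Cm_on_prod V m (U : set V) (I : Type) (s : seq I) (f : I -> V -> R^o) :
  open U -> (forall i, Cm_on m U (f i)) ->
  Cm_on m U (fun x => \prod_(i <- s) f i x : R^o).
Proof.
move=> oU Cf; elim: s => [|i s IH].
  have -> : (fun x => \prod_(i <- [::]) f i x : R^o) = cst 1.
    by apply/funext => x; rewrite big_nil.
  exact: Cm_on_cst.
have -> : (fun x => \prod_(j <- i :: s) f j x : R^o) =
    (fun x => f i x * \prod_(j <- s) f j x).
  by apply/funext => x; rewrite big_cons.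
exact: Cm_onM.
Qed.

(** [L] is affine with linear part [l].  Difference quotients of [f \o L] are
    those of [f], so that this case needs no chain rule. *)
Lemma Cm_on_affine V V' W m (U : set V') (f : V' -> W) (L l : V -> V') :
  continuous L -> (forall x v (t : R), L (t *: v + x) = t *: l v + L x) ->
  Cm_on m U f -> Cm_on m (L @^-1` U) (f \o L).
Proof.
move=> cL Ll; elim: m f => [|m IH] f [cf df]; split=> //.
- by move=> x Ux; apply: continuous_comp; [exact: cL|exact: cf].
- by move=> x Ux; apply: continuous_comp; [exact: cL|exact: cf].
have E v x : (fun h : R => h^-1 *: ((f \o L \o shift x) (h *: v) - (f \o L) x)) =
    (fun h : R => h^-1 *: ((f \o shift (L x)) (h *: l v) - f (L x))).
  by apply/funext => h /=; rewrite Ll.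
move=> v; have [dv Cv] := df (l v); split.
  by move=> x /dv; rewrite /derivable /= E.
have -> : (fun x => 'D_v (f \o L) x) = (fun x => 'D_(l v) f x) \o L.
  by apply/funext => x; rewrite /derive /= E.
exact: IH.
Qed.

End Calculus.

(** * The chain rule *)

Section ChainRule.
Context {R : realType}.
Implicit Types V W : normedModType R.

Lemma mvt_dir V (f : V -> R^o) (y k : V) (t : R) :
  (forall s : R, `|s| <= `|t| -> derivable f (s *: k + y) k) ->
  exists2 s : R, `|s| <= `|t| & f (t *: k + y) - f y = t * 'D_k f (s *: k + y).
Proof.
move=> df; pose g (s : R) : R := f (s *: k + y).
have dg (s : R) : `|s| <= `|t| -> is_derive s (1 : R) g ('D_k f (s *: k + y)).
  move=> /df ds; have E : (fun h : R => h^-1 *: ((g \o shift s) (h *: 1) - g s)) =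
      (fun h : R => h^-1 *: ((f \o shift (s *: k + y)) (h *: k) - f (s *: k + y))).
    by apply/funext => h /=; rewrite /g scaler1 scalerDl addrA.
  by apply: DeriveDef; [rewrite /derivable E|rewrite /derive E].
have cg (i : interval R) : (forall s, s \in i -> `|s| <= `|t|) ->
    {within [set` i], continuous g}.
  move=> H; apply: derivable_within_continuous => s /H/dg; by case.
have [t0|t0] := leP 0 t.
  have H s : s \in `[0, t] -> `|s| <= `|t|.
    by rewrite in_itv /= => /andP[s0 st]; rewrite !ger0_norm.
  have [|s sI E] := @MVT_segment R g (fun s => 'D_k f (s *: k + y)) 0 t t0 _ (cg _ H).
    by move=> s /subset_itv_oo_cc/H/dg.
  exists s; first exact: H.
  by move: E; rewrite /g scale0r add0r subr0 mulrC.
have H s : s \in `[t, 0] -> `|s| <= `|t|.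
  rewrite in_itv /= => /andP[st s0]; rewrite (ler0_norm s0) (ltr0_norm t0).
  by rewrite lerN2.
have [|s sI E] := @MVT_segment R g (fun s => 'D_k f (s *: k + y)) t 0 (ltW t0) _ (cg _ H).
  by move=> s /subset_itv_oo_cc/H/dg.
exists s; first exact: H.
move: E; rewrite /g scale0r add0r sub0r => /(congr1 -%R).
by rewrite opprB => ->; rewrite mulrN opprK mulrC.
Qed.

(** The derivative in the direction [k] is continuous, so by the mean value
    theorem the error in its definition is uniform in the base point [y].  This
    allows to vary the coordinates one at a time in [strong_diff]. *)
Lemma strict_derivative V (U : set V) (f : V -> R^o) (x k : V) :
  open U -> U x -> Cm_on 1 U f -> forall e : R, 0 < e ->
  exists2 d : R, 0 < d & forall (y : V) (t : R), `|y - x| < d -> `|t| < d ->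
    `|f (t *: k + y) - f y - t * 'D_k f x| <= e * `|t|.
Proof.
move=> oU Ux [_ /(_ k)[dk [cDk _]]] e e0.
have : \forall y \near x, U y /\ `|'D_k f x - 'D_k f y| < e.
  apply: filterI; first exact: open_nbhs_nbhs.
  by move/cvgrPdist_lt : (cDk _ Ux); exact.
move=> /nbhs_ballP[d /= d0 H].
have K0 : 0 < 1 + `|k| by rewrite ltr_pwDl.
pose d1 := Num.min (d / 2) (d / 2 / (1 + `|k|)).
have Hs y (t s : R) : `|y - x| < d1 -> `|t| < d1 -> `|s| <= `|t| ->
    ball x d (s *: k + y).
  move=> yx td st; rewrite -ball_normE /= distrC -addrA.
  rewrite (le_lt_trans (ler_normD _ _))// [ltRHS]splitr ler_ltD//; last first.
    by rewrite (lt_le_trans yx)// ge_min lexx.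
  rewrite normrZ (le_trans (ler_wpM2r _ st))//.
  have : `|t| <= d / 2 / (1 + `|k|).
    by rewrite (le_trans (ltW td))// ge_min lexx orbT.
  move=> td'; rewrite (le_trans (ler_wpM2r (normr_ge0 k) td'))//.
  rewrite mulrAC ler_pdivrMr// ler_wpM2l//; first by rewrite divr_ge0// ltW.
  by rewrite lerDr.
exists d1; first by rewrite /d1 lt_min !divr_gt0.
move=> y t yx td.
have [|s st ->] := @mvt_dir V f y k t.
  by move=> s st; have [/dk] := H _ (Hs y t s yx td st).
rewrite -mulrBr normrM mulrC ler_wpM2r// distrC ltW//.
by have [] := H _ (Hs y t s yx td st).
Qed.

(** Change the coordinates of [h] one after the other and use
    [strict_derivative] for each of them. *)
Lemma strong_diff (n : nat) (U : set 'rV[R]_n) (f : 'rV[R]_n -> R^o) x :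
  open U -> U x -> Cm_on 1 U f -> forall e : R, 0 < e ->
  exists2 d : R, 0 < d & forall h : 'rV[R]_n, (forall i, `|h 0 i| < d) ->
    `|f (h + x) - f x - \sum_i h 0 i * 'D_(delta_mx 0 i) f x|
       <= e * \sum_i `|h 0 i|.
Proof.
move=> oU Ux Cf e e0.
suff : forall s : seq 'I_n,
  exists2 d : R, 0 < d & forall h : 'I_n -> R, (forall i, `|h i| < d) ->
    `|f (\sum_(i <- s) h i *: delta_mx 0 i + x) - f x
      - \sum_(i <- s) h i * 'D_(delta_mx 0 i) f x| <= e * \sum_(i <- s) `|h i|.
  move=> /(_ (index_enum 'I_n))[d d0 H]; exists d => // h /(H (fun i => h 0 i)).
  by rewrite -row_sum_delta.
elim=> [|i s [d d0 IH]].
  exists 1 => // h _; rewrite !big_nil !add0r subrr subr0 normr0 mulr0 //.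
have [d' d'0 H] := strict_derivative (delta_mx 0 i) oU Ux Cf e0.
pose K : R := \sum_(i <- s) `|delta_mx 0 i : 'rV[R]_n|.
have K0 : 0 <= K by apply: sumr_ge0.
have K1 : 0 < 1 + K by rewrite ltr_wpDr.
exists (Num.min d (Num.min d' (d' / (1 + K)))).
  by rewrite !lt_min d0 d'0 divr_gt0.
move=> h Hh; rewrite !big_cons.
have hd j : `|h j| < d by have := Hh j; rewrite lt_min => /andP[].
have hd' j : `|h j| < d' by have := Hh j; rewrite !lt_min => /and3P[].
have hd'' j : `|h j| < d' / (1 + K) by have := Hh j; rewrite !lt_min => /and3P[].
set y := \sum_(j <- s) h j *: delta_mx 0 j + x.
have yx : `|y - x| < d'.
  rewrite /y addrK (le_lt_trans (ler_norm_sum _ _ _))//.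
  under eq_bigr do rewrite normrZ.
  apply: (@le_lt_trans _ _ (d' / (1 + K) * K)).
    rewrite mulr_sumr ler_sum// => j _; rewrite ler_wpM2r// ltW//.
  by rewrite mulrAC ltr_pdivrMr// ltr_pM2l// ltrDr.
have := H y (h i) yx (hd' i); have := IH h hd; rewrite -/y.
rewrite mulrDr => A B; rewrite -[_ + _ + x]addrA -/y.
set a := f (_ + y) in B *; set b := \sum_(_ <- _) (_ * _) in A *.
have key (p q r w z : R) : p - q - (w + z) = (p - r - w) + (r - q - z) by ring.
rewrite [X in `|X|](_ : _ =
   (a - f y - h i * 'D_(delta_mx 0 i) f x) + (f y - f x - b) :> R); last exact: key.
by rewrite (le_trans (ler_normD _ _))// lerD.
Qed.

(** [Psi] is derivable in a single direction, while [f] has to be differentiable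
    in all directions at once, because the increments of [Psi] along [v] are not
    multiples of a fixed vector. *)
Lemma chain_rule V (n : nat) (U : set 'rV[R]_n) (f : 'rV[R]_n -> R^o)
    (Psi : V -> 'rV[R]_n) (x v : V) :
  open U -> U (Psi x) -> Cm_on 1 U f -> derivable Psi x v ->
  is_derive x v (f \o Psi : V -> R^o)
    (\sum_i 'D_(delta_mx 0 i) f (Psi x) * ('D_v Psi x) 0 i).
Proof.
move=> oU Ux Cf dPsi.
set L := \sum_i _.
suff H : (h^-1 *: ((f \o Psi \o shift x) (h *: v) - (f \o Psi) x))
    @[h --> 0^'] --> (L : R^o).
  by apply: DeriveDef; [apply/cvg_ex; exists L|exact: cvg_lim H].
have cPsi i : (h^-1 * (Psi (h *: v + x) 0 i - Psi x 0 i)) @[h --> 0^']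
    --> ('D_v Psi x) 0 i.
  have /derivable_mxP/(_ 0 i) := dPsi.
  by rewrite derive_mx// mxE => /derivableP/(@ex_derive _ _ _ _ _ _ _).
pose S := \sum_i (1 + `|('D_v Psi x) 0 i|).
have S0 : 0 <= S by apply: sumr_ge0 => i _; rewrite addr_ge0.
apply/cvgrPdist_le => e e0.
have e1 : 0 < e / 2 / (1 + S) by rewrite !divr_gt0// ltr_wpDr.
have [d d0 Hd] := strong_diff oU Ux Cf e1.
have c0 i : (Psi (h *: v + x) 0 i - Psi x 0 i) @[h --> (0:R)^'] --> (0 : R).
  have : h * (h^-1 * (Psi (h *: v + x) 0 i - Psi x 0 i)) @[h --> (0:R)^'] -->
      0 * ('D_v Psi x) 0 i.
    by apply: cvgM; [apply: cvg_within_filter; exact: cvg_id|exact: cPsi].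
  rewrite mul0r; apply: cvg_trans; apply: near_eq_cvg.
  near=> h; rewrite mulrA mulfV ?mul1r//.
  by near: h; exact: nbhs_dnbhs_neq.
have cL : (\sum_i (h^-1 * (Psi (h *: v + x) 0 i - Psi x 0 i)) *
     'D_(delta_mx 0 i) f (Psi x)) @[h --> (0:R)^'] --> L.
  rewrite /L; under [X in _ --> X]eq_bigr do rewrite mulrC.
  apply: cvg_big => [|i _]; first exact: add_continuous.
  by apply: cvgM; [exact: cPsi|exact: cvg_cst].
near=> h.
have h0 : h != 0 by near: h; exact: nbhs_dnbhs_neq.
have hd i : `|(Psi (h *: v + x) - Psi x) 0 i| < d.
  rewrite !mxE; move: i; near: h; apply: filter_forall => i.
  have /cvgrPdist_lt/(_ _ d0) := c0 i.
  by apply: filterS => z; rewrite sub0r normrN.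
have hS : \sum_i `|h^-1 * (Psi (h *: v + x) 0 i - Psi x 0 i)| <= S.
  apply: ler_sum => i _; move: i; near: h; apply: filter_forall => i.
  have /cvgrPdist_le/(_ _ ltr01) := cPsi i.
  apply: filterS => z Hz; rewrite -lerBlDr (le_trans _ Hz)//.
  by rewrite distrC; exact: lerB_dist.
have hL : `|L - \sum_i (h^-1 * (Psi (h *: v + x) 0 i - Psi x 0 i)) *
     'D_(delta_mx 0 i) f (Psi x)| <= e / 2.
  near: h; move/cvgrPdist_le : cL; apply; by rewrite divr_gt0.
have := Hd _ hd; rewrite subrK => HH.
rewrite (splitr e) -(subrKA (\sum_i (h^-1 * (Psi (h *: v + x) 0 i - Psi x 0 i)) *
     'D_(delta_mx 0 i) f (Psi x))) (le_trans (ler_normD _ _))// lerD//.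
have -> : \sum_i (h^-1 * (Psi (h *: v + x) 0 i - Psi x 0 i)) *
     'D_(delta_mx 0 i) f (Psi x) = h^-1 * \sum_i (Psi (h *: v + x) - Psi x) 0 i *
     'D_(delta_mx 0 i) f (Psi x).
  by rewrite mulr_sumr; apply: eq_bigr => i _; rewrite !mxE mulrA.
rewrite /= distrC [_ *: _]/(_ * _) -mulrBr normrM.
rewrite (le_trans (ler_wpM2l (normr_ge0 _) HH))// mulrCA mulr_sumr.
under eq_bigr do rewrite -normrM !mxE.
rewrite (le_trans (ler_wpM2l (ltW e1) hS))//.
rewrite mulrAC ler_pdivrMr ?ltr_wpDr// ler_wpM2l ?divr_ge0 ?ltW//.
by rewrite ltrDr.
Unshelve. all: by end_near. Qed.

End ChainRule.

Section SmoothComp.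
Context {R : realType}.
Implicit Types V W : normedModType R.

Lemma Cm_on_coord V n m (U : set V) (f : V -> 'rV[R]_n) i : open U ->
  Cm_on m U f -> Cm_on m U (fun x => f x 0 i : R^o).
Proof.
move=> oU; elim: m f => [|m IH] f [cf df].
  split=> // x Ux; apply: (@continuous_comp _ _ _ f (fun M : 'rV[R]_n => M 0 i)).
    exact: cf.
  exact: coord_continuous.
split.
  move=> x Ux; apply: (@continuous_comp _ _ _ f (fun M : 'rV[R]_n => M 0 i)).
    exact: cf.
  exact: coord_continuous.
move=> v; have [dv /IH Cv] := df v; split.
  by move=> x /dv/derivable_mxP/(_ 0 i).
by apply: Cm_on_eq Cv => // x /dv dvx; rewrite derive_mx// mxE.
Qed.

Lemma Cm_on_comp V n m (O : set V) (U : set 'rV[R]_n) (f : 'rV[R]_n -> R^o)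
    (g : V -> 'rV[R]_n) :
  open O -> open U -> (forall x, O x -> U (g x)) ->
  Cm_on m U f -> Cm_on m O g -> Cm_on m O (f \o g : V -> R^o).
Proof.
move=> oO oU OU; elim: m f g OU => [|m IH] f g OU Cf Cg.
  have [[cf _] [cg _]] := (Cf, Cg).
  by split=> // x Ox; apply: continuous_comp; [exact: cg|exact/cf/OU].
have [[cf df] [cg dg]] := (Cf, Cg).
have C1f : Cm_on 1 U f.
  by split=> // v; have [dv Dv] := df v; split=> //; case: (m) Dv => [|?] [].
split; first by move=> x Ox; apply: continuous_comp; [exact: cg|exact/cf/OU].
move=> v; have [dgv Cgv] := dg v; split.
  by move=> x Ox; have [] := chain_rule oU (OU _ Ox) C1f (dgv _ Ox).
apply: (@Cm_on_eq _ _ _ _ _ (fun x => \sum_i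
    'D_(delta_mx 0 i) f (g x) * ('D_v g x) 0 i : R^o)) => //.
  by move=> x Ox; have [_ ->] := chain_rule oU (OU _ Ox) C1f (dgv _ Ox).
apply: Cm_on_sum => // i; apply: Cm_onM => //.
  have [_ Ci] := df (delta_mx 0 i).
  exact: (IH (fun z => 'D_(delta_mx 0 i) f z)) OU Ci (Cm_onS Cg).
exact: (@Cm_on_coord _ _ _ _ (fun x => 'D_v g x)).
Qed.

(** The chain rule for the identity map. *)
Lemma derive_sum_partial n (U : set 'rV[R]_n) (f : 'rV[R]_n -> R^o) x h :
  open U -> U x -> Cm_on 1 U f ->
  'D_h f x = \sum_i 'D_(delta_mx 0 i) f x * h 0 i.
Proof.
move=> oU Ux Cf; have [_] := chain_rule oU (Ux : U (id x)) Cf (@derivable_id R 'rV[R]_n x h).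
by rewrite derive_id.
Qed.

End SmoothComp.

(** * Hadamard's lemma *)

Section RadialAverage.
Context {R : realType}.

Definition int01 (f : R -> R) : R :=
  Rintegral lebesgue_measure (`[0, 1] : set R) f.

Definition cont01 (f : R -> R) : Prop :=
  forall t : R, 0 <= t <= 1 -> {for t, continuous f}.

Lemma cont01_integrable f : cont01 f ->
  (@lebesgue_measure R).-integrable (`[0, 1] : set R) (EFin \o f).
Proof.
move=> cf; apply: continuous_compact_integrable; first exact: segment_compact.
apply: continuous_in_subspaceT => t; rewrite inE /= in_itv /= => t01.
exact: cf.
Qed.

Lemma int01_close f g (e : R) : cont01 f -> cont01 g ->
  (forall t, 0 <= t <= 1 -> `|f t - g t| <= e) -> `|int01 f - int01 g| <= e.
Proof.
move=> cf cg fg; rewrite /int01 -RintegralB//; try exact: cont01_integrable.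
have cfg : cont01 (f \- g).
  by move=> t t01; apply: continuousB; [exact: cf|exact: cg].
rewrite (le_trans (le_normr_Rintegral _ (cont01_integrable cfg)))//.
apply: (@le_trans _ _ (Rintegral lebesgue_measure (`[0, 1] : set R) (cst e))).
  apply: le_Rintegral => //.
  - apply: (@cont01_integrable (fun t => `|f t - g t|)) => t t01.
    exact: (@continuous_comp _ _ _ (f \- g) Num.norm t (cfg _ t01) (@norm_continuous _ R^o _)).
  - by apply: cont01_integrable => t _; exact: cst_continuous.
rewrite Rintegral_cst//= lebesgue_measure_itv /= lte01 /=.
by rewrite oppr0 addr0 mulr1.
Qed.

Variables (V : normedModType R) (x0 : V) (r : R).
Let B := ball x0 r.
Definition seg (t : R) (x : V) := t *: (x - x0) + x0.

Lemma ball_seg t x : 0 <= t <= 1 -> B x -> B (seg t x).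
Proof.
rewrite /B /seg -ball_normE /= => /andP[t0 t1].
rewrite (_ : x0 - (_ + x0) = t *: (x0 - x)).
  by apply: le_lt_trans; rewrite normrZ ger0_norm// ler_piMl.
by rewrite opprD addrCA subrr addr0 -scalerN opprB.
Qed.

Lemma open_B : open B. Proof. exact: ball_open. Qed.

(** Average of [f] over the segment from [x0] to [x].  The weight [t ^ j] makes
    the family stable: a derivative of the average of weight [j] is the average
    of weight [j + 1] of the derivative ([wavg_derive]). *)
Definition wavg (j : nat) (f : V -> R^o) (x : V) : R^o :=
  int01 (fun t => t ^+ j * f (seg t x)).

Lemma seg_cvg (t : R) (x : V) : seg z.1 z.2 @[z --> (t, x)] --> seg t x.
Proof.
apply: cvgD; last exact: cvg_cst.
by apply: cvgZ; [exact: cvg_fst|apply: cvgB; [exact: cvg_snd|exact: cvg_cst]].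
Qed.

Lemma wavg_cvg j f t x : {for seg t x, continuous f} ->
  (z.1 ^+ j * f (seg z.1 z.2)) @[z --> (t, x)] --> t ^+ j * f (seg t x).
Proof.
move=> cf; apply: cvgM.
  apply: (@cvg_comp _ _ _ fst (fun t : R => t ^+ j)); first exact: cvg_fst.
  exact: exprn_continuous.
exact: (@cvg_comp _ _ _ (fun z : R * V => seg z.1 z.2) f _ _ _
  (@seg_cvg t x) cf).
Qed.

Lemma wavg_cont01 j f x : (forall y, B y -> {for y, continuous f}) -> B x ->
  cont01 (fun t => t ^+ j * f (seg t x)).
Proof.
move=> cf Bx t t01.
have H := @wavg_cvg j _ _ _ (cf _ (ball_seg t01 Bx)).
have P : (s, x) @[s --> t] --> (t, x).
  exact: (@cvg_pair R R V (nbhs t) (nbhs t) (nbhs x) _ _ _ id (cst x) cvg_id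
    (cvg_cst x)).
exact: (@cvg_comp _ _ _ (fun s : R => (s, x))
  (fun z : R * V => z.1 ^+ j * f (seg z.1 z.2) : R^o) _ _ _ P H).
Qed.

(** By compactness of the segment, a property that holds near [(t, x)] for each
    [t] holds near [x] for all [t] at once. *)
Lemma near_segment (W : topologicalType) (x : W) (P : W -> R -> Prop) :
  (forall t : R, 0 <= t <= 1 -> \forall z \near (t, x), 0 <= z.1 <= 1 -> P z.2 z.1) ->
  \forall y \near x, forall t : R, 0 <= t <= 1 -> P y t.
Proof.
move=> H.
have : \forall y \near x, (`[0, 1] : set R) `<=`
    (fun t => 0 <= t <= 1 -> P y t).
  apply: (iffLR (compact_near_coveringP _) (@segment_compact R 0 1)
    W (nbhs x) (fun y t => 0 <= t <= 1 -> P y t)).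
  move=> t; rewrite /= in_itv /= => t01; exact: (H t t01).
by apply: filterS => y /= Hy t t01; apply: (Hy t) => //; rewrite in_itv.
Qed.

Lemma wavg_continuous j f : (forall y, B y -> {for y, continuous f}) ->
  forall x, B x -> {for x, continuous (wavg j f)}.
Proof.
move=> cf x Bx; apply/cvgrPdist_le => e e0.
have H : \forall y \near x, forall t : R, 0 <= t <= 1 ->
    `|t ^+ j * f (seg t x) - t ^+ j * f (seg t y)| <= e.
  apply: near_segment => t t01.
  have e2 : 0 < e / 2 by rewrite divr_gt0.
  have /cvgrPdist_le/(_ _ e2) H1 := @wavg_cvg j _ _ _ (cf _ (ball_seg t01 Bx)).
  have /cvgrPdist_le/(_ _ e2) H2 := @wavg_cont01 j _ _ cf Bx _ t01.
  have H3 := @cvg_fst _ _ (nbhs t) (nbhs x) _ _ H2.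
  near=> z => _.
  rewrite (splitr e) -(subrKA (t ^+ j * f (seg t x))) (le_trans (ler_normD _ _))//.
  rewrite lerD//; first by rewrite distrC; near: z; exact: H3.
  by near: z; exact: H1.
near=> y; apply: int01_close.
- exact: wavg_cont01.
- apply: wavg_cont01 => //; near: y; exact: open_nbhs_nbhs (conj open_B Bx).
- by near: y; exact: H.
Unshelve. all: by end_near. Qed.

(** The difference quotients of [f] along the segment converge uniformly, by
    [strict_derivative] and compactness of the segment. *)
Lemma wavg_derive j f v : Cm_on 1 B f -> forall x, B x ->
  is_derive x v (wavg j f) (wavg j.+1 (fun x => 'D_v f x) x).
Proof.
move=> Cf x Bx; have [cf /(_ v)[df [cDf _]]] := Cf.
suff H : (h^-1 *: ((wavg j f \o shift x) (h *: v) - wavg j f x))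
    @[h --> 0^'] --> wavg j.+1 (fun x => 'D_v f x) x.
  by apply: DeriveDef; [apply/cvg_ex; exists (wavg j.+1 (fun x => 'D_v f x) x)
                       |exact: cvg_lim H].
apply/cvgrPdist_le => e e0.
have e2 : 0 < e / 2 by rewrite divr_gt0.
have H : \forall y \near (0 : R), forall t : R, 0 <= t <= 1 ->
    `|t ^+ j * f (seg t (y *: v + x)) - t ^+ j * f (seg t x)
      - y * (t ^+ j.+1 * 'D_v f (seg t x))| <= e * `|y|.
  apply: (@near_segment R (0:R) (fun y t => `|t ^+ j * f (seg t (y *: v + x)) - t ^+ j * f (seg t x)
      - y * (t ^+ j.+1 * 'D_v f (seg t x))| <= e * `|y|)) => t t01.
  have [d d0 Hd] := strict_derivative v open_B (ball_seg t01 Bx) Cf e2.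
  have /cvgrPdist_le/(_ _ e2) H1 :=
    @wavg_cont01 0 _ _ cDf Bx _ t01.
  have H2 := @cvg_fst _ _ (nbhs t) (nbhs (0 : R)) _ _ H1.
  have H3 : \forall s \near t, `|seg s x - seg t x| < d.
    have : seg s x @[s --> t] --> seg t x.
      apply: cvgD; last exact: cvg_cst.
      by apply: cvgZr_tmp; exact: cvg_id.
    by move=> /cvgrPdist_lt/(_ _ d0); apply: filterS => s; rewrite distrC.
  have H4 := @cvg_fst _ _ (nbhs t) (nbhs (0 : R)) _ _ H3.
  have H5 : \forall y \near (0 : R), `|y| < d by exact: nbhs0_lt.
  have H6 := @cvg_snd _ _ (nbhs t) (nbhs (0 : R)) _ _ H5.
  near=> z => z01.
  have z1 : `|z.1| <= 1 by case/andP: z01 => z0 z1; rewrite ger0_norm.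
  have zd : `|z.1 * z.2| < d.
    rewrite normrM (le_lt_trans (ler_piMl _ z1))//.
    by near: z; exact: H6.
  have Hz : `|seg z.1 x - seg t x| < d by near: z; exact: H4.
  have := Hd _ _ Hz zd.
  have -> : (z.1 * z.2) *: v + seg z.1 x = seg z.1 (z.2 *: v + x).
    by rewrite /seg -[z.2 *: v + x - x0]addrA [in RHS]scalerDr scalerA addrA.
  set A := f _; set A' := f _; set D0 := 'D_v f _ => HA.
  have HB : `|D0 - 'D_v f (seg z.1 x)| <= e / 2.
    have : `|t ^+ 0 * D0 - z.1 ^+ 0 * 'D_v f (seg z.1 x)| <= e / 2.
      by near: z; exact: H2.
    by rewrite !expr0 !mul1r.
  set D1 := 'D_v f _ in HB *.
  have key (p a a' z1' z2 b b' : R) : p * a - p * a' - z2 * (p * z1' * b') =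
      p * ((a - a' - z1' * z2 * b) + z1' * z2 * (b - b')) by ring.
  rewrite exprSr [X in `|X| <= _](key _ _ _ _ _ D0) normrM.
  rewrite (le_trans (ler_piMl _ _))//; first by rewrite normrX exprn_ile1.
  rewrite (le_trans (ler_normD _ _))// (splitr e) mulrDl lerD//.
    by rewrite (le_trans HA)// (ler_wpM2l (ltW e2))// normrM ler_piMl.
  rewrite normrM mulrC ler_pM//.
  by rewrite normrM ler_piMl.
near=> h.
have h0 : h != 0 by near: h; exact: nbhs_dnbhs_neq.
have Bh : B (h *: v + x).
  near: h; apply: nbhs_dnbhs.
  have : h *: v + x @[h --> (0:R)] --> 0 *: v + x.
    by apply: cvgD; [apply: cvgZr_tmp; exact: cvg_id|exact: cvg_cst].
  rewrite scale0r add0r; apply; exact: open_nbhs_nbhs (conj open_B Bx).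
have c1 := @wavg_cont01 j.+1 _ _ cDf Bx.
have c2 := @wavg_cont01 j _ _ cf Bx.
have c3 := @wavg_cont01 j _ _ cf Bh.
have c4 : cont01 (fun t => t ^+ j * f (seg t (h *: v + x)) - t ^+ j * f (seg t x)).
  by move=> t t01; apply: continuousB; [exact: c3|exact: c2].
have -> : h^-1 *: ((wavg j f \o shift x) (h *: v) - wavg j f x) =
    int01 (fun t => h^-1 * (t ^+ j * f (seg t (h *: v + x)) - t ^+ j * f (seg t x))).
  rewrite /int01 RintegralZl//; last exact: cont01_integrable.
  by rewrite RintegralB//; exact: cont01_integrable.
apply: int01_close => //.
  move=> t t01; apply: (@continuousM R R (cst h^-1)); first exact: cst_continuous.
  exact: c4.
move=> t t01.
have : `|t ^+ j * f (seg t (h *: v + x)) - t ^+ j * f (seg t x)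
      - h * (t ^+ j.+1 * 'D_v f (seg t x))| <= e * `|h|.
  by move: t t01; near: h; apply: nbhs_dnbhs; exact: H.
have key (a b : R) : (a - h * b) / h = h^-1 * a - b.
  by rewrite mulrBl mulrAC mulfV// mul1r mulrC.
by rewrite -ler_pdivrMr ?normr_gt0// -normfV -normrM key distrC.
Unshelve. all: by end_near. Qed.

Lemma wavg_Cm j m f : Cm_on m B f -> Cm_on m B (wavg j f).
Proof.
elim: m j f => [|m IH] j f Cf.
  by split=> //; have [cf _] := Cf; exact: wavg_continuous.
have C1f : Cm_on 1 B f.
  have [cf df] := Cf.
  by split=> // v; have [dv Dv] := df v; split=> //; case: (m) Dv => [|?] [].
have [cf df] := Cf; split; first exact: wavg_continuous.
move=> v; split.
  by move=> x Bx; have [] := wavg_derive j v C1f Bx.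
apply: (@Cm_on_eq _ _ _ _ _ (wavg j.+1 (fun x => 'D_v f x))).
- exact: open_B.
- by move=> x Bx; have [_ ->] := wavg_derive j v C1f Bx.
- by apply: IH; have [_] := df v.
Qed.

End RadialAverage.

Section Hadamard.
Context {R : realType}.

Lemma int01_sum (I : Type) (s : seq I) (a : I -> R) (f : I -> R -> R) :
  (forall i, cont01 (f i)) ->
  cont01 (fun t => \sum_(i <- s) a i * f i t) /\
  int01 (fun t => \sum_(i <- s) a i * f i t) = \sum_(i <- s) a i * int01 (f i).
Proof.
move=> cf; elim: s => [|i s [IH1 IH2]].
  have -> : (fun t => \sum_(i <- [::]) a i * f i t) = cst 0.
    by apply/funext => t; rewrite big_nil.
  split; first by move=> t _; exact: cst_continuous.
  by rewrite big_nil /int01 Rintegral_cst//= mul0r.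
have -> : (fun t => \sum_(j <- i :: s) a j * f j t) =
    (fun t => a i * f i t + \sum_(j <- s) a j * f j t).
  by apply/funext => t; rewrite big_cons.
have c1 : cont01 (fun t => a i * f i t).
  move=> t t01; apply: (@continuousM R R (cst (a i))); first exact: cst_continuous.
  exact: cf.
split; first by move=> t t01; apply: continuousD; [exact: c1|exact: IH1].
rewrite big_cons -IH2 /int01 RintegralD//; try exact: cont01_integrable.
by rewrite RintegralZl//; exact: cont01_integrable.
Qed.

(** The integrand is the derivative of [f] along the segment. *)
Lemma wavg_ftc (V : normedModType R) (x0 : V) (r : R) (f : V -> R^o) (x : V) :
  Cm_on 1 (ball x0 r) f -> ball x0 r x ->
  wavg x0 0 (fun y => 'D_(x - x0) f y) x = f x - f x0.
Proof.
move=> Cf Bx; have [cf /(_ (x - x0))[df [cDf _]]] := Cf.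
pose F (t : R) : R := f (seg x0 t x).
have dF (t : R) : 0 <= t <= 1 -> is_derive t (1 : R) F ('D_(x - x0) f (seg x0 t x)).
  move=> t01; have := df _ (ball_seg t01 Bx).
  have E : (fun h : R => h^-1 *: ((F \o shift t) (h *: 1) - F t)) =
    (fun h : R => h^-1 *: ((f \o shift (seg x0 t x)) (h *: (x - x0)) - f (seg x0 t x))).
    by apply/funext => h /=; rewrite /F /seg scaler1 scalerDl addrA.
  by move=> d; apply: DeriveDef; [rewrite /derivable E|rewrite /derive E].
have cF (t : R) : 0 <= t <= 1 -> {for t, continuous F}.
  by move=> /dF[d _]; apply/differentiable_continuous/derivable1_diffP.
have c01 := @wavg_cont01 _ _ _ _ 0 _ _ cDf Bx.
rewrite /wavg /int01 /Rintegral (@continuous_FTC2 _ _ F 0 1)//=.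
- by rewrite /F /seg scale1r subrK scale0r add0r.
- apply: continuous_in_subspaceT => t; rewrite inE /= in_itv /= => t01.
  exact: c01.
- split.
  + by move=> t /subset_itv_oo_cc; rewrite in_itv /= => /dF[].
  + by apply: cvg_at_right_filter; apply: cF; rewrite lexx ler01.
  + by apply: cvg_at_left_filter; apply: cF; rewrite lexx ler01.
- move=> t /subset_itv_oo_cc; rewrite in_itv /= => /dF[_].
  by rewrite derive1E expr0 mul1r.
Qed.

Lemma hadamard n (x0 : 'rV[R]_n) (r : R) (f : 'rV[R]_n -> R^o) (x : 'rV[R]_n) :
  Cm_on 1 (ball x0 r) f -> ball x0 r x ->
  f x = f x0 + \sum_i (x - x0) 0 i * wavg x0 0 (fun y => 'D_(delta_mx 0 i) f y) x.
Proof.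
move=> Cf Bx; rewrite -[LHS](subrK (f x0)) addrC; congr (_ + _).
rewrite -(wavg_ftc Cf Bx).
have cD (i : 'I_n) : cont01 (fun t => t ^+ 0 * 'D_(delta_mx 0 i) f (seg x0 t x)).
  apply: (@wavg_cont01 _ _ x0 r 0 (fun y => 'D_(delta_mx 0 i) f y) x _ Bx).
  by have [_ /(_ (delta_mx 0 i))[_ []]] := Cf.
have [_ <-] := int01_sum (index_enum 'I_n) (fun i => (x - x0) 0 i) cD.
apply: eq_Rintegral => t; rewrite inE /= in_itv /= => t01.
rewrite (derive_sum_partial _ (@open_B _ _ x0 r) (ball_seg t01 Bx) Cf).
by rewrite mulr_sumr; apply: eq_bigr => i _; rewrite [RHS]mulrC mulrA.
Qed.

End Hadamard.

(** * Bump functions *)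

Section Bump.
Context {R : realType}.

(** The derivatives of [exp (-1/x)] are combinations of these functions.  The
    whole family is treated together, as [flat k.+1] and [flat k.+2] express the
    derivative of [flat k]. *)
Definition flat (k : nat) (x : R^o) : R^o :=
  if 0 < x then x^-1 ^+ k * expR (- x^-1) else 0.

(** With [y = 1/x] this is [y ^ (k+2) / (k+2)! <= exp y].  A quadratic bound
    gives derivative zero at the origin. *)
Lemma flat_bound k (x : R) : `|flat k x| <= (k.+2)`!%:R * x ^+ 2.
Proof.
rewrite /flat; case: ifPn => [x0|_]; last first.
  by rewrite normr0 mulr_ge0// sqr_ge0.
have y0 : 0 < x^-1 by rewrite invr_gt0.
rewrite ger0_norm; last by rewrite mulr_ge0 ?expR_ge0// exprn_ge0// ltW.
rewrite expRN ler_pdivrMr ?expR_gt0//.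
have := expR_ge1Dxn k.+1 (ltW y0).
set E := expR _ => HE.
have : x^-1 ^+ k.+2 / (k.+2)`!%:R <= E by rewrite (le_trans _ HE)// lerDr.
rewrite ler_pdivrMr ?ltr0n ?fact_gt0// => H.
have -> : x^-1 ^+ k = x ^+ 2 * x^-1 ^+ k.+2.
  by rewrite !exprS expr0; set u := x^-1 ^+ k; field; rewrite gt_eqF.
rewrite [leRHS](_ : _ = x ^+ 2 * (E * (k.+2)`!%:R)); last by ring.
by rewrite ler_wpM2l ?sqr_ge0.
Qed.

Lemma flat_derive k (x v : R^o) :
  is_derive x v (flat k) (v * (- k%:R * flat k.+1 x + flat k.+2 x) : R^o).
Proof.
suff H : is_derive x (1 : R) (flat k) (- k%:R * flat k.+1 x + flat k.+2 x).
  have [/derivable1_diffP d E] := H; apply: DeriveDef; first exact: diff_derivable.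
  by rewrite deriveE// diff1E// derive1E E.
have [x0|x0|x0] := ltgtP x 0.
- have fE : \forall y \near x, cst 0 y = flat k y.
    near=> y; rewrite /flat ifF//; apply/negbTE; rewrite -leNgt ltW//.
    by near: y; exact: lt_nbhsl.
  have -> : - k%:R * flat k.+1 x + flat k.+2 x = 0.
    by rewrite /flat !ltNge (ltW x0) /= mulr0 addr0.
  by apply: (@near_eq_is_derive R R^o R^o (cst 0) (flat k) x 1 0 fE).
- have fE : \forall y \near x, y^-1 ^+ k * expR (- y^-1) = flat k y.
    near=> y; rewrite /flat ifT//.
    by near: y; exact: lt_nbhsr.
  apply: (near_eq_is_derive fE).
  rewrite /flat x0.
  have dV : is_derive x (1 : R) (fun y : R => y^-1) (- (x^-1 ^+ 2)).
    apply: is_derive_eq; first by apply: derivableP; apply: derivableV; rewrite ?gt_eqF.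
    rewrite deriveV ?gt_eqF// derive_id scaler1.
    by rewrite exprVn.
  have dNV : is_derive x (1 : R) (fun y : R => - y^-1) (x^-1 ^+ 2).
    by apply: is_derive_eq; rewrite opprK.
  have dE : is_derive x (1 : R) (expR \o (fun y : R => - y^-1))
      (expR (- x^-1) * x^-1 ^+ 2).
    exact: is_derive1_comp.
  have dX : is_derive x (1 : R) ((fun y : R => y^-1) ^+ k)
      (k%:R * x^-1 ^+ k.-1 * (- (x^-1 ^+ 2))).
    by apply: is_derive_eq.
  have -> : (fun y : R => y^-1 ^+ k * expR (- y^-1)) =
      ((fun y : R => y^-1) ^+ k) * (expR \o (fun y : R => - y^-1)).
    by apply/funext => y; rewrite [RHS]/(_ * _) /= fctE.
  apply: is_derive_eq.
  rewrite /= fctE /= /GRing.scale /=.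
  set E := expR _; case: k {fE dX} => [|k] /=.
    by ring.
  by rewrite !exprS; ring.
- have -> : - k%:R * flat k.+1 x + flat k.+2 x = 0.
    by rewrite x0 /flat ltxx mulr0 addr0.
  rewrite x0; suff H : (h^-1 *: ((flat k \o shift (0 : R)) (h *: 1) - flat k 0))
      @[h --> (0 : R)^'] --> (0 : R^o).
    by apply: DeriveDef; [apply/cvg_ex; exists 0|exact: cvg_lim H].
  apply/cvgrPdist_le => e e0.
  have c0 : 0 < e / (k.+2)`!%:R by rewrite divr_gt0// ltr0n fact_gt0.
  near=> h.
  have h0 : h != 0 by near: h; exact: nbhs_dnbhs_neq.
  have hd : `|h| <= e / (k.+2)`!%:R.
    by near: h; exact: dnbhs0_le.
  rewrite sub0r normrN /= addr0 scaler1 {2}/flat ltxx subr0 normrZ normfV.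
  rewrite ler_pdivrMl ?normr_gt0// (le_trans (flat_bound _ _))//.
  rewrite -normr_id -[h ^+ 2]real_normK ?num_real// expr2 mulrCA.
  rewrite normr_id ler_wpM2l// mulrC -ler_pdivlMr// ltr0n fact_gt0//.
Unshelve. all: by end_near. Qed.

Lemma flat_Cm m k : Cm_on m [set: R^o] (flat k).
Proof.
elim: m k => [|m IH] k.
  split=> // x _; have [d _] := flat_derive k x 1.
  exact/differentiable_continuous/derivable1_diffP.
split.
  move=> x _; have [d _] := flat_derive k x 1.
  exact/differentiable_continuous/derivable1_diffP.
move=> v; split; first by move=> x _; have [] := flat_derive k x v.
have -> : (fun x : R^o => 'D_v (flat k) x) =
    (fun x => v * (- k%:R * flat k.+1 x + flat k.+2 x)).
  by apply/funext => x; have [_ ->] := flat_derive k x v.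
have oT := @openT R^o.
apply: Cm_onM => //; first exact: (Cm_on_cst m _ (v : R^o)).
apply: Cm_onD => //; apply: Cm_onM => //.
exact: (Cm_on_cst m _ (- k%:R : R^o)).
Qed.

Variables (n : nat) (y0 : 'rV[R]_n) (e : R).
Hypothesis e0 : 0 < e.

Definition cutoff (y : 'rV[R]_n) : R^o :=
  \prod_i (flat 0 (e - (y - y0) 0 i) * flat 0 (e + (y - y0) 0 i)).

Lemma cutoff_Cm m : Cm_on m setT cutoff.
Proof.
have affine (b : R) (i : 'I_n) (s : R) :
    Cm_on m setT (fun y : 'rV[R]_n => flat 0 (b + s * (y - y0) 0 i)).
  have := @Cm_on_affine R 'rV[R]_n R^o R^o m setT (flat 0)
    (fun y => b + s * (y - y0) 0 i) (fun v => s * v 0 i).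
  rewrite preimage_setT; apply.
  - move=> y; apply: (@continuousD R R^o 'rV[R]_n (cst b)
      (fun y => s * (y - y0) 0 i)); first exact: cst_continuous.
    apply: (@continuousM R 'rV[R]_n (cst s) (fun y => (y - y0) 0 i)).
      exact: cst_continuous.
    apply: (@continuous_comp _ _ _ (fun y : 'rV[R]_n => y - y0) (fun M : 'rV[R]_n => M 0 i)).
      by apply: continuousB => //; exact: cst_continuous.
    exact: coord_continuous.
  - move=> x v t; rewrite !mxE /GRing.scale /=; ring.
  - exact: flat_Cm.
apply: Cm_on_prod; first exact: openT.
move=> i; apply: Cm_onM; first exact: openT.
- have -> : (fun y : 'rV[R]_n => flat 0 (e - (y - y0) 0 i)) =
      (fun y => flat 0 (e + (-1) * (y - y0) 0 i)).
    by apply/funext => y; rewrite mulN1r.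
  exact: affine.
- have -> : (fun y : 'rV[R]_n => flat 0 (e + (y - y0) 0 i)) =
      (fun y => flat 0 (e + 1 * (y - y0) 0 i)).
    by apply/funext => y; rewrite mul1r.
  exact: affine.
Qed.

Lemma cutoff_center : cutoff y0 != 0.
Proof.
apply/prodf_neq0 => i _; rewrite subrr mxE subr0 addr0 /flat e0.
by rewrite expr0 mul1r mulf_neq0// gt_eqF// expR_gt0.
Qed.

Lemma cutoff_support y : cutoff y != 0 -> forall i, `|(y - y0) 0 i| <= e.
Proof.
move=> /prodf_neq0 H i; have := H i isT.
rewrite mulf_eq0 negb_or /flat; case: ifPn => [A|]; last by rewrite eqxx.
case: ifPn => [B _|]; last by rewrite eqxx andbF.
by rewrite ler_norml; apply/andP; split; lra.
Qed.

End Bump.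

Arguments cutoff {R n} y0 e y.

(** * The tangent space is spanned by coordinate derivations *)

Section Manifold.
Context {R : realType} {M : topologicalType} {n : nat}.
Variable A : set (chart R M n).
Hypothesis hA : smooth_atlas A.
Local Notation smooth := (smooth_fun A).

Lemma chart_ok c : A c -> is_chart c.
Proof. by have [H _ _] := hA; exact: H. Qed.

Lemma open_chart_cod c : A c -> open (chart_cod c).
Proof. by move=> /chart_ok[]. Qed.

Lemma chart_funK c y : A c -> chart_cod c y -> chart_fun c (chart_inv c y) = y.
Proof. by move=> /chart_ok[_ _ K _ _] [p dp <-]; rewrite K. Qed.

Lemma chart_inv_dom c y : A c -> chart_cod c y -> chart_dom c (chart_inv c y).
Proof. by move=> /chart_ok[_ _ K _ _] [p dp <-]; rewrite K. Qed.

Lemma smooth_cst (a : R) : smooth (fun=> a).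
Proof. by move=> c Ac m; exact: (@Cm_on_cst R 'rV[R]_n R^o m _ a). Qed.

Lemma smooth_add f g : smooth f -> smooth g -> smooth (fun q => f q + g q).
Proof.
move=> sf sg c Ac m.
exact: (Cm_onD (open_chart_cod Ac) (sf c Ac m) (sg c Ac m)).
Qed.

Lemma smooth_mul f g : smooth f -> smooth g -> smooth (fun q => f q * g q).
Proof.
move=> sf sg c Ac m.
exact: (Cm_onM (open_chart_cod Ac) (sf c Ac m) (sg c Ac m)).
Qed.

Lemma smooth_sum (I : Type) (s : seq I) (f : I -> M -> R) :
  (forall i, smooth (f i)) -> smooth (fun q => \sum_(i <- s) f i q).
Proof.
move=> sf c Ac m; apply: (@Cm_on_sum R 'rV[R]_n m _ I s (fun i => f i \o chart_inv c)).
  exact: open_chart_cod.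
by move=> i; exact: sf.
Qed.

Section Tangent.
Variables (p : M) (v : tvec R M).
Hypothesis tv : tangent A p v.

Lemma tangent_lin a f h : smooth f -> smooth h ->
  v (fun q => a * f q + h q) = a * v f + v h.
Proof. by have [_ H _] := tv; exact: H. Qed.

Lemma tangent_cst a : v (fun=> a) = 0.
Proof.
have s1 : smooth (fun=> 1) := smooth_cst 1.
have s0 : smooth (fun=> 0) := smooth_cst 0.
have v1 : v (fun=> 1) = 0.
  have [_ _ /(_ _ _ s1 s1)] := tv.
  have -> : (fun=> 1 * 1 : R) = (fun _ : M => 1 : R) by apply/funext => x; rewrite mulr1.
  by rewrite !mul1r => /eqP; rewrite -subr_eq subrr eq_sym => /eqP.
have v0 : v (fun=> 0) = 0.
  have := tangent_lin 1 s0 s0.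
  have -> : (fun=> 1 * 0 + 0 : R) = (fun _ : M => 0 : R).
    by apply/funext => x; rewrite mulr0 addr0.
  by rewrite mul1r => /eqP; rewrite -subr_eq subrr eq_sym => /eqP.
have := tangent_lin a s1 s0.
have -> : (fun=> a * 1 + 0 : R) = (fun _ : M => a : R).
  by apply/funext => x; rewrite mulr1 addr0.
by rewrite v1 v0 mulr0 addr0.
Qed.

Lemma tangentD f h : smooth f -> smooth h ->
  v (fun q => f q + h q) = v f + v h.
Proof.
move=> sf sh; have := tangent_lin 1 sf sh.
by under eq_fun do rewrite mul1r; rewrite mul1r.
Qed.

Lemma tangentZ a f : smooth f -> v (fun q => a * f q) = a * v f.
Proof.
move=> sf; have := tangent_lin a sf (smooth_cst 0).
by under eq_fun do rewrite addr0; rewrite tangent_cst addr0.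
Qed.

Lemma tangentM f h : smooth f -> smooth h ->
  v (fun q => f q * h q) = f p * v h + h p * v f.
Proof. by have [_ _ H] := tv; exact: H. Qed.

Lemma tangent_sum (I : Type) (s : seq I) (f : I -> M -> R) :
  (forall i, smooth (f i)) ->
  v (fun q => \sum_(i <- s) f i q) = \sum_(i <- s) v (f i).
Proof.
move=> sf; elim: s => [|i s IH].
  by under eq_fun do rewrite big_nil; rewrite tangent_cst big_nil.
under eq_fun do rewrite big_cons.
by rewrite tangentD// ?IH ?big_cons//; exact: smooth_sum.
Qed.

End Tangent.

Lemma open_preimage_cap (S T : topologicalType) (f : S -> T) (U : set S) (O : set T) :
  open U -> (forall x, U x -> {for x, continuous f}) -> open O ->
  open (U `&` f @^-1` O).
Proof.
move=> oU cf oO; rewrite openE => x [Ux Ofx]; rewrite /interior.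
apply: filterI; first exact: open_nbhs_nbhs.
by apply: cf => //; exact: open_nbhs_nbhs.
Qed.

Hypothesis hH : hausdorff_space M.
Variables (c : chart R M n) (Ac : A c) (p : M) (dp : chart_dom c p) (r : R).
Hypothesis r0 : 0 < r.
Let y0 := chart_fun c p.
Hypothesis ball_cod : ball y0 r `<=` chart_cod c.

Let e := r / 2.
Let e0 : 0 < e. Proof. by rewrite divr_gt0. Qed.

(** Extension by zero of a function of the coordinates, cut off near [p], where
    it is multiplied by the constant [cutoff y0 e y0], which is not [1]. *)
Definition ext (h : 'rV[R]_n -> R^o) (q : M) : R :=
  if `[< chart_dom c q >] then cutoff y0 e (chart_fun c q) * h (chart_fun c q) else 0.

Let box : set 'rV[R]_n := [set y | forall i, (`[y0 0 i - e, y0 0 i + e]%classic : set R) (y 0 i)].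

Let box_compact : compact box.
Proof.
apply: (@rV_compact R n (fun i => `[y0 0 i - e, y0 0 i + e]%classic)) => i.
exact: segment_compact.
Qed.

Let bump_box y : cutoff y0 e y != 0 -> box y.
Proof.
move=> /cutoff_support H i; have := H i.
rewrite !mxE /= in_itv /= ler_norml => /andP[? ?]; apply/andP; split; lra.
Qed.

Let box_ball : box `<=` ball y0 r.
Proof.
move=> y H; rewrite -ball_normE /= [X in X < _]mx_normrE.
apply/bigmax_ltP; split=> // -[i j] _ /=; rewrite !mxE ord1.
have := H j; rewrite /= in_itv /= => /andP[? ?].
have er : r = e + e by rewrite /e -splitr.
by have := e0; rewrite ltr_norml er => ?; apply/andP; split; lra.
Qed.

(** In a chart [c'], the function is a composition with a change of charts near
    the points of the image [K] of a box that contains the support of the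
    cutoff, and vanishes near all other points, because [K] is compact, hence
    closed in a Hausdorff space. *)
Lemma ext_smooth h : smooth_on (ball y0 r) h -> smooth (ext h).
Proof.
move=> sh c' Ac' m; apply: Cm_on_pointwise => y cy.
have [oc oc' _ _ ci] := chart_ok Ac'.
have [od _ cK cf cci] := chart_ok Ac.
pose K : set M := chart_inv c @` box.
have boxcod k : box k -> chart_cod c k by move=> /box_ball/ball_cod.
have cK' : closed K.
  apply: compact_closed => //; apply: continuous_compact => //.
  by apply: continuous_in_subspaceT => k; rewrite inE => /boxcod/cci.
have [Ky|Ky] := pselect (K (chart_inv c' y)); last first.
  pose W := chart_cod c' `&` chart_inv c' @^-1` (~` K).
  have oW : open W by apply: open_preimage_cap => //; exact: closed_openC.
  apply: (@Cm_onW _ _ _ _ W); first by move=> z /= ->; split.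
  apply: (@Cm_on_eq _ _ _ _ _ (cst 0)) => //; last exact: Cm_on_cst.
  move=> z [cz Kz]; rewrite /= /ext; case: ifPn => // /asboolP dz.
  have [->|/bump_box bz] := eqVneq (cutoff y0 e (chart_fun c (chart_inv c' z))) 0.
    by rewrite mul0r.
  by exfalso; apply: Kz; exists (chart_fun c (chart_inv c' z)) => //; rewrite cK.
pose W0 := chart_cod c' `&` chart_inv c' @^-1` (chart_dom c).
have oW0 : open W0 by exact: open_preimage_cap.
have cW0 x : W0 x -> {for x, continuous (chart_fun c \o chart_inv c')}.
  by move=> [cx dx]; apply: continuous_comp; [exact: ci|exact: cf].
pose W := W0 `&` (chart_fun c \o chart_inv c') @^-1` (ball y0 r).
have oW : open W by apply: open_preimage_cap => //; exact: ball_open.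
have Wy : W y.
  case: Ky => k bk kE; have kc := boxcod _ bk.
  split; first by split=> //=; rewrite -kE; exact: chart_inv_dom.
  by rewrite /= -kE chart_funK//; exact: box_ball.
apply: (@Cm_onW _ _ _ _ W); first by move=> z /= ->.
apply: (@Cm_on_eq _ _ _ _ _
  ((fun z => cutoff y0 e z * h z : R^o) \o (chart_fun c \o chart_inv c'))) => //.
  by move=> z [[cz dz] Bz]; rewrite /= /ext asboolT.
apply: (@Cm_on_comp _ _ _ _ W (ball y0 r)) => //.
- exact: ball_open.
- by move=> z [].
- apply: Cm_onM; first exact: ball_open.
    by apply: (@Cm_onW _ _ _ _ setT) => //; exact: cutoff_Cm.
  exact: sh.
- have [_ _ /(_ _ _ Ac' Ac m)] := hA.
  apply: Cm_onW => z [[cz dz] _]; exists (chart_inv c' z).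
    by split=> //; exact: chart_inv_dom.
  by rewrite chart_funK.
Qed.

Lemma ext_center h : ext h p = cutoff y0 e y0 * h y0.
Proof. by rewrite /ext asboolT. Qed.

Definition partial_at (i : 'I_n) : tvec R M :=
  fun f => if `[< smooth f >] then 'D_(delta_mx 0 i) (f \o chart_inv c : _ -> R^o) y0 else 0.

Let cod_y0 : chart_cod c y0. Proof. by exists p. Qed.

Lemma smooth_derivable f i : smooth f ->
  derivable (f \o chart_inv c : _ -> R^o) y0 (delta_mx 0 i).
Proof. by move=> /(_ c Ac 1%N)[_ /(_ (delta_mx 0 i))[+ _]]; apply. Qed.

Lemma partial_at_tangent i : tangent A p (partial_at i).
Proof.
have [_ _ cK _ _] := chart_ok Ac.
have y0K : chart_inv c y0 = p by exact: cK.
split.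
- by move=> f nf; rewrite /partial_at asboolF.
- move=> a f h sf sh; rewrite /partial_at !asboolT//; last first.
    apply: smooth_add => //; apply: smooth_mul => //; exact: smooth_cst.
  have df := @smooth_derivable _ i sf; have dh := @smooth_derivable _ i sh.
  by have := deriveD (@derivableZ _ _ _ _ a _ _ df) dh; rewrite deriveZ//; exact.
- move=> f h sf sh; rewrite /partial_at !asboolT//; last exact: smooth_mul.
  have df := @smooth_derivable _ i sf; have dh := @smooth_derivable _ i sh.
  by have := deriveM df dh; rewrite /= y0K; exact.
Qed.

Definition coord_fun (i : 'I_n) (y : 'rV[R]_n) : R^o := (y - y0) 0 i.

Lemma coord_fun_smooth i : smooth_on (ball y0 r) (coord_fun i).
Proof.
move=> m.
have : Cm_on m setT (fun y : 'rV[R]_n => y - y0).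
  have oT := @openT 'rV[R]_n.
  have := @Cm_onD R _ _ m _ id (cst (- y0)) oT; apply; last exact: Cm_on_cst.
  have cid : forall x : 'rV[R]_n, setT x -> {for x, continuous id} by move=> x _.
  case: m => [|m]; first by split.
  split=> // v; split; first by move=> x _; exact: derivable_id.
  have -> : (fun x => 'D_v id x) = cst v :> ('rV[R]_n -> 'rV[R]_n).
    by apply/funext => x; rewrite derive_id.
  exact: Cm_on_cst.
move=> H; have := Cm_on_coord i (@openT 'rV[R]_n) H; exact: Cm_onW.
Qed.

(** If [rho] is the extension of [1], [x_i] those of the coordinates and [g_i]
    those of the functions in Hadamard's lemma, then
    [rho^2 (f - f p) = sum_i x_i g_i] everywhere on the manifold.  Apply [v]: the
    factors [f - f p] and [x_i] vanish at [p], and [g_i p] is a partial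
    derivative of [f], up to a constant. *)
Lemma tangent_span : exists a : tvec R M -> 'I_n -> R,
  forall v, tangent A p v -> forall f, v f = \sum_i a v i * partial_at i f.
Proof.
have [_ _ cK _ _] := chart_ok Ac.
have y0K : chart_inv c y0 = p by exact: cK.
pose b := cutoff y0 e y0.
have b0 : b != 0 by exact: cutoff_center.
exists (fun v i => v (ext (coord_fun i)) / b) => v tv f.
have [sf|nsf] := pselect (smooth f); last first.
  have [-> // _ _] := tv; rewrite big1// => i _; rewrite /partial_at.
  by rewrite asboolF// mulr0.
pose phi := f \o chart_inv c : 'rV[R]_n -> R^o.
have sphi m : Cm_on m (ball y0 r) phi by exact: Cm_onW (sf c Ac m).
pose g i : 'rV[R]_n -> R^o := wavg y0 0 (fun y => 'D_(delta_mx 0 i) phi y).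
have sg i : smooth_on (ball y0 r) (g i).
  move=> m; apply: wavg_Cm.
  by have [_ /(_ (delta_mx 0 i))[]] := sphi m.+1.
pose one : 'rV[R]_n -> R^o := cst 1.
have s1 : smooth_on (ball y0 r) one by move=> m; exact: Cm_on_cst.
have srho := ext_smooth s1.
have sx i := ext_smooth (coord_fun_smooth i).
have sgx i := ext_smooth (sg i).
have sfp : smooth (fun q => f q + (- f p)).
  by apply: smooth_add => //; exact: smooth_cst.
have E : (fun q => ext one q * (ext one q * (f q - f p))) =
    (fun q => \sum_i ext (coord_fun i) q * ext (g i) q).
  apply/funext => q; rewrite /ext; case: ifPn => [/asboolP dq|_]; last first.
    by rewrite mul0r big1// => i _; rewrite mul0r.
  set y := chart_fun c q.
  have [->|/bump_box/box_ball By] := eqVneq (cutoff y0 e y) 0.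
    by rewrite !mul0r big1// => i _; rewrite !mul0r.
  have -> : f q = phi y by rewrite /phi /= /y cK.
  have -> : f p = phi y0 by rewrite /phi /= y0K.
  rewrite (hadamard (sphi 1%N) By) [phi y0 + _]addrC addrK mulr_sumr mulr_sumr.
  have key (k x w : R) : k * 1 * (k * 1 * (x * w)) = k * x * (k * w) by ring.
  by apply: eq_bigr => i _; exact: key.
have := congr1 v E.
rewrite (tangentM tv srho (smooth_mul srho sfp)) (tangentM tv srho sfp).
rewrite (tangentD tv sf (smooth_cst _)) (tangent_cst tv) addr0 subrr.
rewrite !ext_center -/b /one /= mulr1 mulr0 !mul0r !addr0.
rewrite (tangent_sum tv); last by move=> i; exact: smooth_mul.
move=> H; apply: (mulfI b0); apply: (mulfI b0); rewrite H mulr_sumr mulr_sumr.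
apply: eq_bigr => i _; rewrite (tangentM tv)// !ext_center -/b.
rewrite {1}/coord_fun subrr mxE mulr0 mul0r add0r /g.
have -> : wavg y0 0 (fun y => 'D_(delta_mx 0 i) phi y) y0 = partial_at i f.
  rewrite /wavg /partial_at asboolT// /int01.
  rewrite (@eq_Rintegral _ _ _ _ _ (fun=> 'D_(delta_mx 0 i) phi y0)).
    rewrite Rintegral_cst//= lebesgue_measure_itv /= lte01 /=.
    by rewrite oppr0 addr0 mulr1.
  by move=> t _; rewrite expr0 mul1r /seg subrr scaler0 add0r.
by field.
Qed.

End Manifold.

(** * Smooth functions on products of a manifold *)

Section SmoothProd.
Context {R : realType} {M : topologicalType} {n : nat}.
Variable A : set (chart R M n).
Hypothesis hA : smooth_atlas A.

Lemma matrix_close k (y z : 'M[R]_(k, n)) (e : R) : 0 < e ->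
  (forall i, `|row i y - row i z| < e) -> `|y - z| < e.
Proof.
move=> e0 H; rewrite [ltLHS]mx_normrE; apply/bigmax_ltP; split=> // -[i j] _ /=.
have := H i; rewrite [X in X < _ -> _]mx_normrE => /bigmax_ltP[_ /(_ (0, j) isT)] /=.
by rewrite !mxE.
Qed.

Lemma row_continuous k (i : 'I_k) : continuous (row i : 'M[R]_(k, n) -> 'rV[R]_n).
Proof.
move=> y; apply/(@cvgrPdist_lt R 'rV[R]_n 'M[R]_(k, n) (nbhs y) (nbhs_filter y)).
move=> e e0; near=> z.
have : `|y - z| < e.
  near: z; exact: (@cvgr_dist_lt R 'M[R]_(k, n) 'M[R]_(k, n) (nbhs y) (nbhs_filter y) id y cvg_id).
rewrite [X in X < _ -> _]mx_normrE => /bigmax_ltP[_ H].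
rewrite [ltLHS]mx_normrE; apply/bigmax_ltP; split=> // -[a j] _ /=.
by have := H (i, j) isT; rewrite !mxE.
Unshelve. all: by end_near. Qed.

Definition box_cod k (c : 'I_k -> chart R M n) : set 'M[R]_(k, n) :=
  [set y | forall i, chart_cod (c i) (row i y)].

Lemma open_box_cod k (c : 'I_k -> chart R M n) : (forall i, A (c i)) ->
  open (box_cod c).
Proof.
move=> Ac; rewrite openE => y cy; rewrite /interior.
have H i : nbhs y (fun z => chart_cod (c i) (row i z)).
  apply: (@row_continuous _ i y).
  apply: (@open_nbhs_nbhs _ (row i y) (chart_cod (c i))).
  by split; [exact: (open_chart_cod hA (Ac i))|exact: cy].
exact: (@filter_forall _ _ _ (nbhs y) (nbhs_filter y) H).
Qed.

Lemma smooth_prod_mul k (f g : ('I_k -> M) -> R) :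
  smooth_fun_prod A f -> smooth_fun_prod A g ->
  smooth_fun_prod A (fun x => f x * g x).
Proof.
move=> sf sg c Ac m.
exact: (Cm_onM (open_box_cod Ac) (sf c Ac m) (sg c Ac m)).
Qed.

Lemma smooth_prod_scale k (a : R) (f : ('I_k -> M) -> R) :
  smooth_fun_prod A f -> smooth_fun_prod A (fun x => a * f x).
Proof.
move=> sf c Ac m.
exact: (Cm_onM (open_box_cod Ac) (Cm_on_cst m _ (a : R^o)) (sf c Ac m)).
Qed.

Lemma linear_mx_continuous k l (L : 'M[R]_(k, n) -> 'M[R]_(l, n)) (s : 'I_l -> 'I_k) :
  (forall y i, row i (L y) = row (s i) y) -> continuous L.
Proof.
move=> HL y.
apply/(@cvgrPdist_lt R 'M[R]_(l, n) 'M[R]_(k, n) (nbhs y) (nbhs_filter y)).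
move=> e e0; near=> z.
apply: matrix_close => // i; rewrite !HL.
move: i; near: z; apply: (@filter_forall _ _ _ (nbhs y) (nbhs_filter y)) => i.
exact: (@cvgr_dist_lt R 'rV[R]_n 'M[R]_(k, n) (nbhs y) (nbhs_filter y) (row (s i))
  _ (@row_continuous k (s i) y) e e0).
Unshelve. all: by end_near. Qed.

Lemma smooth_prod_reindex k l (s : 'I_l -> 'I_k) (f : ('I_l -> M) -> R) :
  smooth_fun_prod A f -> smooth_fun_prod A (fun x : 'I_k -> M => f (x \o s)).
Proof.
move=> sf c Ac m.
pose L (y : 'M[R]_(k, n)) : 'M[R]_(l, n) := \matrix_(i, j) y (s i) j.
have rL y i : row i (L y) = row (s i) y by apply/rowP => j; rewrite !mxE.
have := @Cm_on_affine R 'M[R]_(k, n) 'M[R]_(l, n) R^o m (box_cod (c \o s))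
  (fun y => f (fun i => chart_inv (c (s i)) (row i y))) L L.
move=> /(_ (linear_mx_continuous rL)) H.
have {H} := H _ (sf (c \o s) (fun i => Ac (s i)) m).
have -> : (fun y => f (fun i => chart_inv (c (s i)) (row i y))) \o L =
    (fun y => f ((fun i => chart_inv (c i) (row i y)) \o s)).
  by apply/funext => y /=; congr f; apply/funext => i /=; rewrite rL.
move=> H; apply: (Cm_onW _ (H _)).
  by move=> y cy i; rewrite rL; exact: cy.
by move=> x v t; apply/matrixP => i j; rewrite !mxE.
Qed.

(** The chart for the free point is arbitrary; the frozen points are read in
    charts of their own. *)
Lemma smooth_prod_partial k (f : ('I_k -> M) -> R) (x : 'I_k -> M) (i0 : 'I_k) :
  smooth_fun_prod A f ->
  smooth_fun A (fun y => f (fun j => if j == i0 then y else x j)).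
Proof.
move=> sf c Ac m.
have [_ cov _] := hA.
have /choice[d Hd] : forall j : 'I_k, exists d, A d /\ chart_dom d (x j).
  by move=> j; have [d Ad dj] := cov (x j); exists d.
pose c' j := if j == i0 then c else d j.
have Ac' j : A (c' j) by rewrite /c'; case: ifP => // _; have [] := Hd j.
pose L (z : 'rV[R]_n) : 'M[R]_(k, n) :=
  \matrix_(i, j) (if i == i0 then z 0 j else chart_fun (d i) (x i) 0 j).
pose l (z : 'rV[R]_n) : 'M[R]_(k, n) :=
  \matrix_(i, j) (if i == i0 then z 0 j else 0).
have rL z i : row i (L z) = if i == i0 then z else chart_fun (d i) (x i).
  by apply/rowP => j; rewrite !mxE; case: ifP.
have cL : continuous L.
  move=> z.
  apply/(@cvgrPdist_lt R 'M[R]_(k, n) 'rV[R]_n (nbhs z) (nbhs_filter z)).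
  move=> e e0; near=> w.
  apply: matrix_close => // i; rewrite !rL; case: ifP => _; last first.
    by rewrite subrr normr0.
  near: w; exact: (@cvgr_dist_lt R 'rV[R]_n 'rV[R]_n (nbhs z) (nbhs_filter z) id z cvg_id).
have := @Cm_on_affine R 'rV[R]_n 'M[R]_(k, n) R^o m (box_cod c')
  (fun y => f (fun i => chart_inv (c' i) (row i y))) L l cL.
move=> H; have {H} := H _ (sf c' Ac' m).
have E : (fun y => f (fun i => chart_inv (c' i) (row i y))) \o L =
    (fun y => f (fun j => if j == i0 then y else x j)) \o chart_inv c.
  apply/funext => y /=; congr f; apply/funext => i /=; rewrite rL /c'.
  case: ifP => // _; have [Ad dx] := Hd i.
  by have [_ _ K _ _] := chart_ok hA Ad; rewrite K.
rewrite E => H; apply: (Cm_onW _ (H _)).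
  move=> y cy i; rewrite rL /c'; case: ifP => // _; have [Ad dx] := Hd i.
  by exists (x i).
by move=> z v t; apply/matrixP => i j; rewrite !mxE; case: ifP => // _; rewrite mulr0 add0r.
Unshelve. all: by end_near. Qed.

Lemma smooth_prod_continuous k (f : ('I_k -> M) -> R) (x : 'I_k -> M) (e : R) :
  smooth_fun_prod A f -> 0 < e ->
  exists N : 'I_k -> set M, (forall i, nbhs (x i) (N i)) /\
    forall x', (forall i, N i (x' i)) -> `|f x - f x'| < e.
Proof.
move=> sf e0; have [_ cov _] := hA.
have /choice[d Hd] : forall j : 'I_k, exists d, A d /\ chart_dom d (x j).
  by move=> j; have [d Ad dj] := cov (x j); exists d.
have Ad i : A (d i) by have [] := Hd i.
have dx i : chart_dom (d i) (x i) by have [] := Hd i.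
pose Y (x : 'I_k -> M) : 'M[R]_(k, n) := \matrix_(i, j) chart_fun (d i) (x i) 0 j.
have rY x' i : row i (Y x') = chart_fun (d i) (x' i).
  by apply/rowP => j; rewrite !mxE.
have [/(_ (Y x)) + _] := sf d Ad 0%N.
have cY : box_cod d (Y x) by move=> i; rewrite rY; exists (x i).
move=> /(_ cY)/cvgrPdist_lt/(_ _ e0)/nbhs_ballP[r /= r0 Hr].
have fE x' : (forall i, chart_dom (d i) (x' i)) ->
    f (fun i => chart_inv (d i) (row i (Y x'))) = f x'.
  move=> dx'; congr f; apply/funext => i; rewrite rY.
  by have [_ _ K _ _] := chart_ok hA (Ad i); rewrite K.
exists (fun i => [set q | chart_dom (d i) q /\
    `|chart_fun (d i) (x i) - chart_fun (d i) q| < r]); split.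
  move=> i; have [od _ _ cf _] := chart_ok hA (Ad i).
  apply: filterI; first exact: open_nbhs_nbhs.
  by have /cvgrPdist_lt := cf _ (dx i); apply.
move=> x' Hx'.
have dx' i : chart_dom (d i) (x' i) by have [] := Hx' i.
have := Hr (Y x'); rewrite !fE//; apply.
rewrite -ball_normE /=; apply: matrix_close => // i; rewrite !rY.
by have [] := Hx' i.
Qed.

(** The function is continuous on the product, in which the power of a compact
    set is compact by Tychonoff's theorem. *)
Lemma smooth_prod_bounded k (f : ('I_k -> M) -> R) :
  smooth_fun_prod A f -> compactly_supported_prod f ->
  exists B : R, forall x, `|f x| <= B.
Proof.
move=> sf [K cK fK].
pose P := prod_topology (fun _ : 'I_k => M).
have cf : continuous (f : P -> R^o).
  move=> x; apply/(@cvgrPdist_lt R R^o P (nbhs x) (nbhs_filter x)) => e e0.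
  have [N [nN HN]] := smooth_prod_continuous x sf e0.
  have H i : nbhs x (fun x' : P => N i (x' i)).
    exact: (@proj_continuous _ (fun _ : 'I_k => M) i x _ (nN i)).
  have := @filter_forall _ _ _ (nbhs x) (nbhs_filter x) H.
  by apply: (@filterS _ (nbhs x) (nbhs_filter x)) => x' /HN.
pose S : set P := [set x | forall i, K (x i)].
have cS : compact S by exact: (@tychonoff 'I_k (fun _ => M) (fun _ => K)).
have : compact (f @` S).
  by apply: continuous_compact => //; exact: continuous_subspaceT.
move=> /compact_bounded[B [_ HB]].
exists (`|B| + 1) => x; have [Sx|nSx] := pselect (S x).
  apply: HB; last by exists x.
  by rewrite (le_lt_trans (ler_norm B))// ltrDl.
by rewrite fK ?normr0 ?addr_ge0.
Qed.

End SmoothProd.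

(** * The algebra of cylindrical functions *)

Section CylinderAlgebra.
Context {R : realType} {n : nat} {M : riemannianManifold R n} {T : R} {x0 : M}.
Local Notation tm := (@cyl_time R n M _).
Local Notation fn := (@cyl_fun R n M _).
Local Notation A := (rm_atlas M).
Local Notation Om := (path_space T x0).
Let hA : smooth_atlas A := rm_atlasP M.
Implicit Types (c : cylinder M) (F G : seq (cylinder M)).

Definition merged_times (c1 c2 : cylinder M) : seq R :=
  sort <=%R (undup (codom (@cyl_time _ _ _ c1) ++ codom (@cyl_time _ _ _ c2))).

(** A position outside of [s] is sent to an arbitrary index; it occurs for no
    time of the two cylinders below. *)
Definition time_pos (s : seq R) (t : R) : 'I_(size s).-1.+1 := inord (index t s).

(** The product depends on the path at the times of both factors, each counted
    once since evaluation times have to be strictly increasing. *)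
Definition cyl_mul (c1 c2 : cylinder M) : cylinder M :=
  let s := merged_times c1 c2 in
  @Cylinder _ _ _ (size s).-1 (fun i => nth 0 s i)
    (fun x => @cyl_fun _ _ _ c1 (x \o time_pos s \o @cyl_time _ _ _ c1)
            * @cyl_fun _ _ _ c2 (x \o time_pos s \o @cyl_time _ _ _ c2)).

Definition cyl_scale (a : R) (c : cylinder M) : cylinder M :=
  @Cylinder _ _ _ (cyl_len c) (@cyl_time _ _ _ c) (fun x => a * @cyl_fun _ _ _ c x).

Lemma nth_time_pos s t : t \in s -> nth 0 s (time_pos s t) = t.
Proof.
move=> ts; rewrite /time_pos inordK ?nth_index//.
have s0 : (0 < size s)%N by case: s ts.
by rewrite prednK// index_mem.
Qed.

Lemma mem_merged c1 c2 t : (t \in merged_times c1 c2) =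
  (t \in codom (@cyl_time _ _ _ c1)) || (t \in codom (@cyl_time _ _ _ c2)).
Proof. by rewrite mem_sort mem_undup mem_cat. Qed.

Lemma merged1 c1 c2 i : @cyl_time _ _ _ c1 i \in merged_times c1 c2.
Proof. by rewrite mem_merged codom_f. Qed.

Lemma merged2 c1 c2 i : @cyl_time _ _ _ c2 i \in merged_times c1 c2.
Proof. by rewrite mem_merged codom_f orbT. Qed.

Lemma merged_gt0 c1 c2 : (0 < size (merged_times c1 c2))%N.
Proof. by have := @merged1 c1 c2 ord0; case: merged_times. Qed.

Lemma merged_nth c1 c2 (i : 'I_(size (merged_times c1 c2)).-1.+1) :
  (exists i1, nth 0 (merged_times c1 c2) i = @cyl_time _ _ _ c1 i1) \/
  (exists i2, nth 0 (merged_times c1 c2) i = @cyl_time _ _ _ c2 i2).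
Proof.
have : nth 0 (merged_times c1 c2) i \in merged_times c1 c2.
  by rewrite mem_nth//; case: i => i /=; rewrite prednK// merged_gt0.
by rewrite mem_merged => /orP[/codomP[j ->]|/codomP[j ->]]; [left|right]; exists j.
Qed.

Lemma merged_sorted c1 c2 : sorted <%R (merged_times c1 c2).
Proof. by rewrite /merged_times sort_lt_sorted undup_uniq. Qed.

Lemma time_pos_nth c1 c2 (i : 'I_(size (merged_times c1 c2)).-1.+1) :
  time_pos (merged_times c1 c2) (nth 0 (merged_times c1 c2) i) = i.
Proof.
have si : (i < size (merged_times c1 c2))%N.
  by case: i => i /=; rewrite prednK// merged_gt0.
apply/val_inj; rewrite /time_pos index_uniq//=; first by rewrite inordK.
exact: (lt_sorted_uniq (merged_sorted c1 c2)).
Qed.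

Lemma smooth_cyl_mul c1 c2 : smooth_cylinder T c1 -> smooth_cylinder T c2 ->
  smooth_cylinder T (cyl_mul c1 c2).
Proof.
move=> [s1 [K1 cK1 f1] p1 o1 [t1 t1T le1]] [s2 [K2 cK2 f2] p2 o2 [t2 t2T le2]].
split => /=.
- apply: smooth_prod_mul => //.
    exact: (smooth_prod_reindex (time_pos (merged_times c1 c2) \o @cyl_time _ _ _ c1) s1).
  exact: (smooth_prod_reindex (time_pos (merged_times c1 c2) \o @cyl_time _ _ _ c2) s2).
- exists (K1 `|` K2); first exact: compactU.
  move=> x /existsNP[i nK].
  have [[i1 E]|[i2 E]] := merged_nth i.
    rewrite f1 ?mul0r// => /(_ i1) /=.
    by rewrite -E time_pos_nth => ?; apply: nK; left.
  rewrite f2 ?mulr0// => /(_ i2) /=.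
  by rewrite -E time_pos_nth => ?; apply: nK; right.
- by move=> i; have [[j ->]|[j ->]] := merged_nth i.
- move=> i j ij; rewrite (lt_sorted_ltn_nth _ (merged_sorted c1 c2))// inE.
    by case: i {ij} => i /=; rewrite prednK// merged_gt0.
  by case: j {ij} => j /=; rewrite prednK// merged_gt0.
- exists (Num.max t1 t2); first by rewrite gt_max t1T.
  by move=> i; have [[j ->]|[j ->]] := merged_nth i; rewrite le_max ?le1 ?le2 ?orbT.
Qed.

Lemma smooth_cyl_scale a c : smooth_cylinder T c -> smooth_cylinder T (cyl_scale a c).
Proof.
move=> [s1 [K1 cK1 f1] p1 o1 t1]; split => //=; first exact: smooth_prod_scale.
by exists K1 => // x /f1 ->; rewrite mulr0.
Qed.

Lemma cyl_eval_mul c1 c2 (sig : Om) :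
  cyl_eval (cyl_mul c1 c2) sig = cyl_eval c1 sig * cyl_eval c2 sig.
Proof.
rewrite /cyl_eval /=; congr (_ * _); congr (cyl_fun _); apply/funext => i /=.
  by rewrite nth_time_pos ?merged1.
by rewrite nth_time_pos ?merged2.
Qed.

Definition tangent_along (sig : Om) (h : R -> tvec R M) : Prop :=
  forall s, 0 <= s <= T -> tangent A (Defs.coord s sig) (h s).

Lemma cyl_time_itv c i : smooth_cylinder T c -> 0 <= @cyl_time _ _ _ c i <= T.
Proof.
by move=> [_ _ p _ [t tT le]]; rewrite ltW//= (le_trans (le _))// ltW.
Qed.

Lemma cyl_time_inj c : smooth_cylinder T c -> injective (@cyl_time _ _ _ c).
Proof.
move=> [_ _ _ o _] i j E; apply/val_inj/eqP.
by case: (ltngtP i j) => // /o; rewrite E ltxx.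
Qed.

Lemma smooth_cyl_partial c (sig : Om) i : smooth_cylinder T c ->
  smooth_fun A (fun y => @cyl_fun _ _ _ c
     (fun j => if j == i then y else Defs.coord (@cyl_time _ _ _ c j) sig)).
Proof. by move=> [sf _ _ _ _]; exact: smooth_prod_partial. Qed.

(** A cylindrical function may be viewed as a function of more evaluation times:
    the added times contribute derivatives of constants. *)
Lemma cyl_diff_refine c (s : seq R) (sig : Om) h : smooth_cylinder T c ->
  uniq s -> (forall i, @cyl_time _ _ _ c i \in s) ->
  (forall i : 'I_(size s).-1.+1, 0 <= nth 0 s i <= T) ->
  tangent_along sig h ->
  \sum_(i < (size s).-1.+1) h (nth 0 s i) (fun y => @cyl_fun _ _ _ c
     (fun j => if time_pos s (@cyl_time _ _ _ c j) == i then y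
               else Defs.coord (@cyl_time _ _ _ c j) sig)) = cyl_diff c sig h.
Proof.
move=> sc us ts sT th.
pose pi := time_pos s \o @cyl_time _ _ _ c.
have pi_inj : injective pi.
  move=> i j /(congr1 (fun k : 'I_(size s).-1.+1 => nth 0 s k)).
  by rewrite /pi /= !nth_time_pos//; exact: cyl_time_inj.
rewrite (bigID (mem (codom pi))) /= [X in _ + X]big1 ?addr0; last first.
  move=> i /codomP ni.
  rewrite (_ : (fun y => _) = fun=> @cyl_fun _ _ _ c
    (fun j => Defs.coord (@cyl_time _ _ _ c j) sig)).
    exact: tangent_cst (th _ (sT i)) _.
  apply/funext => y; congr (cyl_fun _); apply/funext => j.
  by case: eqP => // E; exfalso; apply: ni; exists j; rewrite /pi /= E.
rewrite (eq_bigl (fun i => i \in (pi @: [set: 'I_(cyl_len c).+1]%SET)%SET)); last first.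
  by move=> i /=; apply/codomP/imsetP => [[j ->]|[j _ ->]]; exists j; rewrite ?inE.
rewrite (big_imset (h := pi)) /=; last by move=> i j _ _; exact: pi_inj.
rewrite /cyl_diff; apply: eq_big => [i|i _]; first by rewrite inE.
rewrite /pi /= nth_time_pos//; congr (h _ _).
apply/funext => y; congr (cyl_fun _); apply/funext => j.
by rewrite (inj_eq pi_inj).
Qed.

(** At each of the merged times this is the Leibniz rule for the derivation
    [h t]. *)
Lemma cyl_diff_mul c1 c2 (sig : Om) h : smooth_cylinder T c1 -> smooth_cylinder T c2 ->
  tangent_along sig h ->
  cyl_diff (cyl_mul c1 c2) sig h =
    cyl_eval c1 sig * cyl_diff c2 sig h + cyl_eval c2 sig * cyl_diff c1 sig h.
Proof.
move=> sc1 sc2 th; pose s := merged_times c1 c2.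
have us : uniq s := lt_sorted_uniq (merged_sorted c1 c2).
have sT (i : 'I_(size s).-1.+1) : 0 <= nth 0 s i <= T.
  by have [[j ->]|[j ->]] := merged_nth i; exact: cyl_time_itv.
rewrite -(cyl_diff_refine sc1 us (@merged1 c1 c2) sT th).
rewrite -(cyl_diff_refine sc2 us (@merged2 c1 c2) sT th).
rewrite !mulr_sumr -big_split /=; apply: eq_bigr => i _.
have part (c : cylinder M) : smooth_cylinder T c ->
    (forall j, @cyl_time _ _ _ c j \in s) ->
    smooth_fun A (fun y => @cyl_fun _ _ _ c
     (fun j => if time_pos s (@cyl_time _ _ _ c j) == i then y
               else Defs.coord (@cyl_time _ _ _ c j) sig)).
  move=> sc ts; have [[j E]|nE] :=
    pselect (exists j, time_pos s (@cyl_time _ _ _ c j) = i).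
    rewrite (_ : (fun y => _) = fun y => @cyl_fun _ _ _ c
     (fun j' => if j' == j then y else Defs.coord (@cyl_time _ _ _ c j') sig)).
      exact: smooth_cyl_partial.
    apply/funext => y; congr (cyl_fun _); apply/funext => j'; rewrite -E.
    have [->|jj'] := eqVneq j' j; first by rewrite eqxx.
    case: eqP => // /(congr1 (fun k : 'I_(size s).-1.+1 => nth 0 s k)).
    by rewrite !nth_time_pos// => /(cyl_time_inj sc) jj; rewrite jj eqxx in jj'.
  rewrite (_ : (fun y => _) = fun=> @cyl_fun _ _ _ c
    (fun j => Defs.coord (@cyl_time _ _ _ c j) sig)); first exact: smooth_cst.
  apply/funext => y; congr (cyl_fun _); apply/funext => j.
  by case: eqP => // E; exfalso; apply: nE; exists j.
have E (c : cylinder M) : (forall j, @cyl_time _ _ _ c j \in s) -> forall y,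
    @cyl_fun _ _ _ c ((fun j => if j == i then y else Defs.coord (nth 0 s j) sig)
        \o time_pos s \o @cyl_time _ _ _ c) =
    @cyl_fun _ _ _ c (fun j => if time_pos s (@cyl_time _ _ _ c j) == i then y
               else Defs.coord (@cyl_time _ _ _ c j) sig).
  move=> ts y; congr (cyl_fun _); apply/funext => j /=.
  by case: ifP => // _; rewrite nth_time_pos.
have E0 (c : cylinder M) : (forall j, @cyl_time _ _ _ c j \in s) ->
    @cyl_fun _ _ _ c (fun j => if time_pos s (@cyl_time _ _ _ c j) == i
        then Defs.coord (nth 0 s i) sig else Defs.coord (@cyl_time _ _ _ c j) sig)
    = cyl_eval c sig.
  move=> ts; rewrite /cyl_eval; congr (cyl_fun _); apply/funext => j.
  by case: eqP => // <-; rewrite nth_time_pos.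
rewrite /= -/s (_ : (fun y => _ * _) = (fun y => @cyl_fun _ _ _ c1
     (fun j => if time_pos s (@cyl_time _ _ _ c1 j) == i then y
               else Defs.coord (@cyl_time _ _ _ c1 j) sig) * @cyl_fun _ _ _ c2
     (fun j => if time_pos s (@cyl_time _ _ _ c2 j) == i then y
               else Defs.coord (@cyl_time _ _ _ c2 j) sig))); last first.
  by apply/funext => y; rewrite !E//; [exact: merged2|exact: merged1].
rewrite (tangentM (th _ (sT i))); last 2 first.
  by apply: part => //; exact: merged1.
  by apply: part => //; exact: merged2.
by rewrite !E0//; [exact: merged2|exact: merged1].
Qed.

Lemma cyl_diff_scale a c (sig : Om) h : smooth_cylinder T c ->
  tangent_along sig h -> cyl_diff (cyl_scale a c) sig h = a * cyl_diff c sig h.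
Proof.
move=> sc th; rewrite /cyl_diff mulr_sumr; apply: eq_bigr => i _ /=.
rewrite (tangentZ (th _ (cyl_time_itv _ sc)))//; exact: smooth_cyl_partial.
Qed.

Lemma smooth_cylinders_cons (c : cylinder M) F :
  smooth_cylinders T (c :: F) <-> smooth_cylinder T c /\ smooth_cylinders T F.
Proof.
split=> [H|[H1 H2]].
  by split=> [|i iF]; [exact: (H 0%N)|exact: (H i.+1)].
by case=> // i; exact: H2.
Qed.

Lemma smooth_cylinders_cat (F G : seq (cylinder M)) :
  smooth_cylinders T F -> smooth_cylinders T G -> smooth_cylinders T (F ++ G).
Proof.
elim: F => //= c F IH /smooth_cylinders_cons[sc sF] sG.
by apply/smooth_cylinders_cons; split => //; exact: IH.
Qed.

Lemma smooth_cylinders_map (f : cylinder M -> cylinder M) (F : seq (cylinder M)) :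
  (forall c, smooth_cylinder T c -> smooth_cylinder T (f c)) ->
  smooth_cylinders T F -> smooth_cylinders T (map f F).
Proof.
move=> Hf; elim: F => //= c F IH /smooth_cylinders_cons[sc sF].
by apply/smooth_cylinders_cons; split; [exact: Hf|exact: IH].
Qed.

Lemma cyls_eval_cat F G (sig : Om) :
  cyls_eval (F ++ G) sig = cyls_eval F sig + cyls_eval G sig.
Proof. exact: big_cat. Qed.

Lemma cyls_diff_cat F G (sig : Om) h :
  cyls_diff (F ++ G) sig h = cyls_diff F sig h + cyls_diff G sig h.
Proof. exact: big_cat. Qed.

Lemma cyls_eval_scale a F (sig : Om) :
  cyls_eval (map (cyl_scale a) F) sig = a * cyls_eval F sig.
Proof. by rewrite /cyls_eval big_map mulr_sumr. Qed.

Lemma cyls_diff_scale a F (sig : Om) h : smooth_cylinders T F ->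
  tangent_along sig h -> cyls_diff (map (cyl_scale a) F) sig h = a * cyls_diff F sig h.
Proof.
move=> + th; elim: F => [|c F IH]; first by rewrite /cyls_diff !big_nil mulr0.
move=> /smooth_cylinders_cons[sc sF].
by rewrite /cyls_diff !big_cons mulrDr cyl_diff_scale//; congr (_ + _); exact: IH.
Qed.

Definition cyls_mul (F G : seq (cylinder M)) : seq (cylinder M) :=
  foldr (fun c acc => map (cyl_mul c) G ++ acc) [::] F.

Lemma smooth_cyls_mul F G : smooth_cylinders T F -> smooth_cylinders T G ->
  smooth_cylinders T (cyls_mul F G).
Proof.
move=> + sG; elim: F => //= c F IH /smooth_cylinders_cons[sc sF].
apply: smooth_cylinders_cat; last exact: IH.
by apply: smooth_cylinders_map sG => c' ?; exact: smooth_cyl_mul.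
Qed.

Lemma cyls_eval_mul F G (sig : Om) :
  cyls_eval (cyls_mul F G) sig = cyls_eval F sig * cyls_eval G sig.
Proof.
elim: F => [|c F IH] /=; first by rewrite /cyls_eval !big_nil mul0r.
rewrite cyls_eval_cat IH [cyls_eval (c :: F) _]/cyls_eval big_cons mulrDl.
congr (_ + _); rewrite /cyls_eval big_map mulr_sumr.
by apply: eq_bigr => c' _; rewrite cyl_eval_mul.
Qed.

Lemma cyls_diff_mul F G (sig : Om) h :
  smooth_cylinders T F -> smooth_cylinders T G -> tangent_along sig h ->
  cyls_diff (cyls_mul F G) sig h =
    cyls_eval F sig * cyls_diff G sig h + cyls_eval G sig * cyls_diff F sig h.
Proof.
move=> + sG th; elim: F => [|c F IH] /=.
  by rewrite /cyls_diff /cyls_eval !big_nil mul0r mulr0 addr0.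
move=> /smooth_cylinders_cons[sc sF]; rewrite cyls_diff_cat IH//.
have -> : cyls_diff (map (cyl_mul c) G) sig h =
    cyl_eval c sig * cyls_diff G sig h + cyls_eval G sig * cyl_diff c sig h.
  elim: (G) sG => [|c' G' IH'].
    by rewrite /cyls_diff /cyls_eval !big_nil mul0r mulr0 addr0.
  move=> /smooth_cylinders_cons[sc' sG'] /=.
  rewrite /cyls_diff /cyls_eval !big_cons cyl_diff_mul//.
  have := IH' sG'; rewrite /cyls_diff /cyls_eval => ->; ring.
rewrite [cyls_eval (c :: F) _]/cyls_eval [cyls_diff (c :: F) _ _]/cyls_diff.
rewrite !big_cons -/(cyls_eval F sig) -/(cyls_diff F sig h); ring.
Qed.

(** Polynomials without constant term operate on cylindrical functions; the
    constant term has to vanish because constants need not have compact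
    support. *)
Lemma cyls_poly F (p : {poly R}) : smooth_cylinders T F ->
  exists G, [/\ smooth_cylinders T G,
    (forall sig : Om, cyls_eval G sig = ('X * p).[cyls_eval F sig]) &
    (forall (sig : Om) h, tangent_along sig h ->
       cyls_diff G sig h = ('X * p)^`().[cyls_eval F sig] * cyls_diff F sig h)].
Proof.
move=> sF; elim/poly_ind: p => [|p c [G [sG eG dG]]].
  exists [::]; split=> [//|sig|sig h th]; rewrite mulr0 ?deriv0 hornerC.
    by rewrite /cyls_eval big_nil.
  by rewrite /cyls_diff big_nil mul0r.
exists (cyls_mul F G ++ map (cyl_scale c) F); split.
- apply: smooth_cylinders_cat; first exact: smooth_cyls_mul.
  by apply: smooth_cylinders_map sF => c' ?; exact: smooth_cyl_scale.
- move=> sig; rewrite cyls_eval_cat cyls_eval_mul cyls_eval_scale eG.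
  by rewrite !(hornerM, hornerD, hornerX, hornerC); ring.
- move=> sig h th; rewrite cyls_diff_cat cyls_diff_mul// cyls_diff_scale//.
  rewrite dG// eG !(derivM, derivD, derivX, derivC).
  by rewrite !(hornerM, hornerD, hornerX, hornerC); ring.
Qed.

Lemma cyl_eval_bounded c : smooth_cylinder T c ->
  exists B : R, forall sig : Om, `|cyl_eval c sig| <= B.
Proof.
move=> [sf cf _ _ _]; have [B HB] := smooth_prod_bounded hA sf cf.
by exists B => sig; exact: HB.
Qed.

Lemma cyls_eval_bounded F : smooth_cylinders T F ->
  exists B : R, forall sig : Om, `|cyls_eval F sig| <= B.
Proof.
elim: F => [_|c F IH /smooth_cylinders_cons[sc /IH[B HB]]].
  by exists 0 => sig; rewrite /cyls_eval big_nil normr0.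
have [B' HB'] := cyl_eval_bounded sc; exists (B' + B) => sig.
rewrite /cyls_eval big_cons (le_trans (ler_normD _ _))// lerD//; exact: HB.
Qed.

(** The uniform distance controls the finitely many points of the path that the
    function depends on, so the superlevel sets are open. *)
Lemma cyl_eval_measurable c : smooth_cylinder T c ->
  measurable_fun setT (fun sig : Om => cyl_eval c sig).
Proof.
move=> sc; have [sf _ _ _ _] := sc.
apply: (measurability _ (measurable_realfun.RGenOInfty.measurableE R)) => _ [_ [a ->] <-].
apply: sub_sigma_algebra; rewrite setTI => sig /= sab.
have oab : open (`]a, +oo[%classic : set R) by exact: interval_open.
have /nbhs_ballP[e /= e0 He] : nbhs (cyl_eval c sig) (`]a, +oo[%classic : set R).
  exact: open_nbhs_nbhs.
have [N [nN HN]] := smooth_prod_continuous hA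
  (fun i => Defs.coord (@cyl_time _ _ _ c i) sig) sf e0.
have /choice[d Hd] : forall i, exists d : R, 0 < d /\
    ball (Defs.coord (@cyl_time _ _ _ c i) sig) d `<=` N i.
  by move=> i; have /nbhs_ballP[d d0 Hd] := nN i; exists d.
pose d0 := \big[Num.min/1]_i d i.
exists d0.
  by rewrite /d0; elim/big_ind: _ => // [x y ? ?|i _]; [rewrite lt_min; apply/andP|have [] := Hd i].
move=> tau Htau; apply: He; rewrite -ball_normE /=; apply: HN => i.
have [_] := Hd i; apply; apply: (@le_ball _ _ _ d0); last first.
  by apply: Htau; exact: cyl_time_itv.
exact: bigmin_le_cond.
Qed.

Lemma cyls_eval_measurable F : smooth_cylinders T F ->
  measurable_fun setT (fun sig : Om => cyls_eval F sig).
Proof.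
elim: F => [_|c F IH /smooth_cylinders_cons[sc /IH mF]].
  by rewrite /cyls_eval; under eq_fun do rewrite big_nil; exact: measurable_cst.
rewrite /cyls_eval; under eq_fun do rewrite big_cons.
by apply: measurable_realfun.measurable_funD => //; exact: cyl_eval_measurable.
Qed.

End CylinderAlgebra.

(** * Measurable fields of tangent vectors at a point *)

Section TangentInner.
Context {R : realType} {n : nat} {M : riemannianManifold R n}.
Variable p : M.
Local Notation A := (rm_atlas M).
Local Notation tan := (tangent A p).
Local Notation g := (rm_metric M p).
Let hA : smooth_atlas A := rm_atlasP M.

Lemma tangent_comb a a' u v : tan u -> tan v -> tan (fun f => a * u f + a' * v f).
Proof.
move=> [u1 u2 u3] [v1 v2 v3]; split.
- by move=> f nf; rewrite u1// v1// !mulr0 addr0.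
- by move=> b f h sf sh; rewrite u2// v2//; ring.
- by move=> f h sf sh; rewrite u3// v3//; ring.
Qed.

Lemma tangent0 : tan (fun=> 0).
Proof.
split=> // [a f h _ _|f h _ _]; first by rewrite mulr0 addr0.
by rewrite !mulr0 addr0.
Qed.

Lemma tangent_scale a u : tan u -> tan (fun f => a * u f).
Proof.
move=> tu; have := tangent_comb a 0 tu tu.
by under eq_fun do rewrite mul0r addr0.
Qed.

Lemma tangent_lincomb (I : Type) (s : seq I) (c : I -> R) (e : I -> tvec R M) :
  (forall i, tan (e i)) -> tan (fun f => \sum_(i <- s) c i * e i f).
Proof.
move=> te; elim: s => [|i s IH].
  by under eq_fun do rewrite big_nil; exact: tangent0.
under eq_fun do rewrite big_cons.
by have := tangent_comb (c i) 1 (te i) IH; under eq_fun do rewrite mul1r.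
Qed.

Lemma exists_tangent_basis : exists b : 'I_n -> tvec R M, (forall i, tan (b i)) /\
  exists a : tvec R M -> 'I_n -> R, forall v, tan v ->
    v = fun f => \sum_i a v i * b i f.
Proof.
have [_ /(_ p)[c Ac dp] _] := hA.
have [r r0 ball_cod] : exists2 r : R, 0 < r & ball (chart_fun c p) r `<=` chart_cod c.
  have : nbhs (chart_fun c p) (chart_cod c).
    by apply: open_nbhs_nbhs; split; [exact: open_chart_cod hA _ Ac|exists p].
  by move=> /nbhs_ballP[r r0 H]; exists r.
have [a Ha] := tangent_span hA (@rm_hausdorff _ _ M) Ac dp r0 ball_cod.
exists (partial_at A c p); split; first by move=> i; exact: partial_at_tangent.
by exists a => v tv; apply/funext => f; exact: Ha.
Qed.

Let inner : inner_product_on A p g.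
Proof. by have [H _] := rm_metricP M; exact: H. Qed.

Lemma inner0l w : tan w -> g (fun=> 0) w = 0.
Proof.
move=> tw; have [/(_ 1 _ _ _ tangent0 tangent0 tw) + _ _] := inner.
under [in X in g X w = _ -> _]eq_fun do rewrite mulr0 addr0.
by rewrite mul1r => /eqP; rewrite -subr_eq subrr eq_sym => /eqP.
Qed.

Lemma inner_comb a a' u v w : tan u -> tan v -> tan w ->
  g (fun f => a * u f + a' * v f) w = a * g u w + a' * g v w.
Proof.
move=> tu tv tw; have [lin _ _] := inner.
rewrite (lin a u (fun f => a' * v f))//; last exact: tangent_scale.
congr (_ + _); have := lin a' v _ w tv tangent0 tw.
by under [in X in g X w = _ -> _]eq_fun do rewrite addr0; rewrite inner0l// addr0.
Qed.

Lemma inner_sym u v : tan u -> tan v -> g u v = g v u.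
Proof. by have [_ H _] := inner; exact: H. Qed.

Lemma inner_ge0 u : tan u -> 0 <= g u u.
Proof.
move=> tu; have [_ _ H] := inner; have [->|u0] := pselect (u = fun=> 0).
  by rewrite inner0l//; exact: tangent0.
exact/ltW/H.
Qed.

Lemma inner_sum (I : Type) (s : seq I) (c : I -> R) (e : I -> tvec R M) w :
  (forall i, tan (e i)) -> tan w ->
  g (fun f => \sum_(i <- s) c i * e i f) w = \sum_(i <- s) c i * g (e i) w.
Proof.
move=> te tw; elim: s => [|i s IH].
  by under [in LHS]eq_fun do rewrite big_nil; rewrite inner0l// big_nil.
under [in LHS]eq_fun do rewrite big_cons.
rewrite big_cons -IH.
have := inner_comb (c i) 1 (te i) (tangent_lincomb s c te) tw.
by under [in X in g X w = _ -> _]eq_fun do rewrite mul1r; rewrite mul1r.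
Qed.

Lemma inner_sum2 (c d : 'I_n -> R) (e e' : 'I_n -> tvec R M) :
  (forall i, tan (e i)) -> (forall i, tan (e' i)) ->
  g (fun f => \sum_i c i * e i f) (fun f => \sum_i d i * e' i f) =
  \sum_i \sum_j c i * (d j * g (e i) (e' j)).
Proof.
move=> te te'; rewrite inner_sum//; last exact: tangent_lincomb.
apply: eq_bigr => i _; rewrite inner_sym//; last exact: tangent_lincomb.
rewrite inner_sum// mulr_sumr; apply: eq_bigr => j _; rewrite inner_sym//.
Qed.

Lemma inner_comb2 a a' u v : tan u -> tan v ->
  g (fun f => a * u f + a' * v f) (fun f => a * u f + a' * v f) =
  a ^+ 2 * g u u + 2 * a * a' * g u v + a' ^+ 2 * g v v.
Proof.
move=> tu tv; have tc := tangent_comb a a' tu tv.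
rewrite inner_comb// (inner_sym tu)// (inner_sym tv)// !inner_comb//.
rewrite (inner_sym tv tu); ring.
Qed.

Lemma inner_scale2 a u : tan u ->
  g (fun f => a * u f) (fun f => a * u f) = a ^+ 2 * g u u.
Proof.
move=> tu; have := inner_comb2 a 0 tu tu.
under eq_fun do rewrite mul0r addr0.
by move=> ->; ring.
Qed.

(** A weak form of the Cauchy-Schwarz inequality, enough for integrability. *)
Lemma inner_CS u v : tan u -> tan v -> `|g u v| <= g u u + g v v.
Proof.
move=> tu tv; rewrite ler_norml.
have := inner_ge0 (tangent_comb 1 1 tu tv).
have := inner_ge0 (tangent_comb 1 (-1) tu tv).
have := inner_ge0 tu; have := inner_ge0 tv.
rewrite !inner_comb2// => *; apply/andP; split; lra.
Qed.

Lemma inner_comb2_le a a' u v : tan u -> tan v ->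
  g (fun f => a * u f + a' * v f) (fun f => a * u f + a' * v f) <=
  2 * a ^+ 2 * g u u + 2 * a' ^+ 2 * g v v.
Proof.
move=> tu tv; have := inner_ge0 (tangent_comb a (- a') tu tv).
rewrite !inner_comb2// => *; lra.
Qed.

Section MeasurableTangent.
Context d (E : measurableType d) (S : set E).
Local Notation mt := (measurable_tangent p S).

Lemma mt_tangent u w : mt u -> S w -> tan (u w).
Proof.
move=> [e [c [te mc H]]] Sw.
rewrite (_ : u w = fun f => \sum_(a < n) c a w * e a f); last exact/funext/H.
exact: tangent_lincomb.
Qed.

(** This uses that the tangent space has dimension at most [n]: a combination
    of two fields, each spanned by [n] vectors, is again spanned by [n]. *)
Lemma mt_comb (al al' : E -> R) u v : measurable_fun S al -> measurable_fun S al' ->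
  mt u -> mt v -> mt (fun w f => al w * u w f + al' w * v w f).
Proof.
move=> mal mal' [e [c [te mc ue]]] [e' [c' [te' mc' ve]]].
have [b [tb [co Hco]]] := exists_tangent_basis.
exists b, (fun i w => al w * (\sum_a c a w * co (e a) i)
                    + al' w * (\sum_a c' a w * co (e' a) i)); split => //.
- move=> i; apply: measurable_funD; apply: measurable_funM => //.
    by apply: measurable_sum => a; apply: measurable_funM => //; exact: measurable_cst.
  by apply: measurable_sum => a; apply: measurable_funM => //; exact: measurable_cst.
- have E1 (c0 : 'I_n -> R) (e0 : 'I_n -> tvec R M) f : (forall a, tan (e0 a)) ->
      \sum_(a < n) c0 a * e0 a f = \sum_i (\sum_a c0 a * co (e0 a) i) * b i f.
    move=> te0; under eq_bigr => a _ do rewrite (Hco _ (te0 a)) mulr_sumr.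
    rewrite exchange_big /=; apply: eq_bigr => i _.
    by rewrite mulr_suml; apply: eq_bigr => a _; rewrite mulrA.
  move=> w Sw f; rewrite ue// ve// (E1 (c^~ w) e)// (E1 (c'^~ w) e')// !mulr_sumr -big_split /=.
  by apply: eq_bigr => i _; rewrite mulrDl !mulrA.
Qed.

Lemma mt_inner u v : mt u -> mt v -> measurable_fun S (fun w => g (u w) (v w)).
Proof.
move=> [e [c [te mc ue]]] [e' [c' [te' mc' ve]]].
apply: (@eq_measurable_fun _ _ _ _ _
  (fun w => \sum_i \sum_j c i w * (c' j w * g (e i) (e' j)))).
  move=> w; rewrite inE => Sw; rewrite -inner_sum2//.
  by congr (g _ _); apply/funext => f; rewrite ?ue ?ve.
apply: measurable_sum => i; apply: measurable_sum => j.
by apply: measurable_funM => //; apply: measurable_funM => //; exact: measurable_cst.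
Qed.

End MeasurableTangent.

End TangentInner.

(** * Sections of the Bismut tangent spaces *)

Section AlmostEverywhere.
Context {R : realType} d (E : measurableType d).
Variable nu : {measure set E -> \bar R}.

Lemma aeI (P Q : E -> Prop) : {ae nu, forall x, P x} -> {ae nu, forall x, Q x} ->
  {ae nu, forall x, P x /\ Q x}.
Proof. exact: (@filterI _ _ (ae_filter_ringOfSetsType nu)). Qed.

Lemma aeS (P Q : E -> Prop) : (forall x, P x -> Q x) ->
  {ae nu, forall x, P x} -> {ae nu, forall x, Q x}.
Proof. exact: (@filterS _ _ (ae_filter_ringOfSetsType nu)). Qed.

End AlmostEverywhere.

Section BismutSections.
Context {R : realType} {n : nat} {M : riemannianManifold R n} {T : R} {x0 : M}.
Local Notation Om := (path_space T x0).
Variable mu : probability Om R.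
Variable par : Om -> R -> tvec R M -> tvec R M.
Local Notation A := (rm_atlas M).
Local Notation tan := (tangent A x0).
Local Notation g := (rm_metric M x0).
Local Notation D := (`[0, T]%classic : set (measurableTypeR R)).
Local Notation leb := (@lebesgue_measure R).
Local Notation mtD := (measurable_tangent x0 D).
Local Notation N2 := (Hnorm2 T x0).
Local Notation HP := (Hprod T x0).

Let mD : measurable (`[0%R, T] : set R). Proof. exact: measurable_itv. Qed.

Lemma mtD_tangent u r : mtD u -> 0 <= r <= T -> tan (u r).
Proof. by move=> mu_ r0; apply: mt_tangent mu_ _; rewrite /= in_itv. Qed.

Lemma mtD_inner u v : mtD u -> mtD v ->
  measurable_fun (`[0%R, T] : set R) (fun r => (g (u r) (v r))%:E).
Proof. by move=> mu_ mv; apply/measurable_EFinP; exact: mt_inner. Qed.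

Lemma mtD_comb a a' u v : mtD u -> mtD v -> mtD (fun r f => a * u r f + a' * v r f).
Proof. by move=> mu_ mv; apply: mt_comb => //; exact: measurable_cst. Qed.

Lemma Hnorm2_ge0 u : mtD u -> (0 <= N2 u)%E.
Proof.
move=> mu_; apply: integral_ge0 => r; rewrite /= in_itv /= => r0.
by rewrite lee_fin inner_ge0//; exact: mtD_tangent.
Qed.

Lemma Hnorm2_scale a u : mtD u -> N2 (fun r f => a * u r f) = ((a ^+ 2)%:E * N2 u)%E.
Proof.
move=> mu_; rewrite /Hnorm2 /Hprod -ge0_integralZl_EFin ?sqr_ge0//.
- apply: eq_integral => r; rewrite inE /= in_itv /= => r0.
  by rewrite inner_scale2 ?EFinM//; exact: mtD_tangent.
- move=> r; rewrite /= in_itv /= => r0.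
  by rewrite lee_fin inner_ge0//; exact: mtD_tangent.
- exact: mtD_inner.
Qed.

Lemma Hnorm2_comb_le a a' u v : mtD u -> mtD v ->
  (N2 (fun r f => a * u r f + a' * v r f)%R <=
   (2 * a ^+ 2)%:E * N2 u + (2 * a' ^+ 2)%:E * N2 v)%E.
Proof.
move=> mu_ mv; have mc := mtD_comb a a' mu_ mv.
have c0 (b : R) : 0 <= 2 * b ^+ 2 by rewrite mulr_ge0// sqr_ge0.
have nn u' : mtD u' -> forall r, `[0, T]%classic r -> (0 <= (g (u' r) (u' r))%:E)%E.
  move=> mu' r; rewrite /= in_itv /= => r0.
  by rewrite lee_fin inner_ge0//; exact: mtD_tangent.
rewrite /Hnorm2 /Hprod -!ge0_integralZl_EFin//; try exact: nn; try exact: mtD_inner.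
have nn' b u' : mtD u' -> forall r, `[0, T]%classic r ->
    (0 <= (2 * b ^+ 2)%:E * (g (u' r) (u' r))%:E)%E.
  by move=> mu' r Dr; rewrite mule_ge0 ?lee_fin ?c0//; have := nn _ mu' r Dr.
have mm b u' : mtD u' -> measurable_fun (`[0, T] : set R)
    (fun r => (2 * b ^+ 2)%:E * (g (u' r) (u' r))%:E)%E.
  by move=> mu'; apply: measurable_funeM; exact: mtD_inner.
rewrite -ge0_integralD//; try exact: nn'; try exact: mm.
apply: ge0_le_integral => //.
- exact: (nn _ mc).
- exact: (mtD_inner mc mc).
- by apply: emeasurable_funD; exact: mm.
- move=> r; rewrite /= in_itv /= => r0; rewrite -!EFinM -EFinD lee_fin.
  by apply: inner_comb2_le; exact: mtD_tangent.
Qed.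

Lemma Hprod_integrable u v : mtD u -> mtD v -> (N2 u < +oo)%E -> (N2 v < +oo)%E ->
  leb.-integrable (`[0%R, T] : set R) (fun r => (g (u r) (v r))%:E).
Proof.
move=> mu_ mv fu fv.
have nn u' : mtD u' -> forall r, `[0, T]%classic r -> (0 <= (g (u' r) (u' r))%:E)%E.
  move=> mu' r; rewrite /= in_itv /= => r0.
  by rewrite lee_fin inner_ge0//; exact: mtD_tangent.
have iN u' : mtD u' -> (N2 u' < +oo)%E ->
    leb.-integrable (`[0%R, T] : set R) (fun r => (g (u' r) (u' r))%:E).
  move=> mu' fu'; apply/integrableP; split; first exact: mtD_inner.
  rewrite (le_lt_trans _ fu')// /Hnorm2 /Hprod le_eqVlt; apply/orP; left; apply/eqP.
  by apply: eq_integral => r; rewrite inE => Dr; rewrite gee0_abs// nn.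
apply: (@le_integrable _ _ _ _ _ _ _
  (fun r => (g (u r) (u r))%:E + (g (v r) (v r))%:E)%E) => //.
- exact: mtD_inner.
- move=> r Dr; rewrite [X in (_ <= X)%E]gee0_abs ?adde_ge0 ?nn//.
  rewrite -EFinD abse_EFin lee_fin.
  by move: Dr; rewrite /= in_itv /= => r0; apply: inner_CS; exact: mtD_tangent.
- by apply: integrableD => //; exact: iN.
Qed.

(** Finiteness of the norms is needed in order that the integrals be additive. *)
Lemma Hprod_comb a a' u v w : mtD u -> mtD v -> mtD w ->
  (N2 u < +oo)%E -> (N2 v < +oo)%E -> (N2 w < +oo)%E ->
  HP (fun r f => a * u r f + a' * v r f) w = (a%:E * HP u w + a'%:E * HP v w)%E.
Proof.
move=> mu_ mv mw fu fv fw; rewrite /Hprod.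
have iu := Hprod_integrable mu_ mw fu fw.
have iv := Hprod_integrable mv mw fv fw.
rewrite -!integralZl// -integralD//; try exact: integrableZl.
apply: eq_integral => r; rewrite inE /= in_itv /= => r0.
by rewrite inner_comb ?EFinD ?EFinM//; exact: mtD_tangent.
Qed.

Lemma absolutely_continuous_comb (a b c c' : R) k k' : absolutely_continuous a b k ->
  absolutely_continuous a b k' ->
  absolutely_continuous a b (fun s => c * k s + c' * k' s).
Proof.
move=> ak ak' e e0.
pose K := 1 + `|c| + `|c'|.
have K0 : 0 < K by rewrite /K; have := normr_ge0 c; have := normr_ge0 c'; lra.
have e1 : 0 < e / (2 * K) by rewrite divr_gt0// mulr_gt0.
have [d d0 H] := ak _ e1; have [d' d'0 H'] := ak' _ e1.
exists (Num.min d d'); first by rewrite lt_min d0.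
move=> m l r Hlr disj; rewrite lt_min => /andP[/(H _ _ _ Hlr disj) h /(H' _ _ _ Hlr disj) h'].
set S := \sum_(i < m) _ in h; set S' := \sum_(i < m) _ in h'.
have S0 : 0 <= S by apply: sumr_ge0.
have S'0 : 0 <= S' by apply: sumr_ge0.
apply: (@le_lt_trans _ _ (`|c| * S + `|c'| * S')).
  rewrite !mulr_sumr -big_split /=; apply: ler_sum => i _.
  rewrite -!normrM (le_trans _ (ler_normD _ _))//.
  by rewrite !mulrBr opprD addrACA.
apply: (@le_lt_trans _ _ (K * S + K * S')).
  rewrite lerD// ler_wpM2r// /K; have := normr_ge0 c; have := normr_ge0 c'; lra.
rewrite -mulrDr -ltr_pdivlMl// mulrC.
have -> : e / K = e / (2 * K) + e / (2 * K) by field; rewrite gt_eqF.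
exact: ltrD.
Qed.

Lemma cameron_martin_comb a a' k u k' u' :
  cameron_martin mu k u -> cameron_martin mu k' u' ->
  cameron_martin mu (fun s f => a * k s f + a' * k' s f)
                    (fun s f => a * u s f + a' * u' s f).
Proof.
move=> [[tk k0] ack [mtu du] Nu fk] [[tk' k'0] ack' [mtu' du'] Nu' fk'].
have mtc : mtD (fun s f => a * u s f + a' * u' s f) by exact: mtD_comb.
split.
- split; first by move=> s sT; apply: tangent_comb; [exact: tk|exact: tk'].
  by apply/funext => f; rewrite k0 k'0 !mulr0 addr0.
- by move=> f sf; apply: absolutely_continuous_comb; [exact: ack|exact: ack'].
- split=> // f sf; apply: aeS (aeI (du f sf) (du' f sf)) => r [Hr Hr'] rT.
  have d1 := Hr rT; have d2 := Hr' rT.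
  have := is_deriveD (is_deriveZ a d1) (is_deriveZ a' d2).
  by [].
- rewrite (le_lt_trans (Hnorm2_comb_le _ _ mtu mtu'))//.
  have bnd (b : R) (y : \bar R) : (y < +oo)%E -> ((2 * b ^+ 2)%:E * y < +oo)%E.
    by move=> yoo; apply: lte_mul_pinfty => //; rewrite lee_fin mulr_ge0// sqr_ge0.
  by apply: lte_add_pinfty; exact: bnd.
- by move=> fe; apply/funext => f; rewrite fk// fk'// !mulr0 addr0.
Qed.

Lemma Hsection_mtD U sig : Hsection mu U -> mtD (U sig).
Proof.
move=> [[e [c [te mc Ue]]] _].
exists e, (fun a r => c a (sig, r)); split=> //.
  move=> a; have := mc a; move=> mca.
  apply: (@measurable_comp _ _ _ _ _ _ (setT `*` D) (c a) _ (pair sig)) => //.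
  - by apply: measurableX => //; exact: measurable_itv.
  - by move=> _ [r Dr <-]; split.
  - exact: measurable_funTS (measurable_pair1 sig).
by move=> r Dr f; rewrite (Ue (sig, r)).
Qed.

Lemma Hsection_finite U : Hsection mu U -> {ae mu, forall sig, (N2 (U sig) < +oo)%E}.
Proof. by move=> [_]; apply: aeS => sig [k []]. Qed.

Lemma Hsection_comb (al al' : Om -> R) U U' :
  measurable_fun setT al -> measurable_fun setT al' ->
  Hsection mu U -> Hsection mu U' ->
  Hsection mu (fun sig r f => al sig * U sig r f + al' sig * U' sig r f).
Proof.
move=> mal mal' [mU cU] [mU' cU']; split.
  have mf (b : Om -> R) : measurable_fun setT b ->
      measurable_fun (setT `*` D) (fun x : Om * measurableTypeR R => b x.1).
    move=> mb; have H : measurable_fun setT (fun x : Om * measurableTypeR R => b x.1).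
      by apply: (measurableT_comp mb); exact: measurable_fst.
    exact: (measurable_funTS H).
  exact: (mt_comb (al := fun x => al x.1) (al' := fun x => al' x.1)
    (mf _ mal) (mf _ mal') mU mU').
apply: aeS (aeI cU cU') => sig [[k Hk] [k' Hk']].
by eexists; exact: cameron_martin_comb Hk Hk'.
Qed.

(** Tonelli's theorem, as the field is jointly measurable in path and time. *)
Lemma Hnorm2_measurable U : Hsection mu U -> measurable_fun setT (fun sig => N2 (U sig)).
Proof.
move=> [mU _].
pose f (z : Om * measurableTypeR R) : \bar R := (g (U z.1 z.2) (U z.1 z.2))%:E.
have mSD : measurable (setT `*` D : set (Om * measurableTypeR R)).
  by apply: measurableX => //; exact: measurable_itv.
have mf : measurable_fun (setT `*` D) f.
  by apply/measurable_EFinP; exact: (mt_inner mU mU).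
have mfr : measurable_fun setT (f \_ (setT `*` D)).
  exact: (iffLR (measurable_restrictT _ mSD) mf).
have f0 z : (0 <= (f \_ (setT `*` D)) z)%E.
  rewrite patchE; case: ifPn => // /set_mem Dz.
  rewrite /f lee_fin inner_ge0//.
  exact: mt_tangent mU Dz.
have := @measurable_fun_fubini_tonelli_F _ _ _ _ _ leb _ mfr f0.
apply: eq_measurable_fun => sig _.
rewrite /fubini_F /Hnorm2 /Hprod [RHS]integral_mkcond.
apply: eq_integral => r _; rewrite !patchE.
have -> : ((sig, r) \in setT `*` D) = (r \in D).
  by apply/idP/idP; rewrite !inE; [case|split].
by [].
Qed.

Lemma energy_comb_le a a' U U' : Hsection mu U -> Hsection mu U' ->
  (energy mu (fun sig r f => a * U sig r f + a' * U' sig r f)%R <=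
   (2 * a ^+ 2)%:E * energy mu U + (2 * a' ^+ 2)%:E * energy mu U')%E.
Proof.
move=> hU hU'; rewrite /energy.
have hC := Hsection_comb (measurable_cst a) (measurable_cst a') hU hU'.
have c0 (b : R) : 0 <= 2 * b ^+ 2 by rewrite mulr_ge0// sqr_ge0.
have nn V : Hsection mu V -> forall sig, setT sig -> (0 <= N2 (V sig))%E.
  by move=> hV sig _; apply: Hnorm2_ge0; exact: Hsection_mtD hV.
rewrite -!ge0_integralZl_EFin//; try exact: nn; try exact: Hnorm2_measurable.
rewrite -ge0_integralD//; last 4 first.
- by move=> sig _; rewrite mule_ge0 ?lee_fin ?c0//; exact: (nn _ hU sig I).
- by apply: measurable_funeM; exact: Hnorm2_measurable.
- by move=> sig _; rewrite mule_ge0 ?lee_fin ?c0//; exact: (nn _ hU' sig I).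
- by apply: measurable_funeM; exact: Hnorm2_measurable.
apply: ge0_le_integral => //.
- exact: (nn _ hC).
- exact: (Hnorm2_measurable hC).
- by apply: emeasurable_funD; apply: measurable_funeM; exact: Hnorm2_measurable.
- by move=> sig _; apply: Hnorm2_comb_le; [exact: Hsection_mtD hU|exact: Hsection_mtD hU'].
Qed.

Lemma energy_ge0 U : Hsection mu U -> (0 <= energy mu U)%E.
Proof.
by move=> hU; apply: integral_ge0 => sig _; apply: Hnorm2_ge0; exact: Hsection_mtD hU.
Qed.

Lemma energy_mul (al : Om -> R) U : Hsection mu U ->
  energy mu (fun sig r f => al sig * U sig r f) =
    (\int[mu]_sig ((al sig ^+ 2)%:E * N2 (U sig)))%E.
Proof.
move=> hU; apply: eq_integral => sig _; apply: Hnorm2_scale.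
exact: Hsection_mtD hU.
Qed.

Hypothesis hpar : {ae mu, forall sig, forall s v, 0 <= s <= T -> tan v ->
  tangent A (Defs.coord s sig) (par sig s v)}.

Lemma cameron_martin_along sig k u :
  (forall s v, 0 <= s <= T -> tan v -> tangent A (Defs.coord s sig) (par sig s v)) ->
  cameron_martin mu k u -> tangent_along sig (fun s => par sig s (k s)).
Proof. by move=> Hp [[tk _] _ _ _ _] s sT; apply: Hp => //; exact: tk. Qed.

(** The gradient of [P (F)] is [P' (F)] times that of [F], as the factor
    [P' (F)] does not depend on time and comes out of the inner product. *)
Lemma cyl_gradient_poly F U (p : {poly R}) : cyl_gradient mu par F U ->
  exists2 G, (forall sig : Om, cyls_eval G sig = ('X * p).[cyls_eval F sig]) &
    cyl_gradient mu par G
      (fun sig r f => ('X * p)^`().[cyls_eval F sig] * U sig r f).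
Proof.
move=> [sF hU HU]; have [G [sG eG dG]] := @cyls_poly _ _ _ _ x0 F p sF.
exists G => //.
have mp : measurable_fun setT (fun sig : Om => ('X * p)^`().[cyls_eval F sig]).
  apply: (measurableT_comp (f := horner ('X * p)^`())).
    by apply: continuous_measurable_fun; exact: continuous_horner.
  exact: cyls_eval_measurable.
have hV : Hsection mu (fun sig r f => ('X * p)^`().[cyls_eval F sig] * U sig r f).
  have := Hsection_comb mp (measurable_cst (0 : R)) hU hU.
  by under eq_fun do under eq_fun do under eq_fun do rewrite mul0r addr0.
split=> //.
apply: aeS (aeI HU (aeI hpar (Hsection_finite hU))) => sig [Hsig [Hp fU]] k u cku.
have [_ _ [mtu _] fu _] := cku.
have mtU : mtD (U sig) := Hsection_mtD sig hU.
have := Hprod_comb (('X * p)^`().[cyls_eval F sig]) 0 mtU mtU mtu fU fU fu.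
under [in X in X = _ -> _]eq_fun do under eq_fun do rewrite mul0r addr0.
rewrite mul0e adde0 => ->; rewrite (Hsig _ _ cku) -EFinM dG//.
exact: cameron_martin_along cku.
Qed.

Lemma cyl_gradient_comb F U G W (a : R) :
  cyl_gradient mu par F U -> cyl_gradient mu par G W ->
  cyl_gradient mu par (F ++ map (cyl_scale a) G)
    (fun sig r f => 1 * U sig r f + a * W sig r f).
Proof.
move=> [sF hU HU] [sG hW HW]; split.
- apply: smooth_cylinders_cat => //; apply: smooth_cylinders_map sG => c.
  exact: smooth_cyl_scale.
- exact: Hsection_comb (measurable_cst (1 : R)) (measurable_cst a) hU hW.
apply: aeS (aeI (aeI HU HW) (aeI hpar
  (aeI (Hsection_finite hU) (Hsection_finite hW)))) => sig [[Hsig Hsig'] [Hp [fU fW]]] k u cku.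
have [_ _ [mtu _] fu _] := cku.
rewrite Hprod_comb//; try exact: Hsection_mtD.
rewrite (Hsig _ _ cku) (Hsig' _ _ cku) mul1e -EFinM -EFinD.
rewrite cyls_diff_cat cyls_diff_scale//.
exact: cameron_martin_along cku.
Qed.

End BismutSections.

(** * Polynomial approximation of truncations *)

Section PolynomialTruncation.
Context {R : realType}.

Lemma bernoulli_sub (u : R) N : 0 <= u <= 1 -> 1 - N%:R * u <= (1 - u) ^+ N.
Proof.
move=> /andP[u0 u1]; elim: N => [|N IH]; first by rewrite mul0r subr0 expr0.
rewrite exprSr (le_trans _ (ler_wpM2r _ IH)) ?subr_ge0//.
have : 0 <= N%:R * u ^+ 2 by rewrite mulr_ge0// sqr_ge0.
rewrite -natr1; lra.
Qed.

Lemma bernoulli_add (u : R) N : 0 <= u -> 1 + N%:R * u <= (1 + u) ^+ N.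
Proof.
move=> u0; elim: N => [|N IH]; first by rewrite mul0r addr0 expr0.
rewrite exprSr (le_trans _ (ler_wpM2r _ IH)) ?addr_ge0//.
have : 0 <= N%:R * u ^+ 2 by rewrite mulr_ge0// sqr_ge0.
rewrite -natr1; lra.
Qed.

(** Polynomials that fall from [1] to [0] around [1/2] on the unit interval: the
    value is close to [1] if [2^n z^n] is small, and close to [0] if it is
    large. *)
Definition fall (n : nat) (z : R) : R := (1 - z ^+ n) ^+ (2 ^ n).

Lemma fall01 n z : 0 <= z <= 1 -> 0 <= fall n z <= 1.
Proof.
move=> /andP[z0 z1].
have u0 : 0 <= 1 - z ^+ n by rewrite subr_ge0 exprn_ile1.
have u1 : 1 - z ^+ n <= 1 by rewrite gerBl exprn_ge0.
by rewrite /fall exprn_ge0// exprn_ile1.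
Qed.

Lemma fall_nincr n z z' : 0 <= z -> z <= z' -> z' <= 1 -> fall n z' <= fall n z.
Proof.
move=> z0 zz' z1; have z'0 := le_trans z0 zz'.
have u0 y : 0 <= y -> y <= 1 -> 0 <= 1 - y ^+ n.
  by move=> y0 y1; rewrite subr_ge0 exprn_ile1.
rewrite /fall lerXn2r ?nnegrE ?u0//; first exact: le_trans z1.
by rewrite lerD2l lerN2 lerXn2r.
Qed.

Lemma fall_lt z : 0 <= z -> z < 2^-1 -> fall n z @[n --> \oo] --> (1 : R).
Proof.
move=> z0 z2; have z1 : z <= 1 by rewrite (le_trans (ltW z2))// invf_le1// ler1n.
apply: (@squeeze_cvgr _ _ _ _ (fun n => 1 - (2 * z) ^+ n) (cst 1)).
- have z01 : 0 <= z <= 1 by rewrite z0.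
  apply: nearW => n; have /andP[_ ->] := fall01 n z01; rewrite andbT.
  have := @bernoulli_sub (z ^+ n) (2 ^ n).
  by rewrite exprn_ge0//= exprn_ile1// natrX exprMn => ->.
- rewrite -[X in _ --> X]subr0; apply: cvgB; first exact: cvg_cst.
  by apply: cvg_expr; rewrite ger0_norm ?mulr_ge0// mulrC -ltr_pdivlMr// mul1r.
- exact: cvg_cst.
Qed.

Lemma fall_gt z : 2^-1 < z -> z <= 1 -> fall n z @[n --> \oo] --> (0 : R).
Proof.
move=> z2 z1; have z0 : 0 < z by rewrite (lt_trans _ z2)// invr_gt0.
apply: (@squeeze_cvgr _ _ _ _ (cst 0) (fun n => (2 * z)^-1 ^+ n)).
- have z01 : 0 <= z <= 1 by rewrite ltW.
  apply: nearW => n; have /andP[-> _] := fall01 n z01.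
  have u0 : 0 < z ^+ n by rewrite exprn_gt0.
  have H := @bernoulli_add (z ^+ n) (2 ^ n) (ltW u0).
  have H1 : (1 - z ^+ n) ^+ (2 ^ n) * (1 + z ^+ n) ^+ (2 ^ n) <= 1.
    rewrite -exprMn -subr_sqr expr1n exprn_ile1 ?gerBl ?sqr_ge0//.
    by rewrite subr_ge0 -exprM exprn_ile1// ltW.
  have p0 : 0 < (2 * z) ^+ n by rewrite exprn_gt0// mulr_gt0.
  rewrite exprVn -(ler_pM2r p0) mulVf ?gt_eqF// (le_trans _ H1)// /fall.
  have u1 : 0 <= 1 - z ^+ n by rewrite subr_ge0 exprn_ile1// ltW.
  apply: ler_wpM2l; first exact: exprn_ge0.
  by rewrite (le_trans _ H)// natrX exprMn lerDr.
- exact: cvg_cst.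
- apply: cvg_expr; rewrite ger0_norm ?invr_ge0 ?mulr_ge0 ?ltW//.
  by rewrite invf_lt1 ?mulr_gt0// mulrC -ltr_pdivrMr// mul1r.
Qed.

(** At [1/2] the values increase, since the square of [1 - u/2] is at least
    [1 - u]. *)
Lemma fall_half : exists2 l : R, 0 <= l <= 1 & fall n 2^-1 @[n --> \oo] --> l.
Proof.
have h01 : 0 <= (2^-1 : R) <= 1 by rewrite invr_ge0 ler0n invf_le1// ler1n.
have nd : nondecreasing_seq (fun n => fall n (2^-1 : R)).
  apply/nondecreasing_seqP => n; rewrite /fall expnS exprM.
  have u0 : 0 <= (2^-1 : R) ^+ n by rewrite exprn_ge0// invr_ge0.
  have u1 : (2^-1 : R) ^+ n <= 1 by have /andP[? ?] := h01; rewrite exprn_ile1.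
  rewrite lerXn2r ?nnegrE ?subr_ge0 ?sqr_ge0//.
  rewrite [_ ^+ n.+1]exprS; set u := (2^-1 : R) ^+ n in u0 u1 *.
  have key : (1 - 2^-1 * u) ^+ 2 - (1 - u) = u ^+ 2 / 4 by field.
  by rewrite -subr_ge0 key divr_ge0// sqr_ge0.
have bnd n : fall n (2^-1 : R) <= 1 by have /andP[] := fall01 n h01.
have cv : cvgn (fun n => fall n (2^-1 : R)).
  by apply: nondecreasing_is_cvgn => //; exists 1 => _ [n _ <-].
exists (limn (fun n => fall n (2^-1 : R))) => //.
apply/andP; split.
  by apply: limr_ge => //; apply: nearW => n; have /andP[] := fall01 n h01.
by apply: limr_le => //; exact: nearW.
Qed.

(** Limit of the rescaled polynomials [fall]; the value [l] at the jump is
    whatever they produce there. *)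
Definition step (l a x : R) : R := if x < a then 1 else if x == a then l else 0.

(** The antiderivative is divisible by [X]: it has no constant term, as is
    required of polynomials that operate on cylindrical functions. *)
Lemma antiderivative (q : {poly R}) : exists p : {poly R}, ('X * p)^`() = q.
Proof.
exists (\poly_(i < size q) (q`_i / i.+1%:R)); apply/polyP => i.
rewrite coef_deriv coefXM /= coef_poly; case: ltnP => [_|iq].
  by rewrite -[LHS]mulr_natr divfK// pnatr_eq0.
by rewrite nth_default// mul0rn.
Qed.

Lemma poly_mvt (p : {poly R}) (x y : R) : x <= y ->
  exists2 c, x <= c <= y & p.[y] - p.[x] = p^`().[c] * (y - x).
Proof.
move=> xy.
have dp (z : R) : is_derive z (1 : R) (horner p) (p^`().[z]) by exact: is_derive_poly.
have [c cxy E] := @MVT_segment R (horner p) (horner p^`()) x y xy (fun z _ => dp z)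
  (continuous_subspaceT (@continuous_horner R p)).
by exists c => //; move: cxy; rewrite in_itv.
Qed.

(** Rescale [fall] to a neighbourhood of [- B, B] with jump at [a], and take
    antiderivatives vanishing at [0].  These are nondecreasing and 1-Lipschitz.
    As their derivatives are monotone and converge off [a], the increments
    converge to those of [min x a] by the mean value theorem, after removal of a
    short interval next to [a]. *)
Lemma step_approx (l a B : R) : 0 <= B ->
  fall n 2^-1 @[n --> \oo] --> l ->
  exists p : nat -> {poly R}, forall x, `|x| <= B ->
  [/\ forall n, 0 <= ('X * p n)^`().[x] <= 1,
      forall n, `|('X * p n).[x]| <= B,
      ('X * p n)^`().[x] @[n --> \oo] --> step l a x &
      ('X * p n).[x] @[n --> \oo] --> Num.min x a - Num.min 0 a].
Proof.
move=> B0 hl; pose L := 2 * (`|a| + B) + 1.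
have L0 : 0 < L by rewrite /L; have := normr_ge0 a; lra.
pose q n : {poly R} := (1 - ((2^-1)%:P + L^-1 *: ('X - a%:P)) ^+ n) ^+ (2 ^ n).
pose z x := 2^-1 + (x - a) / L.
have qE n x : (q n).[x] = fall n (z x).
  rewrite /q horner_exp hornerD hornerN horner_exp hornerC hornerD hornerC hornerZ.
  by rewrite hornerXsubC /fall /z [L^-1 * _]mulrC.
have /choice[p Hp] := fun n => antiderivative (q n).
pose P n x := ('X * p n).[x].
have P0 n : P n 0 = 0 by rewrite /P hornerM hornerX mul0r.
pose S x := `|x - a| <= L / 2.
have Sx x : `|x| <= B -> S x.
  move=> xB; rewrite /S (le_trans (ler_normB _ _))// /L; lra.
have Sa : S a by rewrite /S subrr normr0 divr_ge0// ltW.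
have Sb x y c : S x -> S y -> x <= c <= y -> S c.
  rewrite /S !ler_norml => /andP[? ?] /andP[? ?] /andP[? ?]; apply/andP; split; lra.
have z01 x : S x -> 0 <= z x <= 1.
  rewrite /S /z ler_norml => /andP[h1 h2].
  have e1 : - 2^-1 <= (x - a) / L by rewrite ler_pdivlMr//; lra.
  have e2 : (x - a) / L <= 2^-1 by rewrite ler_pdivrMr//; lra.
  apply/andP; split; lra.
have zmono x y : x <= y -> z x <= z y.
  by move=> xy; rewrite /z lerD2l ler_pM2r ?invr_gt0// lerD2r.
have q01 n x : S x -> 0 <= (q n).[x] <= 1.
  by move=> /z01 zx; rewrite qE; exact: fall01.
have qmono n x y : S x -> S y -> x <= y -> (q n).[y] <= (q n).[x].
  move=> /z01/andP[zx _] /z01/andP[_ zy] /zmono xy.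
  by rewrite !qE; exact: fall_nincr.
have qlim x : S x -> (q n).[x] @[n --> \oo] --> step l a x.
  move=> Sx'; under eq_fun do rewrite qE; rewrite /step.
  have /andP[zx0 zx1] := z01 _ Sx'.
  case: ltgtP => [xa|xa|->].
  - by apply: fall_lt => //; rewrite /z gtrDl pmulr_llt0 ?invr_gt0// subr_lt0.
  - by apply: fall_gt => //; rewrite /z ltrDl mulr_gt0 ?invr_gt0// subr_gt0.
  - by rewrite /z subrr mul0r addr0.
have mvt n x y : x <= y -> exists2 c, x <= c <= y & P n y - P n x = (q n).[c] * (y - x).
  by move=> xy; have [c cxy] := poly_mvt ('X * p n) xy; rewrite Hp; exists c.
have lip n x y : S x -> S y -> x <= y -> 0 <= P n y - P n x <= y - x.
  move=> Sx' Sy xy; have [c cxy ->] := mvt n _ _ xy.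
  have /andP[c0 c1] := q01 n _ (Sb _ _ _ Sx' Sy cxy).
  by rewrite mulr_ge0 ?subr_ge0//= ler_piMl ?subr_ge0.
have claim1 x y : S x -> S y -> x <= y -> y <= a ->
    P n y - P n x @[n --> \oo] --> y - x.
  move=> Sx' Sy xy ya; apply/cvgrPdist_le => e e0.
  have [yxe|exy] := leP (y - x) e.
    near=> n; have /andP[h1 h2] := lip n _ _ Sx' Sy xy.
    rewrite ger0_norm; lra.
  (* Between [x] and [y'] the derivative is at least its value at [y'], which
     tends to [1]. *)
  pose y' := y - e / 2.
  have xy' : x <= y' by rewrite /y'; lra.
  have y'y : y' <= y by rewrite /y'; lra.
  have Sy' : S y' by apply: (Sb x y) => //; rewrite xy'.
  have e1 : 0 < e / 2 / (y - x) by rewrite !divr_gt0//; lra.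
  have := qlim _ Sy'; rewrite /step ifT; last by rewrite /y'; lra.
  move=> /cvgrPdist_le/(_ _ e1) H; near=> n.
  have Hn : `|1 - (q n).[y']| <= e / 2 / (y - x) by near: n; exact: H.
  have /andP[h1 h2] := lip n _ _ Sx' Sy xy.
  have /andP[h3 h4] := lip n _ _ Sy' Sy y'y.
  have [c cxy E] := mvt n _ _ xy'.
  have Sc : S c by apply: (Sb x y') => //.
  have qc : (q n).[y'] <= (q n).[c] by case/andP: cxy => _; exact: qmono.
  have /andP[d1 d2] := q01 n _ Sy'.
  move: Hn; rewrite ger0_norm ?subr_ge0// ler_pdivlMr ?subr_gt0; last lra.
  move=> Hn; rewrite ger0_norm ?subr_ge0//.
  have : (1 - (q n).[c]) * (y' - x) <= e / 2.
    apply: le_trans Hn; apply: ler_pM; rewrite ?subr_ge0//; last by rewrite /y'; lra.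
      by have /andP[] := q01 n _ Sc.
    by rewrite lerD2l lerN2.
  have y'E : y' = y - e / 2 by [].
  by rewrite mulrBl mul1r -E => ?; lra.
have claim2 x y : S x -> S y -> x <= y -> a <= x ->
    P n y - P n x @[n --> \oo] --> (0 : R).
  move=> Sx' Sy xy ax; apply/cvgrPdist_le => e e0.
  have [yxe|exy] := leP (y - x) e.
    near=> n; have /andP[h1 h2] := lip n _ _ Sx' Sy xy.
    rewrite sub0r normrN ger0_norm//; lra.
  (* Between [x'] and [y] the derivative is at most its value at [x'], which
     tends to [0]. *)
  pose x' := x + e / 2.
  have xx' : x <= x' by rewrite /x'; lra.
  have x'y : x' <= y by rewrite /x'; lra.
  have Sx2 : S x' by apply: (Sb x y) => //; rewrite xx'.
  have e1 : 0 < e / 2 / (y - x) by rewrite !divr_gt0//; lra.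
  have := qlim _ Sx2; rewrite /step ifF; last by apply/negbTE; rewrite /x' -leNgt; lra.
  rewrite ifF; last by apply/negbTE; rewrite gt_eqF// /x'; lra.
  move=> /cvgrPdist_le/(_ _ e1) H; near=> n.
  have Hn : `|0 - (q n).[x']| <= e / 2 / (y - x) by near: n; exact: H.
  have /andP[h1 h2] := lip n _ _ Sx' Sy xy.
  have /andP[h3 h4] := lip n _ _ Sx' Sx2 xx'.
  have [c cxy E] := mvt n _ _ x'y.
  have Sc : S c by apply: (Sb x' y) => //.
  have qc : (q n).[c] <= (q n).[x'] by case/andP: cxy => + _; exact: qmono.
  have /andP[d1 d2] := q01 n _ Sx2.
  move: Hn; rewrite sub0r normrN ger0_norm// ler_pdivlMr ?subr_gt0; last lra.
  move=> Hn; rewrite sub0r normrN ger0_norm//.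
  have : (q n).[c] * (y - x') <= e / 2.
    apply: le_trans Hn; apply: ler_pM; rewrite ?subr_ge0//; last by rewrite /x'; lra.
    by have /andP[] := q01 n _ Sc.
  have x'E : x' = x + e / 2 by [].
  by rewrite -E => ?; lra.
have claim x : S x -> P n x - P n a @[n --> \oo] --> Num.min x a - a.
  move=> Sx'; have [xa|ax] := leP x a.
    rewrite -opprB (_ : (fun n => _) = (fun n => - (P n a - P n x))).
      by apply: cvgN; exact: claim1.
    by apply/funext => n; rewrite opprB.
  by rewrite subrr; exact: (claim2 _ _ Sa Sx' (ltW ax) (lexx a)).
have S0 : S 0 by apply: Sx; rewrite normr0.
exists p => x xB; split.
- by move=> n; rewrite Hp; apply: q01; exact: Sx.
- move=> n; rewrite (le_trans _ xB)//.
  rewrite -/(P n x); have [x0|/ltW x0] := leP 0 x.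
    have := lip n _ _ S0 (Sx _ xB) x0; rewrite P0 !subr0 => /andP[h1 h2].
    by rewrite !ger0_norm.
  have := lip n _ _ (Sx _ xB) S0 x0; rewrite P0 !sub0r => /andP[h1 h2].
  by rewrite (ler0_norm x0) ler0_norm// -oppr_ge0.
- by under eq_fun do rewrite Hp; apply: qlim; exact: Sx.
- have -> : Num.min x a - Num.min 0 a = Num.min x a - a - (Num.min 0 a - a) by ring.
  rewrite (_ : (fun n => _) = (fun n => P n x - P n a - (P n 0 - P n a))).
    by apply: cvgB; apply: claim => //; exact: Sx.
  by apply/funext => n; rewrite P0 /P; ring.
Unshelve. all: by end_near. Qed.

End PolynomialTruncation.

(** * Truncations of cylindrical functions lie in the domain of the gradient *)

Section DominatedZero.
Context {R : realType} d (E : measurableType d).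
Variable nu : {measure set E -> \bar R}.

Lemma dominated_cvg_zero (f_ : nat -> E -> \bar R) (h : E -> \bar R) :
  (forall n, measurable_fun setT (f_ n)) -> (forall n x, (0 <= f_ n x)%E) ->
  {ae nu, forall x, f_ ^~ x @ \oo --> 0%E} ->
  nu.-integrable setT h -> (forall n x, (f_ n x <= h x)%E) ->
  (\int[nu]_x f_ n x)%E @[n --> \oo] --> (0 : \bar R).
Proof.
move=> mf f0 fc ih fh.
have mz : measurable_fun [set: E] (fun=> 0 : \bar R) by exact: measurable_cst.
have fc' : {ae nu, forall x, setT x -> f_ ^~ x @ \oo --> (fun=> 0%E : \bar R) x}.
  by apply: aeS fc => x H _.
have fh' : {ae nu, forall x n, setT x -> (`|f_ n x| <= h x)%E}.
  by apply: aeW => x n _; rewrite gee0_abs.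
have [_ _] := @dominated_convergence _ _ _ nu _ measurableT _ _ _ mf mz fc' ih fh'.
by rewrite integral0.
Qed.

End DominatedZero.

Section Truncation.
Context {R : realType} {n : nat} {M : riemannianManifold R n} {T : R} {x0 : M}.
Local Notation Om := (path_space T x0).
Variable mu : probability Om R.
Variable par : Om -> R -> tvec R M -> tvec R M.
Local Notation tan := (tangent (rm_atlas M) x0).
Local Notation N2 := (Hnorm2 T x0).
Hypothesis hpar : {ae mu, forall sig, forall s v, 0 <= s <= T -> tan v ->
  tangent (rm_atlas M) (Defs.coord s sig) (par sig s v)}.
Variable l : R.
Hypothesis l01 : 0 <= l <= 1.
Hypothesis hl : fall k 2^-1 @[k --> \oo] --> l.

(** Truncation to the levels between [a] and [b], normalised to vanish at [0],
    as do the polynomials that approximate it.  For [0 <= a] it vanishes below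
    [a]. *)
Definition trunc (a b x : R) : R :=
  (Num.min x b - Num.min 0 b) - (Num.min x a - Num.min 0 a).

(** The derivative of [trunc], completed at the jumps [a] and [b] by the limits
    of the polynomial approximations. *)
Definition dtrunc (a b x : R) : R := step l b x - step l a x.

Lemma step01 a x : 0 <= step l a x <= 1.
Proof. by rewrite /step; case: ifP => _; [|case: ifP => _]; rewrite ?lexx ?ler01. Qed.

Lemma step_mono a b x : a <= b -> step l a x <= step l b x.
Proof.
rewrite /step => ab; have /andP[l0 l1] := l01.
have [xa|ax|->] := ltgtP x a; first by rewrite (lt_le_trans xa ab).
  by case: ifP => _ //; case: ifP.
by move: ab; rewrite le_eqVlt => /orP[/eqP <-|->//]; rewrite ltxx eqxx.
Qed.

Lemma dtrunc01 a b x : a <= b -> 0 <= dtrunc a b x <= 1.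
Proof.
move=> ab; have := step_mono x ab; have /andP[] := step01 a x.
by have /andP[] := step01 b x; rewrite /dtrunc; lra.
Qed.

Lemma step_measurable a : measurable_fun setT (step l a).
Proof.
apply: measurable_fun_ifT.
- by apply: measurable_fun_ltr => //; exact: measurable_cst.
- exact: measurable_cst.
- apply: measurable_fun_ifT; [|exact: measurable_cst|exact: measurable_cst].
  by apply: measurable_fun_eqr => //; exact: measurable_cst.
Qed.

Lemma dtrunc_measurable a b : measurable_fun setT (dtrunc a b).
Proof. by apply: measurable_funB; exact: step_measurable. Qed.

Lemma trunc_measurable a b : measurable_fun setT (trunc a b).
Proof.
apply: measurable_funB; apply: measurable_funB; try exact: measurable_cst.
  by apply: measurable_minr => //; exact: measurable_cst.
by apply: measurable_minr => //; exact: measurable_cst.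
Qed.

(** A number in the unit interval is at least its square.  The right-hand
    side is additive over consecutive levels, which the energy need not be at
    the jumps. *)
Lemma energy_dtrunc F U a b : cyl_gradient mu par F U -> a <= b ->
  (energy mu (fun sig r f => dtrunc a b (cyls_eval F sig) * U sig r f)%R <=
   \int[mu]_sig ((dtrunc a b (cyls_eval F sig))%:E * N2 (U sig)))%E.
Proof.
move=> [sF hU _] ab; rewrite energy_mul//.
have mF := @cyls_eval_measurable _ _ _ _ x0 _ sF.
have md : measurable_fun setT (fun sig : Om => dtrunc a b (cyls_eval F sig)).
  exact: (measurableT_comp (dtrunc_measurable a b) mF).
have N0 sig : (0 <= N2 (U sig))%E by apply: Hnorm2_ge0 => //; exact: (Hsection_mtD _ hU).
apply: ge0_le_integral => //.
- by move=> sig _; rewrite mule_ge0// lee_fin sqr_ge0.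
- apply: emeasurable_funM; last exact: (Hnorm2_measurable hU).
  by apply/measurable_EFinP; apply: measurable_funX.
- apply: emeasurable_funM; last exact: (Hnorm2_measurable hU).
  exact/measurable_EFinP.
- move=> sig _; rewrite lee_wpmul2r// lee_fin.
  have /andP[d0 d1] := dtrunc01 (cyls_eval F sig) ab.
  by rewrite expr2 ler_piMl.
Qed.

Lemma energy_finite_integrable U : Hsection mu U -> (energy mu U < +oo)%E ->
  mu.-integrable setT (fun sig => N2 (U sig)).
Proof.
move=> hU fU; apply/integrableP; split; first exact: (Hnorm2_measurable hU).
rewrite (le_lt_trans _ fU)// /energy le_eqVlt; apply/orP; left; apply/eqP.
apply: eq_integral => sig _; rewrite gee0_abs//.
by apply: Hnorm2_ge0 => //; exact: (Hsection_mtD _ hU).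
Qed.

Lemma bounded_L2 (f : Om -> R) (B : R) : (forall sig, `|f sig| <= B) ->
  measurable_fun setT f -> (\int[mu]_sig (f sig ^+ 2)%:E < +oo)%E.
Proof.
move=> fB mf; apply: (@le_lt_trans _ _ (\int[mu]_sig (cst (B ^+ 2)%:E sig))%E).
  apply: ge0_le_integral => //.
  - by move=> sig _; rewrite lee_fin sqr_ge0.
  - by apply/measurable_EFinP; apply: measurable_funX.
  - move=> sig _; rewrite lee_fin -real_normK ?num_real// lerXn2r ?nnegrE//.
    exact: le_trans (fB sig).
by rewrite integral_cst// [X in (_ * X)%E]probability_setT mule1 ltry.
Qed.

(** The approximating polynomials are bounded with bounded derivatives on the
    range of [F], so functions and gradients converge by domination. *)
Lemma D12_trunc F U a b : cyl_gradient mu par F U -> (energy mu U < +oo)%E -> a <= b ->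
  D12_gradient mu par (fun sig => trunc a b (cyls_eval F sig))
    (fun sig r f => dtrunc a b (cyls_eval F sig) * U sig r f).
Proof.
move=> cF fU ab; have [sF hU _] := cF.
have mF := @cyls_eval_measurable _ _ _ _ x0 _ sF.
have [B0 HB0] := @cyls_eval_bounded _ _ _ _ x0 _ sF.
pose B := `|B0|; have B_ge0 : 0 <= B by exact: normr_ge0.
have HB (sig : Om) : `|cyls_eval F sig| <= B by rewrite (le_trans (HB0 sig))// ler_norm.
have [p Hp] := step_approx a B_ge0 hl.
have [q Hq] := step_approx b B_ge0 hl.
have cv (sig : Om) : ('X * (q k - p k)).[cyls_eval F sig] @[k --> \oo]
    --> trunc a b (cyls_eval F sig).
  have [_ _ _ h1] := Hp _ (HB sig); have [_ _ _ h2] := Hq _ (HB sig).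
  by under eq_fun do rewrite mulrBr hornerD hornerN; exact: cvgB h2 h1.
have dcv (sig : Om) : ('X * (q k - p k))^`().[cyls_eval F sig] @[k --> \oo]
    --> dtrunc a b (cyls_eval F sig).
  have [_ _ h1 _] := Hp _ (HB sig); have [_ _ h2 _] := Hq _ (HB sig).
  by under eq_fun do rewrite mulrBr derivB hornerD hornerN; exact: cvgB h2 h1.
have bd k (sig : Om) : `|('X * (q k - p k)).[cyls_eval F sig]| <= B + B.
  have [_ h1 _ _] := Hp _ (HB sig); have [_ h2 _ _] := Hq _ (HB sig).
  by rewrite mulrBr hornerD hornerN (le_trans (ler_normB _ _))// lerD.
have dbd k (sig : Om) : -1 <= ('X * (q k - p k))^`().[cyls_eval F sig] <= 1.
  have [/(_ k)/andP[? ?] _ _ _] := Hp _ (HB sig).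
  have [/(_ k)/andP[? ?] _ _ _] := Hq _ (HB sig).
  by rewrite mulrBr derivB hornerD hornerN; apply/andP; split; lra.
have tbd (sig : Om) : `|trunc a b (cyls_eval F sig)| <= B + B.
  have H : `|('X * (q k - p k)).[cyls_eval F sig]| @[k --> \oo] -->
      `|trunc a b (cyls_eval F sig)| by apply: cvg_norm; exact: cv.
  rewrite -(cvg_lim _ H)//.
  by apply: limr_le; [apply/cvg_ex; eexists; exact: H|apply: nearW => k; exact: bd].
have md : measurable_fun setT (fun sig : Om => dtrunc a b (cyls_eval F sig)).
  exact: (measurableT_comp (dtrunc_measurable a b) mF).
have mt : measurable_fun setT (fun sig : Om => trunc a b (cyls_eval F sig)).
  exact: (measurableT_comp (trunc_measurable a b) mF).
have mN := Hnorm2_measurable hU.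
have N0 sig : (0 <= N2 (U sig))%E by apply: Hnorm2_ge0 => //; exact: (Hsection_mtD _ hU).
have iN := energy_finite_integrable hU fU.
have mpol (s : {poly R}) : measurable_fun setT (fun sig : Om => s.[cyls_eval F sig]).
  apply: (measurableT_comp (f := horner s)) => //.
  by apply: continuous_measurable_fun; exact: continuous_horner.
have hV : Hsection mu (fun sig r f => dtrunc a b (cyls_eval F sig) * U sig r f).
  have := Hsection_comb md (measurable_cst (0 : R)) hU hU.
  by under eq_fun do under eq_fun do under eq_fun do rewrite mul0r addr0.
split; [exact: mt|exact: bounded_L2 tbd mt|exact: hV| |].
- apply: le_lt_trans (energy_dtrunc cF ab) _; apply: le_lt_trans fU.
  apply: ge0_le_integral => //.
  + move=> sig _; rewrite mule_ge0// lee_fin.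
    by have /andP[] := dtrunc01 (cyls_eval F sig) ab.
  + by apply: emeasurable_funM => //; exact/measurable_EFinP.
  + move=> sig _; rewrite -[X in (_ <= X)%E]mul1e lee_wpmul2r// lee_fin.
    by have /andP[] := dtrunc01 (cyls_eval F sig) ab.
- have /choice[G HG] : forall k, exists G,
      (forall sig : Om, cyls_eval G sig = ('X * (q k - p k)).[cyls_eval F sig]) /\
      cyl_gradient mu par G
        (fun sig r f => ('X * (q k - p k))^`().[cyls_eval F sig] * U sig r f).
    by move=> k; have [G h1 h2] := cyl_gradient_poly hpar (q k - p k) cF; exists G.
  exists G, (fun k sig r f => ('X * (q k - p k))^`().[cyls_eval F sig] * U sig r f).
  split.
  + by move=> k; have [] := HG k.
  + rewrite /cvg_L2.
    apply: (@dominated_cvg_zero _ _ _ _ _ (cst ((B + B + (B + B)) ^+ 2)%:E)).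
    * move=> k; apply/measurable_EFinP; apply: measurable_funX.
      apply: measurable_funB => //.
      have [E _] := HG k.
      rewrite (_ : cyls_eval (G k) = fun sig : Om => ('X * (q k - p k)).[cyls_eval F sig]).
        exact: mpol.
      exact/funext.
    * by move=> k sig; rewrite lee_fin sqr_ge0.
    * apply: aeW => sig; apply: cvg_EFin; first exact: nearW.
      have : ('X * (q k - p k)).[cyls_eval F sig] - trunc a b (cyls_eval F sig)
          @[k --> \oo] --> (0 : R).
        by rewrite -(subrr (trunc a b (cyls_eval F sig))); apply: cvgB => //; exact: cvg_cst.
      move=> H; have H2 := cvgM H H; rewrite mulr0 in H2.
      rewrite (_ : fine \o _ = (fun k =>
        (('X * (q k - p k)).[cyls_eval F sig] - trunc a b (cyls_eval F sig)) *
        (('X * (q k - p k)).[cyls_eval F sig] - trunc a b (cyls_eval F sig)))).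
        exact: H2.
      by apply/funext => k /=; have [E _] := HG k; rewrite E expr2.
    * apply/integrableP; split; first exact: measurable_cst.
      under eq_integral do rewrite /= ger0_norm ?sqr_ge0//.
      by rewrite integral_cst// [X in (_ * X)%E]probability_setT mule1 ltry.
    * move=> k sig; have [E _] := HG k; rewrite E lee_fin.
      rewrite -[leLHS]real_normK ?num_real// lerXn2r ?nnegrE ?addr_ge0//.
      by rewrite (le_trans (ler_normB _ _))// lerD.
  + rewrite /cvg_L2H.
    pose al k (sig : Om) := ('X * (q k - p k))^`().[cyls_eval F sig] -
                            dtrunc a b (cyls_eval F sig).
    have mal k : measurable_fun setT (al k) by apply: measurable_funB => //; exact: mpol.
    have EE k : energy mu (fun sig r f =>
          ('X * (q k - p k))^`().[cyls_eval F sig] * U sig r f -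
          dtrunc a b (cyls_eval F sig) * U sig r f) =
        (\int[mu]_sig ((al k sig ^+ 2)%:E * N2 (U sig)))%E.
      rewrite -(energy_mul (al k) hU); congr (energy _ _).
      apply/funext => sig; apply/funext => r; apply/funext => f; by rewrite [RHS]mulrBl.
    rewrite (funext EE).
    apply: (@dominated_cvg_zero _ _ _ _ _ (fun sig => 4%:E * N2 (U sig))%E).
    * move=> k; apply: emeasurable_funM => //.
      by apply/measurable_EFinP; apply: measurable_funX.
    * by move=> k sig; rewrite mule_ge0// lee_fin sqr_ge0.
    * apply: aeS (Hsection_finite hU) => sig fN.
      have fin : N2 (U sig) \is a fin_num by rewrite ge0_fin_numE.
      have : al k sig @[k --> \oo] --> (0 : R).
        rewrite -(subrr (dtrunc a b (cyls_eval F sig))).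
        by apply: cvgB; [exact: dcv|exact: cvg_cst].
      move=> H.
      have H3 : al k sig * al k sig * fine (N2 (U sig)) @[k --> \oo] --> (0 : R).
        have -> : (0 : R) = 0 * 0 * fine (N2 (U sig)) by rewrite !mul0r.
        by apply: cvgM; [exact: cvgM|exact: cvg_cst].
      rewrite (_ : (fun k => _) = (fun k => (al k sig * al k sig * fine (N2 (U sig)))%:E)).
        by apply: cvg_EFin; [exact: nearW|exact: H3].
      by apply/funext => k; rewrite [RHS]EFinM fineK// expr2.
    * exact: integrableZl.
    * move=> k sig; rewrite lee_wpmul2r// lee_fin.
      have /andP[? ?] := dbd k sig.
      have /andP[? ?] := dtrunc01 (cyls_eval F sig) ab.
      by rewrite /al; nra.
Qed.

End Truncation.

(** * Means, entropies and medians of bounded functions *)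

Section BoundedExpectation.
Context {R : realType} d {Om : measurableType d}.
Variable mu : probability Om R.

Definition bmeas (h : Om -> R) : Prop :=
  measurable_fun setT h /\ exists B : R, forall x, `|h x| <= B.

Definition mean (h : Om -> R) : R := fine (\int[mu]_x (h x)%:E)%E.

Lemma bmeas_integrable h : bmeas h -> mu.-integrable setT (EFin \o h).
Proof.
move=> [mh [B hB]]; apply: (@measurable_bounded_integrable _ _ _ mu).
- exact: measurableT.
- by rewrite [X in (X < _)%E]probability_setT ltry.
- exact: mh.
- exists B; split; first by rewrite num_real.
  by move=> y By x _; exact: (le_trans (hB x) (ltW By)).
Qed.

Lemma meanE h : bmeas h -> (\int[mu]_x (h x)%:E)%E = (mean h)%:E.
Proof. by move=> bh; rewrite /mean fineK//; exact/integrable_fin_num/bmeas_integrable. Qed.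

Lemma bmeas_cst (a : R) : bmeas (fun=> a).
Proof. by split; [exact: measurable_cst|exists `|a|]. Qed.

Lemma bmeasD f h : bmeas f -> bmeas h -> bmeas (fun x => f x + h x).
Proof.
move=> [mf [B fB]] [mh [B' hB]]; split; first exact: measurable_funD.
by exists (B + B') => x; rewrite (le_trans (ler_normD _ _))// lerD.
Qed.

Lemma bmeasM f h : bmeas f -> bmeas h -> bmeas (fun x => f x * h x).
Proof.
move=> [mf [B fB]] [mh [B' hB]]; split; first exact: measurable_funM.
by exists (B * B') => x; rewrite normrM ler_pM.
Qed.

Lemma bmeasZ a f : bmeas f -> bmeas (fun x => a * f x).
Proof. by apply: bmeasM; exact: bmeas_cst. Qed.

Lemma bmeasN f : bmeas f -> bmeas (fun x => - f x).
Proof. by move=> /(bmeasZ (-1)); under eq_fun do rewrite mulN1r. Qed.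

Lemma bmeasB f h : bmeas f -> bmeas h -> bmeas (fun x => f x - h x).
Proof. by move=> bf /bmeasN; exact: bmeasD. Qed.

Lemma bmeasX2 f : bmeas f -> bmeas (fun x => f x ^+ 2).
Proof. by move=> bf; under eq_fun do rewrite expr2; exact: bmeasM. Qed.

Lemma bmeas_sum (I : Type) (s : seq I) (f : I -> Om -> R) :
  (forall i, bmeas (f i)) -> bmeas (fun x => \sum_(i <- s) f i x).
Proof.
move=> bf; elim: s => [|i s IH].
  by under eq_fun do rewrite big_nil; exact: bmeas_cst.
by under eq_fun do rewrite big_cons; exact: bmeasD.
Qed.

Lemma mean_cst a : mean (fun=> a) = a.
Proof.
by rewrite /mean integral_cst// [X in (_ * X)%E]probability_setT mule1.
Qed.

Lemma meanD f h : bmeas f -> bmeas h -> mean (fun x => f x + h x) = mean f + mean h.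
Proof.
move=> bf bh; apply: EFin_inj; rewrite -meanE; last exact: bmeasD.
rewrite EFinD -!meanE// -integralD//; exact: bmeas_integrable.
Qed.

Lemma meanZ a f : bmeas f -> mean (fun x => a * f x) = a * mean f.
Proof.
move=> bf; apply: EFin_inj; rewrite -meanE; last exact: bmeasZ.
rewrite EFinM -meanE// -integralZl//; exact: bmeas_integrable.
Qed.

Lemma meanB f h : bmeas f -> bmeas h -> mean (fun x => f x - h x) = mean f - mean h.
Proof.
move=> bf bh; rewrite meanD//; last exact: bmeasN.
congr (_ + _); rewrite -[RHS]mulN1r -meanZ//.
by congr mean; apply/funext => x; rewrite mulN1r.
Qed.

Lemma mean_sum (I : Type) (s : seq I) (f : I -> Om -> R) :
  (forall i, bmeas (f i)) ->
  mean (fun x => \sum_(i <- s) f i x) = \sum_(i <- s) mean (f i).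
Proof.
move=> bf; elim: s => [|i s IH].
  by under eq_fun do rewrite big_nil; rewrite mean_cst big_nil.
under eq_fun do rewrite big_cons.
by rewrite meanD ?IH ?big_cons//; exact: bmeas_sum.
Qed.

Lemma mean_le f h : bmeas f -> bmeas h -> (forall x, f x <= h x) -> mean f <= mean h.
Proof.
move=> bf bh fh; rewrite -lee_fin -!meanE//.
apply: le_integral => //; try exact: bmeas_integrable.
by move=> x _; rewrite lee_fin.
Qed.

Lemma mean_ge0 f : bmeas f -> (forall x, 0 <= f x) -> 0 <= mean f.
Proof. by move=> bf f0; rewrite -(mean_cst 0); exact: mean_le (bmeas_cst 0) bf f0. Qed.

Definition above (F : Om -> R) (t : R) (x : Om) : R := (t < F x)%R%:R.

Lemma above01 F t x : 0 <= above F t x <= 1.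
Proof. by rewrite /above; case: (t < F x); rewrite ?lexx ?ler01. Qed.

Lemma bmeas_above F t : measurable_fun setT F -> bmeas (above F t).
Proof.
move=> mF; split.
  rewrite (_ : above F t = fun x => if t < F x then 1 else 0); last first.
    by apply/funext => x; rewrite /above; case: (t < F x).
  apply: measurable_fun_ifT; [|exact: measurable_cst|exact: measurable_cst].
  by apply: measurable_fun_ltr => //; exact: measurable_cst.
exists 1 => x; have /andP[h0 h1] := above01 F t x; by rewrite ger0_norm.
Qed.

Definition ent_density (h : Om -> R) (x : Om) : R := h x * ln (h x / mean h).

(** The convex function [t ln t] lies above its tangent at [1]. *)
Lemma xlnx_ge (t : R) : 0 <= t -> t - 1 <= t * ln t.
Proof.
rewrite le_eqVlt => /orP[/eqP <-|t0]; first by rewrite mul0r sub0r oppr_le0 ler01.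
have := le_ln1Dx (x := t^-1 - 1); rewrite addrCA subrr addr0 lnV ?posrE//.
have ti : 0 < t^-1 by rewrite invr_gt0.
move=> /(_ _)H; have {}H : - ln t <= t^-1 - 1 by apply: H; lra.
have : t * (- ln t) <= t * (t^-1 - 1) by rewrite ler_pM2l.
by rewrite mulrBr mulfV ?gt_eqF// mulr1 mulrN; lra.
Qed.

Lemma bmeas_ent_density h : bmeas h -> (forall x, 0 <= h x) -> 0 < mean h ->
  bmeas (ent_density h).
Proof.
move=> bh h0 m0; have [mh [B hB]] := bh; split.
  apply: measurable_funM => //; apply: (measurableT_comp (f := @ln R)).
    exact: measurable_ln.
  by apply: measurable_funM => //; exact: measurable_cst.
exists (mean h + B * (B / mean h)) => x; rewrite /ent_density.
have hxB : h x <= B by rewrite (le_trans (ler_norm _)).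
have B0 : 0 <= B by exact: le_trans hxB.
have t0 : 0 <= h x / mean h by rewrite divr_ge0// ltW.
have lower : - mean h <= h x * ln (h x / mean h).
  have := xlnx_ge t0; rewrite -(ler_pM2l m0) => H.
  have E : mean h * (h x / mean h * ln (h x / mean h)) = h x * ln (h x / mean h).
    by rewrite mulrA [mean h * _]mulrC divfK// gt_eqF.
  rewrite E mulrBr mulr1 in H.
  by have : 0 <= mean h * (h x / mean h) by [rewrite mulr_ge0// ltW]; lra.
have upper : h x * ln (h x / mean h) <= B * (B / mean h).
  have [->|hx0] := eqVneq (h x) 0; first by rewrite mul0r mulr_ge0// divr_ge0// ltW.
  have hxp : 0 < h x by rewrite lt_neqAle eq_sym hx0 h0.
  have tp : 0 < h x / mean h by rewrite divr_gt0.
  have l1 : ln (h x / mean h) <= h x / mean h.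
    have := le_ln1Dx (x := h x / mean h - 1); rewrite addrCA subrr addr0 => H.
    have {}H := H _; apply: (le_trans (H _)); lra.
  apply: (@le_trans _ _ (h x * (h x / mean h))); first by rewrite ler_pM2l.
  by apply: ler_pM => //; rewrite ler_pM2r ?invr_gt0.
have BB : 0 <= B * (B / mean h) by rewrite mulr_ge0// divr_ge0// ltW.
by rewrite ler_norml; apply/andP; split; lra.
Qed.

(** Here [chi] stands for the indicator of a set that supports [h].  Among the
    functions of given mean on that set the constant has the least entropy; the
    proof compares [h] with it by [xlnx_ge]. *)
Lemma entropy_support h (chi : Om -> R) : bmeas h -> (forall x, 0 <= h x) ->
  0 < mean h -> bmeas chi -> (forall x, 0 <= chi x) ->
  (forall x, 0 < h x -> chi x = 1) -> 0 < mean chi ->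
  mean h * - ln (mean chi) <= mean (ent_density h).
Proof.
move=> bh h0 m0 bchi chi0 hchi a0; set a := mean chi in a0 *.
have be := bmeas_ent_density bh h0 m0.
have bl : bmeas (fun x => - ln a * h x + (h x - mean h / a * chi x)).
  by apply: bmeasD; [exact: bmeasZ|apply: bmeasB => //; exact: bmeasZ].
suff key x : - ln a * h x + (h x - mean h / a * chi x) <= ent_density h x.
  have := mean_le bl be key; rewrite meanD ?meanB ?meanZ//; try exact: bmeasZ;
    try (by apply: bmeasB => //; exact: bmeasZ).
  by rewrite -/a divfK ?gt_eqF// subrr addr0 mulrC.
rewrite /ent_density; have [hx0|hx0] := eqVneq (h x) 0.
  rewrite hx0 mulr0 mul0r add0r sub0r oppr_le0.
  by rewrite mulr_ge0// divr_ge0// ltW.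
have hxp : 0 < h x by rewrite lt_neqAle eq_sym hx0 h0.
rewrite hchi// mulr1.
have t0 : 0 <= h x / mean h * a by rewrite mulr_ge0 ?divr_ge0// ltW.
have p0 : 0 < mean h / a by rewrite divr_gt0.
have := xlnx_ge t0; rewrite -(ler_pM2l p0) lnM ?posrE ?divr_gt0//.
have E : mean h / a * (h x / mean h * a) = h x.
  by field; rewrite !gt_eqF.
by rewrite mulrBr mulr1 E [X in _ <= X]mulrA E mulrDr; lra.
Qed.

(** With [c^2] the mean of [f^2], the pointwise inequality
    [f^2 ln (f^2 / c^2) >= 2 f (f - c)] follows from [xlnx_ge] at [f / c]; the
    right-hand side is [(f - c)^2 + f^2 - c^2]. *)
Lemma entropy_L2 f : bmeas f -> (forall x, 0 <= f x) ->
  0 < mean (fun x => f x ^+ 2) ->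
  mean (fun x => (f x - Num.sqrt (mean (fun x => f x ^+ 2))) ^+ 2) <=
    mean (ent_density (fun x => f x ^+ 2)).
Proof.
move=> bf f0; set h := fun x => f x ^+ 2; set m := mean h => m0; set c := Num.sqrt m.
have bh : bmeas h by exact: bmeasX2.
have h0 x : 0 <= h x by exact: sqr_ge0.
have be := bmeas_ent_density bh h0 m0.
have cc : c ^+ 2 = m by rewrite sqr_sqrtr// ltW.
have c0 : 0 < c by rewrite sqrtr_gt0.
have bl : bmeas (fun x => (f x - c) ^+ 2).
  by apply: bmeasX2; apply: bmeasB => //; exact: bmeas_cst.
have br : bmeas (fun x => ent_density h x - (h x - m)).
  by apply: bmeasB => //; apply: bmeasB => //; exact: bmeas_cst.
suff key x : (f x - c) ^+ 2 <= ent_density h x - (h x - m).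
  have := mean_le bl br key; rewrite !meanB ?mean_cst//; try exact: bmeas_cst;
    try (by apply: bmeasB => //; exact: bmeas_cst).
  by rewrite -/m subrr subr0.
rewrite /ent_density -/m /h.
have [->|fx0] := eqVneq (f x) 0.
  by rewrite expr0n /= mul0r !sub0r sqrrN cc opprK.
have fxp : 0 < f x by rewrite lt_neqAle eq_sym fx0 f0.
have t0 : 0 <= f x / c by rewrite divr_ge0// ltW.
have -> : f x ^+ 2 / m = (f x / c) ^+ 2 by rewrite expr_div_n cc.
rewrite lnXn ?divr_gt0//.
have := xlnx_ge t0; have p0 : 0 < 2 * c * f x by rewrite !mulr_gt0.
rewrite -(ler_pM2l p0).
have E : 2 * c * f x * (f x / c * ln (f x / c)) = 2 * f x ^+ 2 * ln (f x / c).
  by field; rewrite gt_eqF.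
have E2 : 2 * c * f x * (f x / c - 1) = 2 * f x ^+ 2 - 2 * c * f x.
  by field; rewrite gt_eqF.
rewrite E E2 -cc => H; rewrite -mulr_natl; lra.
Qed.

Definition median_of (F : Om -> R) (m : R) : Prop := forall e, 0 < e ->
  mean (above F (m + e)) <= 1 / 2 /\ mean (above (fun x => - F x) (- m + e)) <= 1 / 2.

(** Take the infimum of the levels that [F] exceeds with probability at most
    [1/2]. *)
Lemma median F : bmeas F -> exists m : R, median_of F m.
Proof.
move=> bF; have [mF [B FB]] := bF.
have mNF : measurable_fun setT (fun x => - F x) by have [] := bmeasN bF.
pose S : set R := [set t | mean (above F t) <= 1 / 2].
have SB : S B.
  rewrite /S /=; have -> : above F B = fun=> 0.
    by apply/funext => x; rewrite /above ltNge (le_trans (ler_norm _)).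
  by rewrite mean_cst; lra.
have lbS : lbound S (- B - 1).
  move=> t St; rewrite leNgt; apply/negP => tB; move: St; rewrite /S /=.
  have -> : above F t = fun=> 1.
    apply/funext => x; rewrite /above.
    have := FB x; rewrite ler_norml => /andP[? _].
    by have -> : t < F x by lra.
  by rewrite mean_cst; lra.
have hS : has_inf S by split; [exists B|exists (- B - 1)].
exists (inf S) => e e0; split.
  have [t St tm] := inf_adherent e0 hS.
  apply: le_trans St; apply: mean_le; try exact: bmeas_above.
  move=> x; rewrite /above ler_nat.
  by case: (ltP (inf S + e) (F x)) => // H; rewrite (lt_trans tm H).
have nS : ~ S (inf S - e).
  move=> Se; have := inf_lbound (proj2 hS) Se; lra.
have {}nS : 1 / 2 < mean (above F (inf S - e)) by rewrite ltNge; apply/negP.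
have : mean (above (fun x => - F x) (- inf S + e)) <=
    mean (fun x => 1 - above F (inf S - e) x).
  apply: mean_le; first exact: bmeas_above.
    by apply: bmeasB; [exact: bmeas_cst|exact: bmeas_above].
  move=> x; rewrite /above; case: (ltP (inf S - e) (F x)) => H1.
    by rewrite subrr; case: ltP => // H2; lra.
  by rewrite subr0; case: (_ < _); rewrite ?lexx ?ler01.
rewrite meanB ?mean_cst; [|exact: bmeas_cst|exact: bmeas_above]; lra.
Qed.

End BoundedExpectation.

(** * Level sets under a weak logarithmic Sobolev inequality *)

Section LayerCake.
Context {R : realType}.

Lemma trunc_clamp (a b x : R) : 0 <= a -> a < b ->
  [/\ 0 <= trunc a b x <= b - a, x <= a -> trunc a b x = 0,
      b <= x -> trunc a b x = b - a & 0 < trunc a b x -> a < x].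
Proof.
move=> a0 ab; have b0 := le_lt_trans a0 ab.
have -> : trunc a b x = Num.min x b - Num.min x a.
  by rewrite /trunc (min_l (ltW b0)) (min_l a0) !subr0.
have [xa|ax] := leP x a; have [xb|bx] := leP x b; split; try lra.
Qed.

(** Dyadic layer cake: if [g] is between [lam 2^k] and [lam 2^(k+1)], then [g^2]
    is at most [4 (lam 2^k)^2]. *)
Lemma layer_sum (g lam : R) K : 0 <= g -> 0 < lam ->
  Num.min g (lam * 2 ^+ K) ^+ 2 <=
    lam ^+ 2 + \sum_(k < K) 4 * (lam * 2 ^+ k) ^+ 2 * (lam * 2 ^+ k < g)%R%:R.
Proof.
move=> g0 lam0; elim: K => [|K IH].
  rewrite big_ord0 addr0 expr0 mulr1 lerXn2r ?nnegrE//.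
  - by rewrite le_min g0 ltW.
  - exact: ltW.
  - by rewrite ge_min lexx orbT.
rewrite big_ord_recr /= addrA; set S := lam ^+ 2 + _ in IH *.
have tK : 0 < lam * 2 ^+ K by rewrite mulr_gt0// exprn_gt0.
have S0 : 0 <= S by rewrite (le_trans _ IH)// sqr_ge0.
have [gK|Kg] := leP g (lam * 2 ^+ K).
  rewrite min_l ?mulr0 ?addr0; last by rewrite (le_trans gK)// exprS; lra.
  by move: IH; rewrite min_l.
rewrite mulr1; have : Num.min g (lam * 2 ^+ K.+1) ^+ 2 <= (2 * (lam * 2 ^+ K)) ^+ 2.
  rewrite lerXn2r ?nnegrE//.
  - by rewrite le_min g0 mulr_ge0// ?exprn_ge0// ltW.
  - by rewrite mulr_ge0// ltW.
  - by rewrite ge_min exprS mulrCA lexx orbT.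
by rewrite exprMn => H; lra.
Qed.

Context d {Om : measurableType d}.
Variable mu : probability Om R.
Variables (r0 C : R).
Hypotheses (r0_gt0 : 0 < r0) (C_gt0 : 0 < C).

(** [ln (4/3)] is the least factor gained in the entropy of a function supported
    in a set of measure at most [3/4]. *)
Definition gain : R := - ln (3 / 4).

Lemma gain_gt0 : 0 < gain.
Proof. by rewrite /gain oppr_gt0 ln_lt0//; apply/andP; split; lra. Qed.

(** The parameter of the weak inequality is [frac] times the measure [A] of the
    set [F > a].  The three bounds make the error term small with respect to the
    gain of entropy, the parameter admissible, and [- ln frac] nonnegative. *)
Definition frac : R := Num.min (gain / 8) (Num.min (r0 / 2) (1 / 2)).

Lemma frac_gt0 : 0 < frac.
Proof. by have := gain_gt0; rewrite /frac !lt_min => ?; rewrite !divr_gt0. Qed.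

(** With [s = frac A], the quotient of [ln (1/s)] by [ln (1/A)] is at most this
    constant divided by [C], since [ln (1/A)] is at least [gain]. *)
Definition level_cst : R := C * (- ln frac / gain + 1).

Lemma lnfrac : 0 <= - ln frac.
Proof.
rewrite oppr_ge0 ln_le0// /frac !ge_min; apply/orP; right; apply/orP; right; lra.
Qed.

Lemma level_cst_gt0 : 0 < level_cst.
Proof.
rewrite /level_cst mulr_gt0// ltr_wpDl//; rewrite divr_ge0 ?lnfrac//.
exact/ltW/gain_gt0.
Qed.

Variable F : Om -> R.
Hypothesis bF : bmeas F.
Variable e : R -> R -> R.
Hypothesis e_ge0 : forall a b, 0 <= a -> a < b -> 0 <= e a b.
Let h a b x := trunc a b (F x) ^+ 2.
Hypothesis wlsi : forall a b s, 0 <= a -> a < b -> 0 < s -> s < r0 ->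
  0 < mean mu (h a b) ->
  mean mu (ent_density mu (h a b)) <= C * ln (1 / s) * e a b + s * (b - a) ^+ 2.

Lemma bmeas_trunc a b : 0 <= a -> a < b -> bmeas (fun x => trunc a b (F x)).
Proof.
move=> a0 ab; split.
  by have [mF _] := bF; exact: (measurableT_comp (trunc_measurable a b) mF).
exists (b - a) => x; have [/andP[h0 h1] _ _ _] := trunc_clamp (F x) a0 ab.
by rewrite ger0_norm.
Qed.

Let mF : measurable_fun setT F. Proof. by have [] := bF. Qed.

(** Lower and upper bounds of the entropy of the square of the truncation, which
    is [t^2] above the level [a + t] and supported above [a].  The factor
    [1/8] is small enough for a sum over dyadic levels, where [t^2] grows by a
    factor [4] from one level to the next. *)
Lemma level_step a t : 0 <= a -> 0 < t -> mean mu (above F a) <= 3 / 4 ->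
  t ^+ 2 * mean mu (above F (a + t)) <=
    level_cst * e a (a + t) + t ^+ 2 * mean mu (above F a) / 8.
Proof.
move=> a0 t0 A34; set A := mean mu (above F a) in A34 *.
have ab : a < a + t by rewrite ltrDl.
have bh : bmeas (h a (a + t)) by apply: bmeasX2; exact: bmeas_trunc.
have h0 x : 0 <= h a (a + t) x by exact: sqr_ge0.
have ba x : bmeas (above F x) by exact: bmeas_above.
have A0 : 0 <= A by apply: mean_ge0 => // x; have /andP[] := above01 F a x.
have e0 := e_ge0 a0 ab.
have cst0 : 0 <= level_cst * e a (a + t) by rewrite mulr_ge0// ltW// level_cst_gt0.
have t20 : 0 < t ^+ 2 by rewrite exprn_gt0.
have low : t ^+ 2 * mean mu (above F (a + t)) <= mean mu (h a (a + t)).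
  rewrite -meanZ//; apply: mean_le => // [|x]; first exact: bmeasZ.
  have [_ _ H _] := trunc_clamp (F x) a0 ab; rewrite /above /h.
  case: ltP => [/ltW/H ->|_]; last by rewrite mulr0 sqr_ge0.
  by rewrite mulr1 addrAC subrr add0r.
have upp : mean mu (h a (a + t)) <= t ^+ 2 * A.
  rewrite -meanZ//; apply: mean_le => // [|x]; first exact: bmeasZ.
  have [/andP[c0 c1] H _ _] := trunc_clamp (F x) a0 ab; rewrite /above /h.
  case: ltP => [_|/H ->]; last by rewrite mulr0 expr0n.
  rewrite addrAC subrr add0r in c1.
  by rewrite mulr1 lerXn2r ?nnegrE//; exact: ltW.
have [m0|m0] := leP (mean mu (h a (a + t))) 0.
  have : 0 <= t ^+ 2 * A / 8 by rewrite divr_ge0// mulr_ge0// ltW.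
  by move: (le_trans low m0); lra.
have Ap : 0 < A.
  by rewrite -(pmulr_rgt0 _ t20); exact: lt_le_trans upp.
have f0 := frac_gt0.
have s0 : 0 < frac * A by rewrite mulr_gt0.
have sr : frac * A < r0.
  have : frac <= r0 / 2 by rewrite /frac !ge_min lexx orbT.
  move=> H; apply: (@le_lt_trans _ _ (r0 / 2 * 1)); last by lra.
  by apply: ler_pM => //; lra.
have := wlsi a0 ab s0 sr m0.
have := entropy_support bh h0 m0 (ba a) _ _ Ap.
move=> /(_ _ _)H; have {}H : mean mu (h a (a + t)) * - ln A <=
    mean mu (ent_density mu (h a (a + t))).
  apply: H => x; first by have /andP[] := above01 F a x.
  have [/andP[c0 _] _ _ P] := trunc_clamp (F x) a0 ab.
  rewrite /h exprn_even_gt0//= => c; rewrite /above P// lt_neqAle c0 eq_sym.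
  by rewrite c.
rewrite addrAC subrr add0r div1r lnV ?posrE// lnM ?posrE// => W.
have y0 : gain <= - ln A by rewrite /gain lerN2 ler_ln ?posrE//; lra.
have g0 := gain_gt0.
have yp : 0 < - ln A by exact: lt_le_trans y0.
rewrite (le_trans low)// -(ler_pM2r yp).
set y := - ln A in H W y0 yp *; set L := - ln frac in W.
have L0 : 0 <= L by exact: lnfrac.
have W' : mean mu (h a (a + t)) * y <= C * (L + y) * e a (a + t) + frac * A * t ^+ 2.
  by rewrite (le_trans H)// (le_trans W)// /L /y opprD.
apply: (le_trans W'); rewrite mulrDl; apply: lerD.
  have -> : level_cst * e a (a + t) * y = C * (L / gain * y + y) * e a (a + t).
    by rewrite /level_cst -/L; ring.
  apply: ler_wpM2r => //; apply: ler_wpM2l; first exact: ltW.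
  by rewrite lerD2r mulrAC -mulrA ler_peMr// ler_pdivlMr// mul1r.
have fg : frac <= gain / 8 by rewrite /frac ge_min lexx.
have -> : frac * A * t ^+ 2 = t ^+ 2 * A * frac by ring.
have -> : t ^+ 2 * A / 8 * y = t ^+ 2 * A * (y / 8) by ring.
apply: ler_wpM2l; first by rewrite mulr_ge0// ltW.
by lra.
Qed.

(** If [S] is the sum of [t_k^2 mu (F > a + t_k)] over [t_k = lam 2^k], then
    [level_step] gives [S - lam^2 <= 4 level_cst E + S / 2].  Finitely
    many levels are enough because [F] is bounded, and [lam] is arbitrarily
    small. *)
Lemma weighted_tail (a E : R) : 0 <= a -> mean mu (above F a) <= 3 / 4 ->
  (forall lam K, 0 < lam ->
    \sum_(k < K) e (a + lam * 2 ^+ k) (a + lam * 2 ^+ k.+1) <= E) ->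
  mean mu (fun x => Num.max (F x - a) 0 ^+ 2) <= 32 * level_cst * E.
Proof.
move=> a0 A34 HE; apply/ler_addgt0Pr => eps eps0.
pose lam := Num.sqrt (eps / 9).
have lam0 : 0 < lam by rewrite sqrtr_gt0 divr_gt0.
have lam2 : lam ^+ 2 = eps / 9 by rewrite sqr_sqrtr// divr_ge0// ltW.
have [_ [B FB]] := bF.
have [K HK] : exists K, B + a <= lam * 2 ^+ K.
  pose K := Num.truncn ((B + a) / lam); exists K.+1.
  rewrite mulrC -ler_pdivrMr//.
  apply: (@le_trans _ _ K.+1%:R).
    by have [z0|z0] := leP 0 ((B + a) / lam);
      [apply/ltW/truncnS_gt|rewrite (le_trans (ltW z0))].
  by rewrite -natrX ler_nat ltnW// ltn_expl.
pose t k := lam * 2 ^+ k.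
have t0 k : 0 < t k by rewrite /t mulr_gt0// exprn_gt0.
pose m k := mean mu (above F (a + t k)).
have ba x : bmeas (above F x) by exact: bmeas_above.
have m34 k : m k <= 3 / 4.
  apply: le_trans A34; apply: mean_le => // x; rewrite /above ler_nat.
  case: (ltP (a + t k) (F x)) => // H; rewrite (lt_trans _ H)//.
  by rewrite ltrDl.
have m0 k : 0 <= m k by apply: mean_ge0 => // x; have /andP[] := above01 F (a + t k) x.
have step k : t k ^+ 2 * m k.+1 <= level_cst * e (a + t k) (a + t k.+1) + t k ^+ 2 * m k / 8.
  have := @level_step (a + t k) (t k) _ (t0 k) (m34 k).
  have -> : a + t k + t k = a + t k.+1 by rewrite /t exprS; ring.
  by apply; rewrite addr_ge0// ltW.
pose S := \sum_(k < K) t k ^+ 2 * m k.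
have shift : \sum_(k < K) t k.+1 ^+ 2 * m k.+1 >= S - lam ^+ 2.
  rewrite /S; case: (K) => [|K']; first by rewrite !big_ord0 sub0r oppr_le0 sqr_ge0.
  rewrite big_ord_recl big_ord_recr /=.
  have : t 0%N ^+ 2 * m 0%N <= lam ^+ 2.
    by rewrite /t expr0 mulr1 ler_piMr ?sqr_ge0// (le_trans (m34 0%N))//; lra.
  have : 0 <= t K'.+1 ^+ 2 * m K'.+1 by rewrite mulr_ge0// sqr_ge0.
  set u := \sum_(i < K') _; set v := (X in X + _ - _).
  have -> : v = t 0%N ^+ 2 * m 0%N by [].
  by lra.
have sum4 : \sum_(k < K) t k.+1 ^+ 2 * m k.+1 <= 4 * (level_cst * E) + S / 2.
  apply: (@le_trans _ _ (\sum_(k < K) (4 * (level_cst * e (a + t k) (a + t k.+1)) +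
     2^-1 * (t k ^+ 2 * m k)))).
    apply: ler_sum => k _; have := step k.
    have -> : t k.+1 ^+ 2 = 4 * t k ^+ 2 by rewrite /t [2 ^+ k.+1]exprS; ring.
    set p := level_cst * _; set q := t k ^+ 2 * m k.
    rewrite -mulrA; set w := t k ^+ 2 * m k.+1; lra.
  rewrite big_split /= -!mulr_sumr [S / 2]mulrC lerD2r ler_pM2l//.
  by rewrite ler_pM2l ?level_cst_gt0//; exact: HE.
have Sb : S <= 8 * (level_cst * E) + 2 * lam ^+ 2 by lra.
have bmax : bmeas (fun x => Num.max (F x - a) 0 ^+ 2).
  apply: bmeasX2; split.
    by apply: measurable_maxr; [apply: measurable_funB => //|]; exact: measurable_cst.
  exists (`|B| + a) => x; rewrite ger0_norm ?le_max ?lexx ?orbT//.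
  rewrite ge_max addr_ge0// andbT; have := FB x; have := ler_norm B.
  by rewrite ler_norml => ? /andP[_ ?]; lra.
have bs : bmeas (fun x => lam ^+ 2 + \sum_(k < K) 4 * t k ^+ 2 * above F (a + t k) x).
  apply: bmeasD; first exact: bmeas_cst.
  by apply: bmeas_sum => k; exact: bmeasZ.
apply: (@le_trans _ _ (lam ^+ 2 + 4 * S)).
  apply: (@le_trans _ _ (mean mu (fun x => lam ^+ 2 +
      \sum_(k < K) 4 * t k ^+ 2 * above F (a + t k) x))).
    apply: mean_le => // x; have g0 : 0 <= Num.max (F x - a) 0 by rewrite le_max lexx orbT.
    have := layer_sum K g0 lam0; rewrite min_l; last first.
      rewrite ge_max; apply/andP; split; last exact/ltW/t0.
      apply: le_trans HK.
      by have := FB x; rewrite ler_norml => /andP[_ ?]; lra.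
    move=> H; apply: (le_trans H); rewrite lerD2l; apply: ler_sum => k _.
    rewrite -/(t k) /above lt_max [t k < 0]ltNge (ltW (t0 k)) orbF ltrBrDl.
    by [].
  rewrite meanD ?mean_cst; [|exact: bmeas_cst|by apply: bmeas_sum => k; exact: bmeasZ].
  rewrite mean_sum; last by move=> k; exact: bmeasZ.
  rewrite lerD2l /S mulr_sumr; apply: ler_sum => k _.
  by rewrite meanZ// mulrA.
by rewrite lam2 in Sb *; lra.
Qed.

End LayerCake.

(** * The Poincare inequality *)

Section Variance.
Context {R : realType} d {Om : measurableType d}.
Variable mu : probability Om R.

Lemma variance_le_shift (f : Om -> R) (c : R) : measurable_fun setT f ->
  (\int[mu]_x (f x ^+ 2)%:E < +oo)%E ->
  ('V_mu[f] <= \int[mu]_x ((f x - c) ^+ 2)%:E)%E.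
Proof.
move=> mf f2.
have L2 (h : Om -> R) : measurable_fun setT h -> (\int[mu]_x (h x ^+ 2)%:E < +oo)%E ->
    h \in Lfun mu 2%:E.
  move=> mh h2; rewrite inE; apply/andP; split; rewrite inE//=.
  rewrite /finite_norm unlock /= poweR_lty//.
  apply: le_lt_trans h2; rewrite le_eqVlt; apply/orP; left; apply/eqP.
  by apply: eq_integral => x _; rewrite powR_mulrn ?normr_ge0// real_normK// num_real.
have mg : measurable_fun setT (fun x => f x - c).
  by apply: measurable_funB => //; exact: measurable_cst.
have g2 : (\int[mu]_x ((f x - c) ^+ 2)%:E < +oo)%E.
  apply: (@le_lt_trans _ _ (\int[mu]_x (2%:E * (f x ^+ 2)%:E + (2 * c ^+ 2)%:E))%E).
    apply: ge0_le_integral => //.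
    - by move=> x _; rewrite lee_fin sqr_ge0.
    - by apply/measurable_EFinP; exact: measurable_funX.
    - apply: emeasurable_funD; last exact: measurable_cst.
      by apply: measurable_funeM; apply/measurable_EFinP; exact: measurable_funX.
    - move=> x _; rewrite -EFinM -EFinD lee_fin.
      by have := sqr_ge0 (f x + c); lra.
  have p1 x : [set: Om] x -> (0 <= (f x ^+ 2)%:E)%E by rewrite lee_fin sqr_ge0.
  have m1 : measurable_fun setT (fun x => (f x ^+ 2)%:E).
    by apply/measurable_EFinP; exact: measurable_funX.
  have p2 x : [set: Om] x -> (0 <= 2%:E * (f x ^+ 2)%:E)%E.
    by move=> _; rewrite mule_ge0// lee_fin sqr_ge0.
  have m2 : measurable_fun setT (fun x => 2%:E * (f x ^+ 2)%:E)%E.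
    exact: measurable_funeM.
  have p3 x : [set: Om] x -> (0 <= (2 * c ^+ 2)%:E)%E.
    by rewrite lee_fin mulr_ge0// sqr_ge0.
  rewrite ge0_integralD// ge0_integralZl_EFin//.
  rewrite integral_cst// [X in (_ + _ * X)%E]probability_setT mule1.
  by rewrite lte_add_pinfty ?ltry// lte_mul_pinfty.
rewrite -(varianceB_cst_r c (L2 _ mf f2)).
rewrite varianceE; last exact: L2.
rewrite (@le_trans _ _ ('E_mu[(f \- cst c) ^+ 2])%E)//; last by rewrite unlock.
rewrite -[leRHS]sube0 leeB//.
by rewrite sqre_ge0.
Qed.

End Variance.

Section PoincareInequality.
Context {R : realType} {n : nat} {M : riemannianManifold R n} {T : R} {x0 : M}.
Local Notation Om := (path_space T x0).
Variable mu : probability Om R.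
Variable par : Om -> R -> tvec R M -> tvec R M.
Local Notation tan := (tangent (rm_atlas M) x0).
Local Notation N2 := (Hnorm2 T x0).
Hypothesis hpar : {ae mu, forall sig, forall s v, 0 <= s <= T -> tan v ->
  tangent (rm_atlas M) (Defs.coord s sig) (par sig s v)}.
Variables (r0 C : R).
Hypotheses (r0_gt0 : 0 < r0) (C_gt0 : 0 < C).
Hypothesis hwlsi : forall s : R, 0 < s -> s < r0 ->
  forall (f : Om -> R) (V : Om -> R -> tvec R M), D12_gradient mu par f V ->
  (exists B : R, forall sig, `|f sig| <= B) ->
  (entropy mu (fun sig => (f sig ^+ 2)%R) <= (C * ln (1 / s))%:E * energy mu V
     + s%:E * ('N[mu]_+oo[EFin \o f]) ^+ 2)%E.
Local Notation E_ U := (fine (energy mu U)).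
Local Notation al0 := (32 * level_cst r0 C).

Lemma energy_fin U : Hsection mu U -> (energy mu U < +oo)%E ->
  energy mu U = (E_ U)%:E.
Proof. by move=> hU fU; rewrite fineK// ge0_fin_numE// energy_ge0. Qed.

Lemma E_ge0 U : Hsection mu U -> 0 <= E_ U.
Proof. by move=> hU; rewrite fine_ge0// energy_ge0. Qed.

Lemma wlsi_real f V B s : D12_gradient mu par f V -> (forall sig, `|f sig| <= B) ->
  0 < s -> s < r0 -> 0 < mean mu (fun x => f x ^+ 2) ->
  mean mu (ent_density mu (fun x => f x ^+ 2)) <= C * ln (1 / s) * E_ V + s * B ^+ 2.
Proof.
move=> hf fB s0 sr m0; have [mf _ hV fV _] := hf.
have bf : bmeas f by split=> //; exists B.
have be := bmeas_ent_density (bmeasX2 bf) (fun x => sqr_ge0 (f x)) m0.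
have := hwlsi s0 sr hf (ex_intro _ B fB).
have -> : entropy mu (fun sig => f sig ^+ 2) =
    (mean mu (ent_density mu (fun x => f x ^+ 2)))%:E.
  by rewrite -meanE// /entropy unlock.
have B0 : 0 <= B by exact: le_trans (fB (cst_path T x0)).
have NB : ('N[mu]_+oo[EFin \o f] <= B%:E)%E.
  rewrite unlock /= [X in (0 < X)%E]probability_setT lte01.
  by apply/ess_supP; apply: aeW => x /=; rewrite lee_fin.
rewrite (energy_fin hV fV) => H; rewrite -lee_fin (le_trans H)//.
rewrite EFinD -EFinM leeD2l//; rewrite [leRHS]EFinM lee_wpmul2l ?lee_fin ?(ltW s0)//.
rewrite -[(B ^+ 2)%:E]/((B%:E) ^+ 2)%E !expe2.
by apply: lee_pmul => //; rewrite Lnorm_ge0.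
Qed.

Lemma cyl_bmeas F U : cyl_gradient mu par F U -> bmeas (fun sig : Om => cyls_eval F sig).
Proof.
move=> [sF _ _]; split; first exact: cyls_eval_measurable.
by have [B HB] := @cyls_eval_bounded _ _ _ _ x0 _ sF; exists B.
Qed.

Lemma cyl_gradient_scale F U (c : R) : cyl_gradient mu par F U -> (energy mu U < +oo)%E ->
  exists G W, [/\ (forall sig : Om, cyls_eval G sig = c * cyls_eval F sig),
    cyl_gradient mu par G W, (energy mu W < +oo)%E & E_ W = c ^+ 2 * E_ U].
Proof.
move=> cF fU; have [sF hU _] := cF.
have [G eG cG] := cyl_gradient_poly hpar c%:P cF.
have dE (x : R) : ('X * c%:P)^`().[x] = c.
  by rewrite derivM derivX derivC mulr0 addr0 mul1r hornerC.
exists G, (fun sig r f => ('X * c%:P)^`().[cyls_eval F sig] * U sig r f).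
have EE : energy mu (fun sig r f => ('X * c%:P)^`().[cyls_eval F sig] * U sig r f) =
    ((c ^+ 2) * E_ U)%:E.
  rewrite energy_mul//; under eq_integral do rewrite dE.
  rewrite ge0_integralZl_EFin ?sqr_ge0//.
  - by rewrite [in RHS]EFinM -(energy_fin hU fU).
  - by move=> sig _; apply: Hnorm2_ge0; exact: (Hsection_mtD _ hU).
  - exact: Hnorm2_measurable hU.
split; [|exact: cG|by rewrite EE ltry|by rewrite EE].
by move=> sig; rewrite eG hornerM hornerX hornerC mulrC.
Qed.

(** The densities on the right of [energy_dtrunc] telescope. *)
Lemma energy_levels F U (l a lam : R) K : 0 <= l <= 1 ->
  fall k 2^-1 @[k --> \oo] --> l ->
  cyl_gradient mu par F U -> (energy mu U < +oo)%E -> 0 < lam ->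
  \sum_(k < K) E_ (fun sig r f => dtrunc l (a + lam * 2 ^+ k) (a + lam * 2 ^+ k.+1)
      (cyls_eval F sig) * U sig r f) <= E_ U.
Proof.
move=> l01 hl cF fU lam0; have [sF hU _] := cF.
pose t k := a + lam * 2 ^+ k.
have tS k : t k <= t k.+1.
  rewrite /t lerD2l exprS mulrCA ler_peMl ?ler1n// mulr_ge0 ?exprn_ge0// ltW//.
have mF := @cyls_eval_measurable _ _ _ _ x0 _ sF.
have md k : measurable_fun setT (fun sig : Om => dtrunc l (t k) (t k.+1) (cyls_eval F sig)).
  exact: (measurableT_comp (dtrunc_measurable l _ _) mF).
have mN := Hnorm2_measurable hU.
have N0 sig : (0 <= N2 (U sig))%E by apply: Hnorm2_ge0; exact: (Hsection_mtD _ hU).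
have D0 k sig : (0 <= (dtrunc l (t k) (t k.+1) (cyls_eval F sig))%:E * N2 (U sig))%E.
  rewrite mule_ge0// lee_fin.
  by have /andP[] := dtrunc01 l01 (cyls_eval F sig) (tS k).
have mD k : measurable_fun setT (fun sig : Om =>
    (dtrunc l (t k) (t k.+1) (cyls_eval F sig))%:E * N2 (U sig))%E.
  by apply: emeasurable_funM => //; exact/measurable_EFinP.
have fin k : energy mu (fun sig r f => dtrunc l (t k) (t k.+1) (cyls_eval F sig) * U sig r f)
    = (E_ (fun sig r f => dtrunc l (t k) (t k.+1) (cyls_eval F sig) * U sig r f))%:E.
  have [_ _ hV fV _] := D12_trunc hpar l01 hl cF fU (tS k).
  exact: energy_fin.
rewrite -lee_fin -(energy_fin hU fU) -sumEFin.
apply: (@le_trans _ _ (\sum_(k < K) \int[mu]_sig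
    ((dtrunc l (t k) (t k.+1) (cyls_eval F sig))%:E * N2 (U sig)))%E).
  apply: lee_sum => k _; rewrite -fin.
  exact: (energy_dtrunc l01 cF (tS k)).
rewrite -ge0_integral_sum//; apply: ge0_le_integral => //.
- by move=> sig _; apply: sume_ge0 => k _.
- exact: emeasurable_sum.
move=> sig _.
have -> : (\sum_(k < K) ((dtrunc l (t k) (t k.+1) (cyls_eval F sig))%:E * N2 (U sig)) =
    (\sum_(k < K) dtrunc l (t k) (t k.+1) (cyls_eval F sig))%:E * N2 (U sig))%E.
  rewrite -sumEFin ge0_sume_distrl// => k _; rewrite lee_fin.
  by have /andP[] := dtrunc01 l01 (cyls_eval F sig) (tS k).
rewrite -[X in (_ <= X)%E]mul1e lee_wpmul2r// lee_fin.
have -> : \sum_(k < K) dtrunc l (t k) (t k.+1) (cyls_eval F sig) =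
    step l (t K) (cyls_eval F sig) - step l (t 0%N) (cyls_eval F sig).
  elim: (K) => [|K' IH]; first by rewrite big_ord0 subrr.
  by rewrite big_ord_recr /= IH /dtrunc; ring.
have /andP[_ h1] := step01 l01 (t K) (cyls_eval F sig).
by have /andP[h2 _] := step01 l01 (t 0%N) (cyls_eval F sig); lra.
Qed.

Lemma tail_bound F U a : cyl_gradient mu par F U -> (energy mu U < +oo)%E ->
  0 <= a -> mean mu (above (fun sig : Om => cyls_eval F sig) a) <= 3 / 4 ->
  mean mu (fun sig : Om => Num.max (cyls_eval F sig - a) 0 ^+ 2) <= al0 * E_ U.
Proof.
move=> cF fU a0 H34; have [l l01 hl] := @fall_half R.
have D b c : b <= c -> D12_gradient mu par (fun sig => trunc b c (cyls_eval F sig))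
    (fun sig r f => dtrunc l b c (cyls_eval F sig) * U sig r f).
  exact: D12_trunc.
apply: (@weighted_tail _ _ _ mu r0 C r0_gt0 C_gt0 _ (cyl_bmeas cF) (fun b c =>
  E_ (fun sig r f => dtrunc l b c (cyls_eval F sig) * U sig r f))) => //.
- by move=> b c _ /ltW/D[_ _ hV _ _]; exact: E_ge0.
- move=> b c s b0 bc s0 sr m0; apply: wlsi_real => //; first exact/D/ltW.
  move=> sig; have [/andP[h0 h1] _ _ _] := trunc_clamp (cyls_eval F sig) b0 bc.
  by rewrite ger0_norm.
- by move=> lam K lam0; exact: energy_levels.
Qed.

Lemma two_sided_bound F U a : cyl_gradient mu par F U -> (energy mu U < +oo)%E ->
  0 <= a -> mean mu (above (fun sig : Om => cyls_eval F sig) a) <= 3 / 4 ->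
  mean mu (above (fun sig : Om => - cyls_eval F sig) a) <= 3 / 4 ->
  mean mu (fun sig : Om => cyls_eval F sig ^+ 2) <= 4 * al0 * E_ U + 2 * a ^+ 2.
Proof.
move=> cF fU a0 H1 H2.
have [G [W [eG cG fW EW]]] := cyl_gradient_scale (-1) cF fU.
have eN : (fun sig : Om => cyls_eval G sig) = (fun sig => - cyls_eval F sig).
  by apply/funext => sig; rewrite eG mulN1r.
have B1 := tail_bound cF fU a0 H1.
rewrite -eN in H2; have B2 := tail_bound cG fW a0 H2.
rewrite EW sqrrN expr1n mul1r in B2.
have bF := cyl_bmeas cF; have bG := cyl_bmeas cG.
have bm (h : Om -> R) : bmeas h -> bmeas (fun x => Num.max (h x - a) 0 ^+ 2).
  move=> [mh [B hB]]; apply: bmeasX2; split.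
    by apply: measurable_maxr; [apply: measurable_funB => //|]; exact: measurable_cst.
  exists (B + a) => x; rewrite ger0_norm ?le_max ?lexx ?orbT//.
  have := hB x; rewrite ler_norml => /andP[? ?].
  by rewrite ge_max; apply/andP; split; have := normr_ge0 (h x); have := hB x; lra.
have b1 := bm _ bF; have b2 := bm _ bG.
apply: (@le_trans _ _ (mean mu (fun sig : Om =>
   2 * (Num.max (cyls_eval F sig - a) 0 ^+ 2 + Num.max (cyls_eval G sig - a) 0 ^+ 2)
     + 2 * a ^+ 2))).
  apply: mean_le; first exact: bmeasX2.
    by apply: bmeasD; [apply: bmeasZ; exact: bmeasD|exact: bmeas_cst].
  move=> sig; rewrite eG mulN1r; set x := cyls_eval F sig.
  have [xa|ax] := leP (x - a) 0; have [xa'|ax'] := leP (- x - a) 0.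
  - rewrite expr0n addr0 mulr0 add0r -[x ^+ 2]real_normK ?num_real//.
    have : `|x| ^+ 2 <= a ^+ 2.
      by rewrite lerXn2r ?nnegrE// ler_norml; apply/andP; split; lra.
    by have := sqr_ge0 a; lra.
  - by rewrite expr0n add0r; have := sqr_ge0 (x + 2 * a); lra.
  - by rewrite expr0n addr0; have := sqr_ge0 (x - 2 * a); lra.
  - by lra.
rewrite meanD ?mean_cst; [|by apply: bmeasZ; exact: bmeasD|exact: bmeas_cst].
by rewrite meanZ ?meanD//; [lra|exact: bmeasD].
Qed.

(** A term of the sequence in the definition of the domain; the factor [2] for
    the energy avoids a discussion of the convergence of norms. *)
Lemma D12_approx f V e : D12_gradient mu par f V -> 0 < e ->
  exists G W, [/\ cyl_gradient mu par G W, (energy mu W < +oo)%E,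
    (\int[mu]_sig ((cyls_eval G sig - f sig) ^+ 2)%:E <= e%:E)%E &
    E_ W <= 2 * E_ V + e].
Proof.
have arith (y t : R) : y <= t / 2 -> forall x, 2 * x + 2 * y <= 2 * x + t.
  by move=> yt x; lra.
move=> [mf f2 hV fV [F [U [cF cvF cvU]]]] e0.
have e2 : 0 < e / 2 by rewrite divr_gt0.
have /fine_cvgP[finF /cvgrPdist_le/(_ _ e0) HF] := cvF.
have /fine_cvgP[finU /cvgrPdist_le/(_ _ e2) HU] := cvU.
have [k [[h1 h2] [h3 h4]]] := filter_ex (filterI (filterI finF HF) (filterI finU HU)).
have [sk hU HUk] := cF k.
pose Dk := fun sig r f => U k sig r f - V sig r f.
have hD : Hsection mu Dk.
  have := Hsection_comb (measurable_cst (1 : R)) (measurable_cst (-1 : R)) hU hV.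
  by under eq_fun do under eq_fun do under eq_fun do rewrite mul1r mulN1r.
have UE : U k = (fun sig r f => 1 * V sig r f + 1 * Dk sig r f).
  apply/funext => sig; apply/funext => r; apply/funext => g.
  by rewrite /Dk !mul1r addrC subrK.
have := energy_comb_le 1 1 hV hD; rewrite -UE.
rewrite (energy_fin hV fV) -[energy mu Dk]fineK// -!EFinM -EFinD => H.
have fU : (energy mu (U k) < +oo)%E by rewrite (le_lt_trans H)// ltry.
exists (F k), (U k); split => //.
  rewrite -[leLHS]fineK// lee_fin; move: h2; rewrite sub0r normrN.
  exact: le_trans (ler_norm _).
rewrite (energy_fin hU fU) lee_fin in H; apply: (le_trans H).
move: h4; rewrite sub0r normrN => /(le_trans (ler_norm _)).
by rewrite -/Dk expr1n mulr1 => /arith; exact.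
Qed.

(** The constant [1] belongs to the domain, with gradient zero, exactly when this
    holds for all positive [e]. *)
Definition near_one (e : R) : Prop := exists u W,
  [/\ cyl_gradient mu par u W, (energy mu W < +oo)%E,
      mean mu (fun sig : Om => (cyls_eval u sig - 1) ^+ 2) <= e & E_ W <= e].

Lemma al0_ge0 : 0 <= al0.
Proof. by rewrite mulr_ge0// ltW// level_cst_gt0. Qed.

(** The weak inequality bounds the entropy of [f^2], where [f] is the truncation
    of [G] between [0] and [1], so [f] is close to a constant by [entropy_L2].
    The constant is close to [1], as [f] is [1] with probability at least
    [1/2]. *)
Lemma near_one_truncation G W s e : cyl_gradient mu par G W -> (energy mu W < +oo)%E ->
  mean mu (above (fun sig : Om => - cyls_eval G sig) (-1)) <= 1 / 2 ->
  0 < s -> s < r0 -> s < 1 -> 0 < e ->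
  exists u W', [/\ cyl_gradient mu par u W', (energy mu W' < +oo)%E,
    mean mu (fun sig : Om => (cyls_eval u sig - 1) ^+ 2) <=
      12 * (C * ln (1 / s) * E_ W + s) + 2 * e & E_ W' <= 2 * E_ W + e].
Proof.
have arith1 (x y z : R) : x <= z -> y <= 2 * z -> 2 * x + 2 * y <= 6 * z by lra.
have arith2 (x y z t r : R) : x <= t -> y <= 6 * z -> z <= r ->
  2 * x + 2 * y <= 12 * r + 2 * t by lra.
have arith3 (x y z t : R) : y * (1 / 2) <= y * z -> y * z <= x -> x <= t -> y <= 2 * t.
  by lra.
have arith4 (x y t : R) : x <= y -> 2 * x + t <= 2 * y + t by lra.
have arith5 (x : R) : x <= 1 / 2 -> 1 / 2 <= 1 - x by lra.
have arith6 (x : R) : 1 / 2 <= x -> 0 < x by lra.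
have sq2 (x y : R) : (x + y) ^+ 2 <= 2 * x ^+ 2 + 2 * y ^+ 2.
  by have := sqr_ge0 (x - y); lra.
move=> cG fW HG s0 sr s1 e0; have [l l01 hl] := @fall_half R.
have [sG hW _] := cG.
pose f (sig : Om) := trunc 0 1 (cyls_eval G sig).
have hf : D12_gradient mu par f
    (fun sig r g => dtrunc l 0 1 (cyls_eval G sig) * W sig r g).
  exact: (D12_trunc hpar l01 hl cG fW ler01).
set V := (fun sig r g => _) in hf.
have EV : E_ V <= E_ W.
  have := energy_levels (-1) 1 l01 hl cG fW ltr01.
  by rewrite big_ord1 expr0 expr1 !mul1r addNr (_ : -1 + 2 = 1 :> R)//; lra.
have f01 sig : 0 <= f sig <= 1.
  by have [h _ _ _] := trunc_clamp (cyls_eval G sig) (lexx 0) (@ltr01 R); rewrite subr0 in h.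
have f1 sig : 1 <= cyls_eval G sig -> f sig = 1.
  move=> h; have [_ _ h3 _] := trunc_clamp (cyls_eval G sig) (lexx 0) (@ltr01 R).
  by rewrite /f h3// subr0.
have mf : measurable_fun setT f by case: hf.
have bf : bmeas f.
  split=> //; exists 1 => sig; have /andP[h0 h1] := f01 sig; by rewrite ger0_norm.
set a := above (fun sig : Om => - cyls_eval G sig) (-1) in HG.
have ba : bmeas a.
  by apply: bmeas_above; have [] := bmeasN (cyl_bmeas cG).
have f2a sig : 1 - a sig <= f sig ^+ 2.
  rewrite /a /above ltrN2; have [h|h] := ltP (cyls_eval G sig) 1.
    by rewrite subrr sqr_ge0.
  by rewrite f1// subr0 expr1n.
have bf2 := bmeasX2 bf.
set m2 := mean mu (fun x => f x ^+ 2).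
have b1a : bmeas (fun x => 1 - a x) by apply: bmeasB => //; exact: bmeas_cst.
have m1a : 1 / 2 <= mean mu (fun x => 1 - a x).
  by rewrite meanB ?mean_cst//; [exact: arith5|exact: bmeas_cst].
have m2_ge : 1 / 2 <= m2 by rewrite (le_trans m1a)// mean_le.
have m2_gt0 : 0 < m2 := arith6 _ m2_ge.
have m2_le1 : m2 <= 1.
  rewrite -[leRHS](mean_cst mu 1); apply: mean_le => //; first exact: bmeas_cst.
  by move=> x; rewrite expr_le1//; have /andP[] := f01 x.
have LS := wlsi_real hf (B := 1) (s := s) _ s0 sr m2_gt0.
have {}LS : mean mu (ent_density mu (fun x => f x ^+ 2)) <= C * ln (1 / s) * E_ V + s * 1 ^+ 2.
  by apply: LS => sig; have /andP[h0 h1] := f01 sig; rewrite ger0_norm.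
have ls0 : 0 <= ln (1 / s).
  by rewrite div1r lnV ?posrE// oppr_ge0 ln_le0// ltW.
set Ent := mean mu (ent_density _ _) in LS.
have LE : Ent <= C * ln (1 / s) * E_ W + s.
  rewrite (le_trans LS)// expr1n mulr1 lerD2r ler_wpM2l// mulr_ge0//.
  exact: ltW.
have H2 := entropy_L2 bf (fun x => proj1 (andP (f01 x))) m2_gt0.
rewrite -/m2 -/Ent in H2; set c := Num.sqrt m2 in H2.
have bc : bmeas (fun x => (f x - c) ^+ 2).
  by apply: bmeasX2; apply: bmeasB => //; exact: bmeas_cst.
have Hc : (1 - c) ^+ 2 <= 2 * Ent.
  apply: (arith3 _ _ (mean mu (fun x => 1 - a x)) _ _ _ H2).
    by rewrite ler_wpM2l// sqr_ge0.
  rewrite -meanZ//; apply: mean_le => //; first exact: bmeasZ.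
  move=> x; rewrite /a /above ltrN2; have [h|h] := ltP (cyls_eval G x) 1.
    by rewrite subrr mulr0 sqr_ge0.
  by rewrite f1// subr0 mulr1.
have Hf : mean mu (fun x => (f x - 1) ^+ 2) <= 6 * Ent.
  apply: (@le_trans _ _ (mean mu (fun x => 2 * (f x - c) ^+ 2 + 2 * (1 - c) ^+ 2))).
    apply: mean_le => //.
    - by apply: bmeasX2; apply: bmeasB => //; exact: bmeas_cst.
    - by apply: bmeasD; [exact: bmeasZ|exact: bmeas_cst].
    - by move=> x; rewrite -[(1 - c) ^+ 2]sqrrN opprB -[f x - 1](subrKA c) sq2.
  rewrite meanD; [|exact: bmeasZ|exact: bmeas_cst].
  by rewrite meanZ ?mean_cst//; exact: arith1 H2 Hc.
have [u [W' [cu fW' uf EW']]] := D12_approx hf e0.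
exists u, W'; split; [exact: cu|exact: fW'| |exact: le_trans EW' (arith4 _ _ _ EV)].
have bu := cyl_bmeas cu.
have buf : bmeas (fun x => (cyls_eval u x - f x) ^+ 2).
  by apply: bmeasX2; exact: bmeasB.
rewrite meanE// lee_fin in uf.
have b1 : bmeas (fun x => (f x - 1) ^+ 2).
  by apply: bmeasX2; apply: bmeasB => //; exact: bmeas_cst.
apply: (@le_trans _ _ (mean mu (fun x : Om => 2 * (cyls_eval u x - f x) ^+ 2 + 2 * (f x - 1) ^+ 2))).
  apply: mean_le => //.
  - by apply: bmeasX2; apply: bmeasB => //; exact: bmeas_cst.
  - by apply: bmeasD; exact: bmeasZ.
  - by move=> x; rewrite -[cyls_eval u x - 1](subrKA (f x)) sq2.
rewrite meanD; [|exact: bmeasZ|exact: bmeasZ].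
by rewrite !meanZ//; exact: arith2 uf Hf LE.
Qed.

(** Otherwise [near_one_truncation] for [2 F / m] would produce a function that
    contradicts the hypothesis. *)
Lemma median_energy e : 0 < e -> ~ near_one e -> exists2 eta, 0 < eta &
  forall F U m, cyl_gradient mu par F U -> (energy mu U < +oo)%E -> 0 < m ->
    median_of mu (fun sig : Om => cyls_eval F sig) m -> eta * m ^+ 2 <= E_ U.
Proof.
have arith1 (x y t : R) : x <= 4 * t -> t <= y / 100 -> 0 < y -> 2 * x + y / 8 <= y by lra.
have arith2 (x y z t u : R) : u <= 12 * (x + z) + 2 * (y / 8) -> x <= 4 * t ->
  t <= y / 100 -> z <= y / 100 -> 0 < y -> u <= y by lra.
have arith3 (x y : R) : - y + y / 2 < - x = (2 * x < y) by apply/idP/idP; lra.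
have arith4 (x y z : R) : x < y * z -> 2 ^+ 2 * x <= 4 * y * z by lra.
move=> e0 He; pose s := Num.min (r0 / 2) (Num.min (e / 100) (1 / 2)).
have s0 : 0 < s by rewrite !lt_min !divr_gt0.
have sr : s < r0.
  by rewrite /s gt_min; apply/orP; left; have := r0_gt0; lra.
have se : s <= e / 100 by rewrite /s !ge_min lexx !orbT.
have s2 : s <= 1 / 2 by rewrite /s !ge_min lexx !orbT.
have s1 : s < 1 by lra.
have L0 : 0 <= C * ln (1 / s).
  rewrite mulr_ge0 ?(ltW C_gt0)// div1r lnV ?posrE// oppr_ge0 ln_le0//; exact: ltW.
set L := C * ln (1 / s) in L0; pose eta := e / 100 / (L + 1).
have eta0 : 0 < eta by rewrite divr_gt0 ?divr_gt0// ltr_wpDl.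
have etaL : L * eta + eta = e / 100.
  by rewrite /eta -[X in _ + X]mul1r -mulrDl mulrC divfK// gt_eqF// ltr_wpDl.
have etaL0 : 0 <= L * eta by rewrite mulr_ge0// ltW.
exists eta => // F U m cF fU m0 med; rewrite leNgt; apply/negP => EU.
have [G [W [eG cG fW EW]]] := cyl_gradient_scale (2 / m) cF fU.
have {}EW : E_ W <= 4 * eta.
  by rewrite EW expr_div_n mulrAC ler_pdivrMr ?exprn_gt0//; exact: arith4.
have HG : mean mu (above (fun sig : Om => - cyls_eval G sig) (-1)) <= 1 / 2.
  have m2 : 0 < m / 2 by rewrite divr_gt0.
  have [_] := med _ m2; apply: le_trans.
  have bG := bmeasN (cyl_bmeas cG); have bF := bmeasN (cyl_bmeas cF).
  apply: mean_le.
    by apply: bmeas_above; case: bG.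
    by apply: bmeas_above; case: bF.
  move=> sig; rewrite /above eG ltrN2 mulrAC ltr_pdivrMr// mul1r.
  by rewrite arith3.
have e8 : 0 < e / 8 by rewrite divr_gt0.
have [u [W' [cu fW' Hu HW']]] := near_one_truncation cG fW HG s0 sr s1 e8.
have etae : eta <= e / 100 by rewrite -etaL lerDr.
have Leta : L * eta <= e / 100 by rewrite -etaL lerDl ltW.
have LW : L * E_ W <= 4 * (L * eta) by rewrite mulrCA ler_wpM2l.
apply: He; exists u, W'; split; [exact: cu|exact: fW'| |].
- exact: arith2 Hu LW Leta se e0.
- exact: (le_trans HW' (arith1 _ _ _ EW etae e0)).
Qed.

(** The function [F - m u] exceeds [del] only if [F] exceeds [m + del / 2] or
    [m (u - 1)] is at least [del / 2] in absolute value; the second event has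
    probability at most [1/4] by the choice of [u], so that [two_sided_bound]
    applies with the level [del]. *)
Lemma poincare_near_one F U m : (forall e, 0 < e -> near_one e) ->
  cyl_gradient mu par F U -> (energy mu U < +oo)%E ->
  median_of mu (fun sig : Om => cyls_eval F sig) m ->
  mean mu (fun sig : Om => (cyls_eval F sig - m) ^+ 2) <= 16 * al0 * E_ U.
Proof.
have arith1 (a d t : R) : 0 < d -> 4 / d * t <= 1 / 4 ->  a <= 1 / 2 -> a + 4 / d * t <= 3 / 4.
  by lra.
have arith2 (a E t d g h : R) : g <= 4 * a * (2 * E + 2 * t) + 2 * d -> h <= t ->
  16 * t + 16 * (a * t) <= d -> 0 <= t -> 0 <= a * t -> 2 * g + 2 * h <= 16 * a * E + 6 * d.
  by lra.
have sq2 (x y : R) : (x + y) ^+ 2 <= 2 * x ^+ 2 + 2 * y ^+ 2.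
  by have := sqr_ge0 (x - y); lra.
have arith3 (x y d : R) : x <= y -> 16 * y <= d -> 4 * x <= 1 / 4 * d by lra.
have arith4 (a k t : R) : 0 <= a * t -> 0 <= t ->
  16 * (k * t) + 16 * (a * (k * t)) <= 16 * (1 + a) * (1 + k) * t by lra.
have arith5 (x y d : R) : 0 < d -> d < x -> y <= d / 2 -> d ^+ 2 <= 4 * (x - y) ^+ 2.
  move=> d0 dx yd; have -> : 4 * (x - y) ^+ 2 = (2 * (x - y)) ^+ 2 by ring.
  by rewrite lerXn2r ?nnegrE//; [exact: ltW|lra|lra].
move=> H1 cF fU med; apply/ler_addgt0Pr => e' e'0.
pose del := Num.sqrt (e' / 6); have del0 : 0 < del by rewrite sqrtr_gt0 divr_gt0.
have del2 : del ^+ 2 = e' / 6 by rewrite sqr_sqrtr// ltW// divr_gt0.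
have A0 := al0_ge0.
have K0 : 0 < 16 * (1 + al0) * (1 + m ^+ 2).
  by rewrite mulr_gt0// ?mulr_gt0// ltr_pwDl// sqr_ge0.
pose e := del ^+ 2 / (16 * (1 + al0) * (1 + m ^+ 2)).
have e0 : 0 < e by rewrite divr_gt0// exprn_gt0.
have eK : 16 * (1 + al0) * (1 + m ^+ 2) * e = del ^+ 2.
  by rewrite /e mulrC divfK// gt_eqF.
have [u [W [cu fW Hu EW]]] := H1 e e0.
have m2 : 0 <= m ^+ 2 := sqr_ge0 m.
have me0 : 0 <= m ^+ 2 * e by rewrite mulr_ge0// ltW.
have ame0 : 0 <= al0 * (m ^+ 2 * e) by rewrite mulr_ge0.
have ae0 : 0 <= al0 * e by rewrite mulr_ge0// ltW.
have eK' : 16 * (m ^+ 2 * e) + 16 * (al0 * (m ^+ 2 * e)) <= del ^+ 2.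
  by rewrite -eK; apply: arith4 => //; exact: ltW.
have cG := cyl_gradient_comb hpar (- m) cF cu.
set G := _ ++ _ in cG; set V := (fun sig r f => _) in cG.
have [_ hU _] := cF; have [_ hW _] := cu; have [_ hV _] := cG.
have EV : (energy mu V <= (2 * E_ U + 2 * (m ^+ 2 * e))%:E)%E.
  apply: (le_trans (energy_comb_le 1 (- m) hU hW)).
  rewrite (energy_fin hU fU) (energy_fin hW fW) -!EFinM -EFinD lee_fin.
  rewrite expr1n mulr1 lerD2l sqrrN -mulrA ler_wpM2l// ler_wpM2l//.
have fV : (energy mu V < +oo)%E by rewrite (le_lt_trans EV)// ltry.
rewrite (energy_fin hV fV) lee_fin in EV.
have eG (sig : Om) : cyls_eval G sig = cyls_eval F sig - m * cyls_eval u sig.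
  by rewrite /G cyls_eval_cat cyls_eval_scale mulNr.
have bF := cyl_bmeas cF; have bu := cyl_bmeas cu; have bG := cyl_bmeas cG.
have bu1 : bmeas (fun sig : Om => (cyls_eval u sig - 1) ^+ 2).
  by apply: bmeasX2; apply: bmeasB => //; exact: bmeas_cst.
have muu : m ^+ 2 * mean mu (fun sig : Om => (cyls_eval u sig - 1) ^+ 2) <= m ^+ 2 * e.
  by rewrite ler_wpM2l.
have m16 : 16 * (m ^+ 2 * e) <= del ^+ 2.
  by apply: le_trans eK'; rewrite lerDl mulr_ge0.
have abv (g h : Om -> R) : bmeas g -> bmeas h ->
   mean mu (above g (del / 2)) <= 1 / 2 ->
   (forall sig, (h sig - g sig) ^+ 2 = m ^+ 2 * (cyls_eval u sig - 1) ^+ 2) ->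
   mean mu (above h del) <= 3 / 4.
  move=> bg bh Hg Hgh.
  apply: (@le_trans _ _ (mean mu (fun sig => above g (del / 2) sig +
      4 / del ^+ 2 * (m ^+ 2 * (cyls_eval u sig - 1) ^+ 2)))).
    apply: mean_le.
    - by apply: bmeas_above; case: bh.
    - apply: bmeasD; first by apply: bmeas_above; case: bg.
      by apply: bmeasZ; exact: bmeasZ.
    move=> sig; rewrite -Hgh /above; have [hh|hh] := ltP del (h sig); last first.
      by rewrite mulr0n addr_ge0// mulr_ge0 ?sqr_ge0// divr_ge0// sqr_ge0.
    have [gg|gg] := ltP (del / 2) (g sig).
      by rewrite mulr1n lerDl mulr_ge0 ?sqr_ge0// divr_ge0// sqr_ge0.
    rewrite mulr0n mulr1n add0r mulrAC ler_pdivlMr ?exprn_gt0// mul1r.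
    exact: arith5 del0 hh gg.
  rewrite meanD; [|by apply: bmeas_above; case: bg|by apply: bmeasZ; exact: bmeasZ].
  rewrite !meanZ//; last exact: bmeasZ.
  apply: (arith1 _ _ _ (exprn_gt0 2 del0)) => //.
  rewrite mulrAC ler_pdivrMr ?exprn_gt0//.
  exact: (arith3 _ _ _ muu m16).
have d2 : 0 < del / 2 by rewrite divr_gt0.
have bm : bmeas (fun _ : Om => m) by exact: bmeas_cst.
have A1 : mean mu (above (fun sig : Om => cyls_eval G sig) del) <= 3 / 4.
  apply: (abv (fun sig => cyls_eval F sig - m)) => //; first exact: bmeasB.
    have [+ _] := med _ d2; congr (_ <= _); congr mean; apply/funext => sig.
    by rewrite /above ltrBrDl.
  by move=> sig; rewrite eG; ring.
have A2 : mean mu (above (fun sig : Om => - cyls_eval G sig) del) <= 3 / 4.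
  apply: (abv (fun sig => m - cyls_eval F sig)) => //; first exact: bmeasB.
  - exact: bmeasN.
  - have [_] := med _ d2; congr (_ <= _); congr mean; apply/funext => sig.
    by rewrite /above -ltrBrDl opprK addrC.
  by move=> sig; rewrite eG; ring.
have := two_sided_bound cG fV (ltW del0) A1 A2.
set mG := mean mu _ => HG.
have HG' : mG <= 4 * al0 * (2 * E_ U + 2 * (m ^+ 2 * e)) + 2 * del ^+ 2.
  by rewrite (le_trans HG)// lerD2r ler_wpM2l// mulr_ge0.
apply: (@le_trans _ _ (mean mu (fun sig : Om => 2 * cyls_eval G sig ^+ 2 +
    2 * (m ^+ 2 * (cyls_eval u sig - 1) ^+ 2)))).
  apply: mean_le.
  - by apply: bmeasX2; exact: bmeasB.
  - by apply: bmeasD; apply: bmeasZ; [exact: bmeasX2|exact: bmeasZ].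
  - move=> sig; rewrite -exprMn (le_trans _ (sq2 _ _))// eG.
    by rewrite mulrBr mulr1 addrA subrK.
rewrite meanD; [|by apply: bmeasZ; exact: bmeasX2|by apply: bmeasZ; exact: bmeasZ].
rewrite !meanZ//; [|exact: bmeasZ|exact: bmeasX2].
have -> : e' = 6 * del ^+ 2 by rewrite del2 mulrC divfK.
exact: arith2 HG' muu eK' me0 ame0.
Qed.

(** Here [m^2] is bounded by the energy, so [two_sided_bound] may be used at
    levels next to [|m|], without subtraction of a constant. *)
Lemma poincare_far eta F U : 0 < eta ->
  (forall F U m, cyl_gradient mu par F U -> (energy mu U < +oo)%E -> 0 < m ->
    median_of mu (fun sig : Om => cyls_eval F sig) m -> eta * m ^+ 2 <= E_ U) ->
  cyl_gradient mu par F U -> (energy mu U < +oo)%E ->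
  mean mu (fun sig : Om => cyls_eval F sig ^+ 2) <= (4 * al0 + 8 / eta) * E_ U.
Proof.
have arith (x k d e q g : R) : d ^+ 2 = e / 4 -> x ^+ 2 <= q ->
    g <= k + 2 * (x + d) ^+ 2 -> g <= k + 8 * q + e.
  by have := sqr_ge0 (x - d); have := sqr_ge0 x; lra.
move=> eta0 Heta cF fU.
have bF := cyl_bmeas cF; have [m med] := median mu bF.
have Hm : eta * m ^+ 2 <= E_ U.
  have [m0|m0|->] := ltgtP m 0; last 1 first.
  - by rewrite expr0n mulr0 E_ge0//; case: cF.
  - have [G [W [eG cG fW EW]]] := cyl_gradient_scale (-1) cF fU.
    have eN : @cyls_eval _ _ _ T x0 G = (fun sig => - cyls_eval F sig).
      by apply/funext => sig; rewrite eG mulN1r.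
    have eNN : (fun sig : Om => - cyls_eval G sig) = (fun sig => cyls_eval F sig).
      by rewrite eN; apply/funext => sig; rewrite opprK.
    rewrite -sqrrN -[E_ U]mul1r -[X in _ <= X * _](expr1n _ 2) -(sqrrN 1) -EW.
    apply: Heta cG fW _ _; first by rewrite oppr_gt0.
    by move=> e e0; have [h1 h2] := med e e0; rewrite eNN eN opprK.
  - exact: Heta cF fU m0 med.
apply/ler_addgt0Pr => e e0; pose del := Num.sqrt (e / 4).
have del0 : 0 < del by rewrite sqrtr_gt0 divr_gt0.
have del2 : del ^+ 2 = e / 4 by rewrite sqr_sqrtr// ltW// divr_gt0.
have [h1 h2] := med _ del0.
have a0 : 0 <= `|m| + del by rewrite addr_ge0// ltW.
have H1 : mean mu (above (fun sig : Om => cyls_eval F sig) (`|m| + del)) <= 3 / 4.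
  apply: (@le_trans _ _ (1 / 2)); last by lra.
  apply: le_trans h1; have [mF _] := bF.
  apply: mean_le; [exact: bmeas_above|exact: bmeas_above|move=> sig].
  rewrite /above ler_nat; have := ler_norm m.
  by case: ltP => // ? ?; have -> : m + del < cyls_eval F sig by lra.
have H2 : mean mu (above (fun sig : Om => - cyls_eval F sig) (`|m| + del)) <= 3 / 4.
  apply: (@le_trans _ _ (1 / 2)); last by lra.
  apply: le_trans h2; have [mF _] := bmeasN bF.
  apply: mean_le; [exact: bmeas_above|exact: bmeas_above|move=> sig].
  rewrite /above ler_nat; have := ler_norm (- m); rewrite normrN.
  by case: ltP => // ? ?; have -> : - m + del < - cyls_eval F sig by lra.
have := two_sided_bound cF fU a0 H1 H2.
have -> : (4 * al0 + 8 / eta) * E_ U = 4 * al0 * E_ U + 8 * (E_ U / eta).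
  by rewrite mulrDl; congr (_ + _); rewrite mulrAC mulrA.
apply: arith del2 _; rewrite real_normK ?num_real//.
by rewrite ler_pdivlMr// mulrC.
Qed.

Lemma poincare_cylinder : exists2 al, 0 < al & forall F U, cyl_gradient mu par F U ->
  (energy mu U < +oo)%E -> exists c,
  mean mu (fun sig : Om => (cyls_eval F sig - c) ^+ 2) <= al * E_ U.
Proof.
have L0 : 0 < al0 by rewrite mulr_gt0// level_cst_gt0.
have [H1|/existsNP[e /not_implyP[e0 He]]] := pselect (forall e, 0 < e -> near_one e).
  exists (16 * al0); first by rewrite mulr_gt0.
  move=> F U cF fU; have [m med] := median mu (cyl_bmeas cF).
  by exists m; exact: poincare_near_one.
have [eta eta0 Heta] := median_energy e0 He.
exists (4 * al0 + 8 / eta); first by rewrite addr_gt0 ?divr_gt0// mulr_gt0.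
move=> F U cF fU; exists 0; under [X in mean _ X]eq_fun do rewrite subr0.
exact: (poincare_far eta0 Heta).
Qed.

(** Cylindrical functions are dense for the graph norm, and the variance is the
    least mean square distance to a constant. *)
Lemma poincare_D12 : exists2 al, 0 < al & forall f V, D12_gradient mu par f V ->
  ('V_mu[f] <= al%:E * energy mu V)%E.
Proof.
have arith (a x y E t : R) : 0 <= a -> y <= a * x -> x <= 2 * E + t ->
    2 * t + 2 * y <= 4 * a * E + (2 + 2 * a) * t.
  by move=> a0 yx /(ler_wpM2l a0); lra.
have [al al0 Hal] := poincare_cylinder.
exists (4 * al); first by rewrite mulr_gt0.
move=> f V hf; have [mf f2 hV fV _] := hf; rewrite (energy_fin hV fV) -EFinM.
apply/lee_addgt0Pr => e e0; pose e' := e / (2 + 2 * al).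
have K0 : 0 < 2 + 2 * al by rewrite addr_gt0// mulr_gt0.
have e'0 : 0 < e' by rewrite divr_gt0.
have eK : (2 + 2 * al) * e' = e by rewrite mulrC divfK// gt_eqF.
have [G [W [cG fW Gf EW]]] := D12_approx hf e'0.
have [c Hc] := Hal _ _ cG fW.
apply: (le_trans (variance_le_shift c mf f2)).
have bG := cyl_bmeas cG; have [mG _] := bG.
have bGc : bmeas (fun sig : Om => (cyls_eval G sig - c) ^+ 2).
  by apply: bmeasX2; apply: bmeasB => //; exact: bmeas_cst.
have m1 : measurable_fun setT (fun sig : Om => ((cyls_eval G sig - f sig) ^+ 2)%:E).
  by apply/measurable_EFinP; apply: measurable_funX; exact: measurable_funB.
have m2 : measurable_fun setT (fun sig : Om => ((cyls_eval G sig - c) ^+ 2)%:E).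
  by apply/measurable_EFinP; case: bGc.
apply: (@le_trans _ _ (\int[mu]_sig (2%:E * ((cyls_eval G sig - f sig) ^+ 2)%:E +
    2%:E * ((cyls_eval G sig - c) ^+ 2)%:E))%E).
  apply: ge0_le_integral => //.
  - by move=> sig _; rewrite lee_fin sqr_ge0.
  - apply/measurable_EFinP; apply: measurable_funX.
    exact: (measurable_funB mf (measurable_cst c)).
  - by apply: emeasurable_funD; exact: measurable_funeM.
  - move=> sig _; rewrite -!EFinM -EFinD lee_fin.
    by have := sqr_ge0 (cyls_eval G sig - f sig + (cyls_eval G sig - c)); lra.
have p1 (h : Om -> R) : forall sig, setT sig -> (0 <= (h sig ^+ 2)%:E)%E.
  by move=> sig _; rewrite lee_fin sqr_ge0.
have p2 (h : Om -> R) : forall sig, setT sig -> (0 <= 2%:E * (h sig ^+ 2)%:E)%E.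
  by move=> sig _; rewrite mule_ge0// lee_fin sqr_ge0.
rewrite ge0_integralD//; try exact: p2; try exact: measurable_funeM.
rewrite !ge0_integralZl_EFin//; try exact: p1.
rewrite (meanE mu bGc) -[X in (_ + X)%E]EFinM.
apply: (@le_trans _ _ (2%:E * e'%:E + (2 * mean mu (fun sig : Om => (cyls_eval G sig - c) ^+ 2))%:E)%E).
  by rewrite leeD// lee_wpmul2l.
rewrite -EFinM -!EFinD lee_fin -eK; apply: arith Hc EW; exact: ltW.
Qed.

End PoincareInequality.

Unset Implicit Arguments.

Theorem proposition3p3
    (R : realType) (n : nat) (M : riemannianManifold R n)
    (hM : stochastically_complete M)
    (T : R) (hT : 0 < T) (x0 : M)
    (mu : probability (path_space T x0) R)
    (D : vfield R M -> vfield R M -> vfield R M)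
    (hD : metric_connection D) (hDskew : skew_symmetric_torsion D)
    (par : path_space T x0 -> R -> tvec R M -> tvec R M)
    (hpar : stochastic_parallel_translation mu D par)
    (hclosable : closable_gradient mu par)
    (r0 C : R) (hr0 : 0 < r0) (hC : 0 < C)
    (hwlsi : forall s : R, 0 < s -> s < r0 ->
       forall (f : path_space T x0 -> R) (V : path_space T x0 -> R -> tvec R M),
         D12_gradient mu par f V ->
         (exists B : R, forall sig, `|f sig| <= B) ->
         (entropy mu (fun sig => (f sig ^+ 2)%R) <=
            (C * ln (1 / s))%:E * energy mu V
            + s%:E * ('N[mu]_+oo[EFin \o f]) ^+ 2)%E) :
  exists2 alpha : R, 0 < alpha &
    forall (f : path_space T x0 -> R) (V : path_space T x0 -> R -> tvec R M),
      D12_gradient mu par f V ->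
      ('V_mu[f] <= alpha%:E * energy mu V)%E.
Proof.
have [hP _ _] := hpar.
apply: (poincare_D12 _ hr0 hC hwlsi).
by apply: aeS hP => sig [].
Qed.
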